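(* Let $\Delta$ be a connected $d$-dimensional normal pseudomanifold without boundary, where $d\ge3$. If $\Delta$ is not simply-connected, then $g_2(\Delta)\ge\binom{d+2}{2}$.
   Context: A $d$-dimensional simplicial complex $\Delta$ is a normal pseudomanifold without boundary if it is pure, every $(d-1)$-face lies in exactly two facets, and the link $\{H\in\Delta:H\cup G\in\Delta,H\cap G=\emptyset\}$ of every nonempty face $G$ of dimension $\le d-2$ is connected. With $f_i$ the number of $i$-dimensional faces ($f_{-1}=1$), $h_j=\sum_{i=0}^j(-1)^{j-i}\binom{d+1-i}{d+1-j}f_{i-1}$ and $g_2=h_2-h_1$; equivalently $g_2(\Delta)=f_1-(d+1)f_0+\binom{d+2}{2}$. Simple connectivity refers to the geometric realization. *)

(* Defs.v *)
From HB Require Import structures.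
From mathcomp Require Import all_boot all_order all_algebra.
From mathcomp Require Import all_classical all_reals all_analysis homotopy.

Set Implicit Arguments.
Unset Strict Implicit.
Unset Printing Implicit Defensive.

Import Order.TTheory GRing.Theory Num.Theory numFieldNormedType.Exports.

Local Open Scope classical_set_scope.
Local Open Scope ring_scope.

Section UnitInterval.
Variable R : realType.

Definition unit_interval : Type := set_type `[0, 1 : R]%classic.

HB.instance Definition _ :=
  Topological.copy unit_interval (set_type `[0, 1 : R]%classic).

Let ui0_in : (0 : R) \in `[0, 1 : R]%classic.
Proof. by rewrite inE /= in_itv /= lexx ler01. Qed.

Let ui1_in : (1 : R) \in `[0, 1 : R]%classic.
Proof. by rewrite inE /= in_itv /= lexx ler01. Qed.

Let ui0_neq_ui1 :
  (exist _ 0 ui0_in : unit_interval) != (exist _ 1 ui1_in : unit_interval).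
Proof. by apply/eqP => -[] /esym /eqP; rewrite oner_eq0. Qed.

HB.instance Definition _ := isBiPointed.Build unit_interval ui0_neq_ui1.

End UnitInterval.

Section SimplyConnected.
Variables (R : realType) (T : topologicalType).
Local Notation I := (unit_interval R).

Definition path_connected := forall x y : T, inhabited {path I from x to y in T}.

Definition path_homotopic (x y : T) (p q : {path I from x to y in T}) :=
  exists H : I * I -> T,
    [/\ continuous H,
        forall s, H (s, zero) = p s,
        forall s, H (s, one) = q s,
        forall t, H (zero, t) = x &
        forall t, H (one, t) = y].

Definition simply_connected :=
  path_connected /\
  forall (x : T) (p : {path I from x to x in T}), path_homotopic p (cst x).

End SimplyConnected.

Section SimplicialComplex.
Variable V : finType.
Implicit Types (D : {set {set V}}) (F G H : {set V}).

(* The elements of V need not all be vertices: the vertices of D are the v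
   such that [set v] \in D.  A face of dimension k is a face of cardinality
   k + 1; the empty face belongs to every complex. *)
Definition simplicial_complex D :=
  finset.set0 \in D /\ forall F G, G \subset F -> F \in D -> G \in D.

Definition facet D F : bool := maxset (fun G => G \in D) F.

Definition link D G : {set {set V}} :=
  [set H in D | (H :|: G \in D) && (H :&: G == finset.set0)]%SET.

(* Points are given by their barycentric coordinates.  As V is finite, the
   product topology induces on the set below the usual (coherent) topology. *)
Definition realization (R : realType) D : set {ptws V -> R} :=
  [set x | [/\ forall v, 0 <= x v, \sum_v x v = 1 &
               [set v | x v != 0]%SET \in D]].
Arguments realization : clear implicits.

(* In terms of cardinality: facets have d + 1 elements, (d-1)-faces have d, and
   faces of dimension at most d - 2 have fewer than d. *)
Definition normal_pseudomanifold (R : realType) (d : nat) D :=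
  [/\ simplicial_complex D,
      forall F, facet D F -> #|F| = d.+1,
      forall G, G \in D -> #|G| = d ->
        #|[set F | facet D F & G \subset F]%SET| = 2%N &
      forall G, G \in D -> G != finset.set0 -> (#|G| < d)%N ->
        connected (realization R (link D G))].

(* f_{k-1}, the number of faces with k elements *)
Definition face_num D (k : nat) : nat := #|[set F in D | #|F| == k]%SET|.

Definition h_num (d : nat) D (j : nat) : int :=
  \sum_(i < j.+1)
    (-1) ^+ (j - i) * 'C(d.+1 - i, d.+1 - j)%:Z * (face_num D i)%:Z.

Definition g2 (d : nat) D : int := h_num d D 2 - h_num d D 1.

End SimplicialComplex.

Arguments realization {V} R D.

(* Main.v *)
(** Put the vertices at generic points p_v of R^(d+2), and consider vector
    fields w with w_u.p_v + w_v.p_u = 0 for every edge uv and every loop uu.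
    The link of a vertex is a minimal mod 2 cycle, so it is generically rigid by
    Fogelsanger's theorem, and coning makes the star of every vertex rigid: on
    each star w_u = p_u A for a skew-symmetric matrix A, and adjacent stars,
    sharing a facet, have the same A.

    If the realization is not simply connected, then the edge-path group pi is
    nontrivial.  Lift the equations to the universal cover: modulo pi there are
    (d+2) f_0 unknowns and f_0 + f_1 equations.  As loops connect the sheets, the
    matrix A is the same everywhere, so every solution is constant on fibres.
    If pi is infinite, a square-summable solution is therefore zero, and counting
    dimensions by the trace on the group ring gives (d+2) f_0 <= f_0 + f_1.  If
    pi is finite, a solution of zero sum on each fibre is zero, with the same
    conclusion.  This says (d+1) f_0 <= f_1, that is g_2 >= binomial(d+2, 2). *)

From HB Require Import structures.
Require Import Defs.
From mathcomp Require Import all_boot all_order all_algebra.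
From mathcomp Require Import ring lra.

Set Implicit Arguments.
Unset Strict Implicit.
Unset Printing Implicit Defensive.

Import Order.TTheory GRing.Theory Num.Theory.

(** * Generic rigidity *)

(** The target constant is a dimension. On the complex itself the solutions contain all [p_v A], a
    space of dimension binomial(d+2, 2), and counting there gives only g_2 >= 0. The lift removes
    exactly these: a nonzero constant is neither square-summable over an infinite group nor of zero
    sum over a finite one. Keeping the loops makes the frameworks linear instead of affine. Trivial
    motions have no translation part, and coning adds one dimension, from R^(d+1) for links to
    R^(d+2) for stars. Skew matrices of size n that agree on n - 1 independent points coincide, and
    a facet has d + 1 = n - 1 vertices. Contracting an edge of a minimal cycle may destroy
    minimality. In Fogelsanger's theorem the cells off the edge are therefore split into pieces
    whose contractions stay minimal, up to one degenerate case; pieces are rigid by induction and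
    vertex splitting, and neighbouring pieces share enough vertices to be glued. The trace count
    uses finitely supported vectors only: if M has no square-summable kernel, the powers of 1 - t
    M^T M decay, and tau(AB) = tau(BA) compares their traces with those of 1 - t M M^T. *)

Section Gram.
Local Open Scope ring_scope.
Variables (R : realFieldType).

(** The Gram determinant: one polynomial in the entries that detects full column rank without
    selecting a minor. *)
Definition detg (I K : finType) (c : K -> I -> R) : R :=
  \det (\matrix_(i < #|I|, i' < #|I|)
     \sum_k c k (enum_val i) * c k (enum_val i')).

(** The quadratic form of the Gram matrix is a sum of squares, so over an ordered field its kernel
    is that of [c]. *)
Lemma detg_neq0P (I K : finType) (c : K -> I -> R) :
  detg c != 0 <->
  (forall w : I -> R, (forall k, \sum_i c k i * w i = 0) -> forall i, w i = 0).
Proof.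
rewrite /detg; set G := (X in \det X).
pose wv (w : I -> R) : 'rV[R]_#|I| := \row_i w (enum_val i).
have quad w : (wv w *m G *m (wv w)^T) 0 0 = \sum_k (\sum_i c k i * w i) ^+ 2.
  rewrite mxE; under eq_bigr => i _ do rewrite !mxE.
  under eq_bigr => i _ do (under eq_bigr => j _ do rewrite !mxE mulr_sumr;
    rewrite exchange_big mulr_suml).
  rewrite exchange_big; apply: eq_bigr => k _.
  rewrite expr2 (reindex (@enum_val I predT)) /=; last first.
    by exists enum_rank => x _; rewrite ?enum_valK ?enum_rankK.
  rewrite mulr_sumr; apply: eq_bigr => i _.
  rewrite !mulr_suml; apply: eq_bigr => j _; ring.
split=> [d0 w ker|inj].
- have wG : wv w *m G = 0.
    apply/rowP => i; rewrite !mxE.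
    under eq_bigr => j _ do rewrite !mxE mulr_sumr.
    rewrite exchange_big big1 // => k _.
    transitivity ((\sum_i c k i * w i) * c k (enum_val i)); last by rewrite ker mul0r.
    rewrite (reindex (@enum_val I predT)) /=; last first.
      by exists enum_rank => x _; rewrite ?enum_valK ?enum_rankK.
    by rewrite mulr_suml; apply: eq_bigr => j _; ring.
  have Gu : G \in unitmx by rewrite unitmxE unitfE.
  have w0 : wv w = 0 by rewrite -(mulmxK Gu (wv w)) wG mul0mx.
  move=> i; have /rowP/(_ (enum_rank i)) := w0.
  by rewrite !mxE enum_rankK.
- apply/det0P => -[x x0 xG]; case/eqP: x0.
  pose w i := x 0 (enum_rank i).
  have xw : x = wv w by apply/rowP => i; rewrite !mxE /w enum_valK.
  have := quad w; rewrite -xw xG mul0mx mxE => /esym/eqP.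
  rewrite psumr_eq0 => [/allP q0|k _]; last exact: sqr_ge0.
  apply/rowP => i; rewrite xw !mxE; apply: inj => k.
  by apply/eqP; rewrite -sqrf_eq0; apply: q0; rewrite mem_index_enum.
Qed.

Definition ispoly (f : R -> R) := exists P : {poly R}, forall t, f t = P.[t].

Lemma ispoly_cst (a : R) : ispoly (fun=> a).
Proof. by exists a%:P => t; rewrite hornerC. Qed.

Lemma ispoly_id : ispoly id.
Proof. by exists 'X => t; rewrite hornerX. Qed.

Lemma ispolyD f g : ispoly f -> ispoly g -> ispoly (fun t => f t + g t).
Proof. by move=> [P fP] [Q gQ]; exists (P + Q) => t; rewrite hornerD fP gQ. Qed.

Lemma ispolyM f g : ispoly f -> ispoly g -> ispoly (fun t => f t * g t).
Proof. by move=> [P fP] [Q gQ]; exists (P * Q) => t; rewrite hornerM fP gQ. Qed.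

Lemma ispoly_sum (I : finType) (A : pred I) (f : I -> R -> R) :
  (forall i, ispoly (f i)) -> ispoly (fun t => \sum_(i | A i) f i t).
Proof.
move=> /fin_all_exists[P fP]; exists (\sum_(i | A i) P i) => t.
by rewrite horner_sum; apply: eq_bigr => i _; rewrite fP.
Qed.

Lemma ispoly_detg (I K : finType) (c : R -> K -> I -> R) :
  (forall k i, ispoly (fun t => c t k i)) -> ispoly (fun t => detg (c t)).
Proof.
move=> cP.
have /fin_all_exists[Q QP] (ij : 'I_#|I| * 'I_#|I|) :
    ispoly (fun t => \sum_k c t k (enum_val ij.1) * c t k (enum_val ij.2)).
  by apply: ispoly_sum => k; apply: ispolyM.
exists (\det (\matrix_(i, j) Q (i, j))) => t.
rewrite -horner_evalE -det_map_mx /detg; congr (\det _).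
by apply/matrixP => i j; rewrite !mxE (QP (i, j)).
Qed.

Lemma nonroot (P : {poly R}) : P != 0 -> exists t, P.[t] != 0.
Proof.
move=> P0; pose s := [seq i%:R : R | i <- iota 0 (size P)].
have us : uniq s.
  by rewrite map_inj_uniq ?iota_uniq // => i j /eqP; rewrite eqr_nat => /eqP.
have : ~~ all (root P) s.
  apply/negP => /(max_poly_roots P0)/(_ us).
  by rewrite size_map size_iota ltnn.
by case/allPn => t _ ?; exists t.
Qed.

Lemma ispoly_nonroot2 f g a b : ispoly f -> ispoly g -> f a != 0 -> g b != 0 ->
  exists t, f t != 0 /\ g t != 0.
Proof.
move=> [P fP] [Q gQ] fa gb.
have [|t] := @nonroot (P * Q).
  apply: mulf_neq0; [move: fa | move: gb]; rewrite ?fP ?gQ; apply: contraNneq => ->;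
  by rewrite horner0.
by rewrite hornerM mulf_eq0 negb_or => /andP[? ?]; exists t; rewrite fP gQ.
Qed.

End Gram.

(** * Generic configurations *)

Section Generic.
Local Open Scope ring_scope.
Variables (R : realFieldType) (V : finType) (n : nat).
Implicit Types (p q : V -> 'rV[R]_n) (S T B : {set V}).

Definition line p q (t : R) v := p v + t *: (q v - p v).

Lemma line0 p q : line p q 0 =1 p.
Proof. by move=> v; rewrite /line scale0r addr0. Qed.

Lemma line1 p q : line p q 1 =1 q.
Proof. by move=> v; rewrite /line scale1r addrCA subrr addr0. Qed.

(* Polynomiality along lines stands in for multivariate polynomials: it suffices
   to intersect two generic properties. *)
Definition generic (P : (V -> 'rV[R]_n) -> Prop) :=
  exists f : (V -> 'rV[R]_n) -> R,
  [/\ forall p q, ispoly (fun t => f (line p q t)),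
      forall p q, p =1 q -> f p = f q,
      exists p, f p != 0 &
      forall p, f p != 0 -> P p].

Lemma generic_ex P : generic P -> exists p, P p.
Proof. by move=> [f [_ _ [p fp] fP]]; exists p; apply: fP. Qed.

Lemma genericW (P Q : _ -> Prop) : (forall p, P p -> Q p) -> generic P -> generic Q.
Proof. by move=> PQ [f [? ? ? fP]]; exists f; split=> // p /fP/PQ. Qed.

Lemma generic_true (P : _ -> Prop) : (forall p, P p) -> generic P.
Proof.
move=> all; exists (fun=> 1); split=> //; first by move=> *; apply: ispoly_cst.
by exists (fun=> 0); apply: oner_neq0.
Qed.

(** On the line from a configuration good for [P] to one good for [Q], both test functions are
    nonzero polynomials, hence have a common non-root. *)
Lemma generic_and P Q : generic P -> generic Q -> generic (fun p => P p /\ Q p).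
Proof.
move=> [f [pf ef [p fp] fP]] [g [pg eg [q gq] gQ]].
exists (fun p => f p * g p); split.
- by move=> *; apply: ispolyM.
- by move=> p1 q1 e; rewrite (ef _ _ e) (eg _ _ e).
- have [||t [ft gt]] := ispoly_nonroot2 (a := 0) (b := 1) (pf p q) (pg p q).
  + by rewrite (ef _ _ (line0 p q)).
  + by rewrite (eg _ _ (line1 p q)).
  by exists (line p q t); apply: mulf_neq0.
- by move=> p1; rewrite mulf_eq0 negb_or => /andP[/fP ? /gQ].
Qed.

Lemma generic_forall (I : finType) (P : I -> _ -> Prop) :
  (forall i, generic (P i)) -> generic (fun p => forall i, P i p).
Proof.
move=> gP.
suff: forall s : seq I, generic (fun p => forall i, i \in s -> P i p).
  by move/(_ (enum I)); apply: genericW => p h i; apply: h; rewrite mem_enum.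
elim=> [|i s IH]; first exact: generic_true.
have := generic_and (gP i) IH; apply: genericW => p [Pi Ps] j.
by rewrite inE => /predU1P[->|/Ps].
Qed.

Definition indep p B :=
  forall w : V -> R, \sum_(b in B) w b *: p b = 0 -> forall b, b \in B -> w b = 0.

(** The rows [inr u] force a relation to vanish off [B], so that independence of a subfamily becomes
    full column rank over all of [V]. *)
Definition indepc B p (k : 'I_n + V) (v : V) : R :=
  match k with
  | inl j => if v \in B then p v 0 j else 0
  | inr u => ((v == u) && (u \notin B))%:R
  end.

Lemma indepcP B p : detg (indepc B p) != 0 <-> indep p B.
Proof.
rewrite detg_neq0P; split=> inj w h.
- pose w' v := if v \in B then w v else 0.
  move=> b bB; have := inj w'; rewrite /w' => /(_ _ b); rewrite bB; apply=> -[j|u] /=.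
    have /rowP/(_ j) := h; rewrite !mxE summxE => e.
    rewrite -[RHS]e [RHS]big_mkcond; apply: eq_bigr => v _.
    by case: ifP => _; rewrite ?mulr0 // !mxE mulrC.
  rewrite big1 // => v _; case: eqP => [->|_] /=; last by rewrite mul0r.
  by case: ifP; rewrite ?mulr0 // mul0r.
- have w0 v : v \notin B -> w v = 0.
    move=> vB; have := h (inr v); rewrite (bigD1 v) //= eqxx vB mul1r.
    by rewrite big1 ?addr0 // => u /negPf ->; rewrite mul0r.
  move=> v; have [vB|/w0//] := boolP (v \in B); apply: inj vB.
  apply/rowP => j; rewrite summxE mxE -[RHS](h (inl j)) [LHS]big_mkcond.
  by apply: eq_bigr => u _ /=; case: ifP => _; rewrite ?mul0r // !mxE mulrC.
Qed.

Lemma indepc_poly B p q k v : ispoly (fun t => indepc B (line p q t) k v).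
Proof.
case: k => [j|u] /=; last exact: ispoly_cst.
case: (v \in B); last exact: ispoly_cst.
have [P PE] : ispoly (fun t => p v 0 j + t * (q v 0 j - p v 0 j)).
  apply: ispolyD; first exact: ispoly_cst.
  by apply: ispolyM; [exact: ispoly_id|exact: ispoly_cst].
by exists P => t; rewrite -PE !mxE.
Qed.

Lemma eq_detg (I K : finType) (c c' : K -> I -> R) :
  (forall k i, c k i = c' k i) -> detg c = detg c'.
Proof.
move=> e; rewrite /detg; congr (\det _); apply/matrixP => i j; rewrite !mxE.
by apply: eq_bigr => k _; rewrite !e.
Qed.

Lemma generic_indep B : (#|B| <= n)%N -> generic (indep ^~ B).
Proof.
move=> Bn; exists (fun p => detg (indepc B p)); split.
- by move=> p q; apply: ispoly_detg => k v; apply: indepc_poly.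
- by move=> p q e; apply: eq_detg => -[j|u] v //=; rewrite e.
(* The elements of [B] are placed at distinct basis vectors, numbered by their position in
   [enum B]. *)
- exists (fun v => \row_j (index v (enum B) == j)%:R); apply/indepcP => w + b bB.
  have bn : (index b (enum B) < n)%N.
    by apply: leq_trans Bn; rewrite cardE index_mem mem_enum.
  move/rowP/(_ (Ordinal bn)); rewrite summxE mxE (bigD1 b) //= !mxE eqxx mulr1.
  rewrite big1 ?addr0 // => v /andP[vB vb]; rewrite !mxE.
  case: eqP => [/= e|_]; last by rewrite mulr0.
  case/eqP: vb; rewrite -[v](nth_index b (s := enum B)) ?mem_enum // e.
  by rewrite nth_index ?mem_enum.
- by move=> p /indepcP.
Qed.

Definition gpos p := forall B, (#|B| <= n)%N -> indep p B.

Lemma generic_gpos : generic gpos.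
Proof.
apply: generic_forall => B; case: (leqP #|B| n) => [/generic_indep|_].
  exact: genericW.
exact: generic_true.
Qed.

End Generic.

(** * Rigidity of linear frameworks *)

Section Rigid.
Local Open Scope ring_scope.
Variables (R : realFieldType) (V : finType) (n : nat).
Implicit Types (p q w : V -> 'rV[R]_n) (S T B : {set V}) (A : 'M[R]_n).

Definition dot m (x y : 'rV[R]_m) := \sum_j x 0 j * y 0 j.

Lemma dotC m (x y : 'rV[R]_m) : dot x y = dot y x.
Proof. by apply: eq_bigr => j _; rewrite mulrC. Qed.

Lemma dotDl m (x y z : 'rV[R]_m) : dot (x + y) z = dot x z + dot y z.
Proof. by rewrite -big_split; apply: eq_bigr => j _; rewrite mxE mulrDl. Qed.

Lemma dotZl m a (x y : 'rV[R]_m) : dot (a *: x) y = a * dot x y.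
Proof. by rewrite mulr_sumr; apply: eq_bigr => j _; rewrite mxE mulrA. Qed.

Lemma dotNl m (x y : 'rV[R]_m) : dot (- x) y = - dot x y.
Proof. by rewrite -scaleN1r dotZl mulN1r. Qed.

Lemma dot0l m (y : 'rV[R]_m) : dot 0 y = 0.
Proof. by rewrite /dot big1 // => j _; rewrite mxE mul0r. Qed.

Lemma dotE m (x y : 'rV[R]_m) : dot x y = (x *m y^T) 0 0.
Proof. by rewrite mxE; apply: eq_bigr => j _; rewrite mxE. Qed.

Lemma dot_skew A (x y : 'rV[R]_n) : A^T = - A -> dot (x *m A) y + dot (y *m A) x = 0.
Proof.
move=> skA; rewrite (dotC (y *m A)) !dotE trmx_mul skA mulNmx mulmxN mulmxA.
by rewrite [X in _ + X]mxE subrr.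
Qed.

Definition motion (E : rel V) p w :=
  forall a b, E a b -> dot (w a) (p b) + dot (w b) (p a) = 0.

(* Loops in E express that the motion w a is orthogonal to p a. *)
Definition rigid (E : rel V) p S :=
  forall w, motion E p w ->
  exists2 A, A^T = - A & forall v, v \in S -> w v = p v *m A.

Lemma rigid_sub E p S T : T \subset S -> rigid E p S -> rigid E p T.
Proof.
by move=> /subsetP TS rS w /rS[A skA wA]; exists A => // v /TS; apply: wA.
Qed.

Lemma motion_sub (E F : rel V) p w : subrel F E -> motion E p w -> motion F p w.
Proof. by move=> FE mw a b /FE; apply: mw. Qed.

Lemma rigid_edges (E F : rel V) p S : subrel F E -> rigid F p S -> rigid E p S.
Proof. by move=> FE rS w /(motion_sub FE)/rS. Qed.

Lemma indep_row_free p B : indep p B -> row_free (\matrix_(i < #|B|) p (enum_val i)).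
Proof.
move=> ind; rewrite -kermx_eq0; apply/rowV0P => x /sub_kermxP x0.
apply/rowP => i; pose r := enum_rank_in (enum_valP i).
have := ind (fun b => x 0 (r b)) _ _ (enum_valP i).
rewrite /r enum_valK_in mxE; apply.
rewrite big_enum_val -[RHS]x0 mulmx_sum_row; apply: eq_bigr => j _.
by rewrite enum_valK_in rowK.
Qed.

(** Vanishing on n - 1 independent rows leaves rank at most 1, and no skew matrix has rank 1. Hence
    n - 1 common points suffice for gluing. *)
Lemma skew_eq0 p B A : indep p B -> (n <= #|B|.+1)%N -> A^T = - A ->
  (forall b, b \in B -> p b *m A = 0) -> A = 0.
Proof.
move=> /indep_row_free; set X := \matrix_(_ < _) _ => Xf Bn skA pA.
have XA : X *m A = 0.
  by apply/row_matrixP => i; rewrite row_mul rowK pA ?enum_valP // row0.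
have rA : (\rank A <= 1)%N.
  have := mulmx0_rank_max XA; rewrite (eqP Xf) => h.
  by rewrite -(leq_add2l #|B|) addn1 (leq_trans h).
have [//|/rowV0Pn[z zA z0]] := eqVneq A 0.
have Az : (A <= z)%MS.
  by rewrite -(geq_leqif (mxrank_leqif_sup zA)) rank_rV z0.
have [c cE] := submxP Az.
(* A = c z and z = y A give z A z^T = 0 and y c = 1, hence A = 0 *)
have [y yE] := submxP zA.
have zAz : z *m A *m z^T = 0.
  apply/matrixP => i j; rewrite !ord1 -dotE [RHS]mxE; have := dot_skew z z skA.
  by move/eqP; rewrite -mulr2n mulrn_eq0 => /eqP.
have zc : z *m c *m (z *m z^T) = 0 by rewrite mulmxA -(mulmxA z c) -cE.
have zz : (z *m z^T) 0 0 != 0.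
  rewrite -dotE /dot; apply: contra_neq z0 => /eqP.
  rewrite psumr_eq0 => [/allP h|j _]; last by rewrite -expr2 sqr_ge0.
  apply/rowP => j; apply/eqP; rewrite mxE -sqrf_eq0 expr2.
  by apply: h; rewrite mem_index_enum.
have zA0 : z *m A = 0.
  move/matrixP/(_ 0 0): zc; rewrite mxE big_ord1 [RHS]mxE => /eqP.
  rewrite mulf_eq0 (negPf zz) orbF => /eqP zc.
  rewrite cE mulmxA [z *m c]mx11_scalar zc (_ : 0%:M = 0) ?mul0mx //.
  by apply/matrixP => i j; rewrite !mxE mul0rn.
have Az0 : A *m z^T = 0.
  by rewrite -[A]trmxK skA linearN /= mulNmx -trmx_mul zA0 trmx0 oppr0.
have : z *m z^T = 0 by rewrite {1}yE -mulmxA Az0 mulmx0.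
by move/matrixP/(_ 0 0); rewrite [RHS]mxE => /eqP; rewrite (negPf zz).
Qed.

(** With the points as rows of [X] and the vectors as rows of [W], the edges and loops say exactly
    that [W X^T] is skew. *)
Lemma clique_rigid (E : rel V) p B : indep p B ->
  (forall a b, a \in B -> b \in B -> E a b) -> rigid E p B.
Proof.
move=> /indep_row_free; set X := \matrix_(_ < _) _ => Xf Ecl w mw.
pose W := \matrix_(i < #|B|) w (enum_val i).
have [Y XY] := row_freeP Xf.
have S_skew : X *m W^T = - (W *m X^T).
  apply/matrixP => i j; have := mw _ _ (Ecl _ _ (enum_valP i) (enum_valP j)).
  rewrite !mxE; move/eqP; rewrite addrC addr_eq0 => /eqP e.
  transitivity (dot (w (enum_val j)) (p (enum_val i))).
    by apply: eq_bigr => k _; rewrite !mxE mulrC.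
  by rewrite e; congr (- _); apply: eq_bigr => k _; rewrite !mxE.
(* Since [X Y = 1], the matrix [Y W] has the right values. Subtracting its transpose makes it skew,
   and the last term, skew as well, restores the values. *)
exists (Y *m W - (Y *m W)^T - Y *m (W *m X^T) *m Y^T).
  have trB (M N : 'M[R]_n) : (M - N)^T = M^T - N^T.
    by apply/matrixP => i j; rewrite !mxE.
  rewrite !trB trmxK !trmx_mul !trmxK S_skew !(mulmxN, mulNmx) !mulmxA.
  by apply/matrixP => i j; rewrite !mxE; ring.
suff XA : X *m (Y *m W - (Y *m W)^T - Y *m (W *m X^T) *m Y^T) = W.
  move=> v vB; move/row_matrixP/(_ (enum_rank_in vB v)): XA.
  by rewrite row_mul !rowK enum_rankK_in.
rewrite !mulmxBr !mulmxA XY !mul1mx trmx_mul mulmxA S_skew.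
by apply/matrixP => i j; rewrite !(mulNmx, mulmxA) !mxE; ring.
Qed.

Lemma rigid_glue (E : rel V) p S T B : rigid E p S -> rigid E p T ->
  B \subset S -> B \subset T -> indep p B -> (n <= #|B|.+1)%N ->
  rigid E p (S :|: T).
Proof.
move=> rS rT /subsetP BS /subsetP BT ind Bn w mw.
have [A skA wA] := rS _ mw; have [A' skA' wA'] := rT _ mw.
have /eqP : A - A' = 0.
  apply: skew_eq0 ind Bn _ _.
    by rewrite linearB /= skA skA' opprD opprK.
  by move=> b bB; rewrite mulmxBr -wA ?BS // -wA' ?BT // subrr.
rewrite subr_eq0 => /eqP AA'; rewrite -{}AA' in wA'.
by exists A => // v; rewrite inE => /orP[/wA|/wA'].
Qed.

(* Coefficients of the linear system saying that w is a motion vanishing on B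
   and outside S. *)
Definition pinned (E : rel V) S B p (k : V * V + V * 'I_n) (i : V * 'I_n) : R :=
  match k with
  | inl ab => if E ab.1 ab.2 then
      (i.1 == ab.1)%:R * p ab.2 0 i.2 + (i.1 == ab.2)%:R * p ab.1 0 i.2 else 0
  | inr vj => ((i == vj) && ((vj.1 \in B) || (vj.1 \notin S)))%:R
  end.

Lemma sum_pair_delta (u : V) (f w : V * 'I_n -> R) :
  \sum_i ((i.1 == u)%:R * f i) * w i = \sum_j f (u, j) * w (u, j).
Proof.
transitivity (\sum_v \sum_j (v == u)%:R * f (v, j) * w (v, j)).
  by rewrite pair_bigA; apply: eq_bigr => -[].
rewrite (bigD1 u) //= eqxx [X in _ + X]big1 ?addr0 => [|v /negPf ->].
  by apply: eq_bigr => j _; rewrite mul1r.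
by rewrite big1 // => j _; rewrite mul0r mul0r.
Qed.

Lemma sum_pinned (E : rel V) S B p (w : V * 'I_n -> R) a b : E a b ->
  \sum_i pinned E S B p (inl (a, b)) i * w i =
  dot (\row_j w (a, j)) (p b) + dot (\row_j w (b, j)) (p a).
Proof.
move=> Eab /=; rewrite Eab.
under eq_bigr => i _ do rewrite mulrDl; rewrite big_split /=.
rewrite (sum_pair_delta a (fun i => p b 0 i.2)).
rewrite (sum_pair_delta b (fun i => p a 0 i.2)) /=.
by congr (_ + _); apply: eq_bigr => j _; rewrite mxE mulrC.
Qed.

Lemma pinnedP E S B p :
  detg (pinned E S B p) != 0 <->
  (forall w, motion E p w -> (forall v, (v \in B) || (v \notin S) -> w v = 0) ->
   forall v, w v = 0).
Proof.
rewrite detg_neq0P; split=> inj w.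
- move=> mw w0 v; apply/rowP => j; rewrite mxE.
  have rowE u : \row_j w u 0 j = w u by apply/rowP => k; rewrite mxE.
  apply: (inj (fun i => w i.1 0 i.2) _ (v, j)) => -[[a b]|[u l]].
    have [Eab|/negPf Eab] := boolP (E a b); first by rewrite sum_pinned // !rowE mw.
    by rewrite /= Eab big1 // => i _; rewrite mul0r.
  rewrite (bigD1 (u, l)) //= eqxx big1 ?addr0 => [|i /negPf ->]; last by rewrite mul0r.
  by have [/w0 ->|_] := boolP ((u \in B) || _); rewrite ?mul0r // mxE mulr0.
- move=> h [v j]; pose w' u : 'rV[R]_n := \row_j w (u, j).
  have /rowP/(_ j) : w' v = 0; last by rewrite !mxE.
  apply: inj => [a b Eab|u uB]; first by rewrite -(sum_pinned S B _ _ Eab).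
  apply/rowP => l; have := h (inr (u, l)); rewrite (bigD1 (u, l)) //= eqxx uB mul1r.
  by rewrite big1 ?addr0 => [|i /negPf ->]; rewrite ?mul0r // !mxE.
Qed.

(** On the clique [B] every motion agrees with a trivial one; the difference, cut off outside [S],
    is pinned and hence zero. *)
Lemma pinned_rigid E S B p : detg (pinned E S B p) != 0 -> indep p B ->
  (forall a b, E a b -> (a \in S) && (b \in S)) ->
  (forall a b, a \in B -> b \in B -> E a b) -> rigid E p S.
Proof.
move=> /pinnedP inj ind ES Ecl w mw.
have [A skA wA] := clique_rigid ind Ecl mw.
exists A => // v vS; apply/eqP; rewrite -subr_eq0; apply/eqP.
have := inj (fun v => if v \in S then w v - p v *m A else 0).
move/(_ _ _ v); rewrite vS; apply=> [a b Eab|u].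
  have /andP[-> ->] := ES _ _ Eab.
  rewrite !dotDl !dotNl addrACA mw // add0r -opprD dot_skew ?oppr0 //.
by case/orP=> [/wA ->|/negPf -> //]; rewrite subrr if_same.
Qed.

Lemma rigid_pinned E S B p : rigid E p S -> indep p B -> (n <= #|B|.+1)%N ->
  B \subset S -> detg (pinned E S B p) != 0.
Proof.
move=> rS ind Bn /subsetP BS; apply/pinnedP => w /rS[A skA wA] w0 v.
have A0 : A = 0.
  by apply: skew_eq0 ind Bn skA _ => b bB; rewrite -wA ?BS // w0 // bB.
have [vS|vS] := boolP (v \in S); last by rewrite w0 // vS orbT.
by rewrite wA // A0 mulmx0.
Qed.

Lemma pinned_poly E S B (p : R -> V -> 'rV[R]_n) k i :
  (forall v j, ispoly (fun t => p t v 0 j)) -> ispoly (fun t => pinned E S B (p t) k i).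
Proof.
move=> pp; case: k => [[a b]|u] /=; last exact: ispoly_cst.
case: (E a b); last exact: ispoly_cst.
by apply: ispolyD; apply: ispolyM; rewrite //; apply: ispoly_cst.
Qed.

Lemma line_poly p q v j : ispoly (fun t => line p q t v 0 j).
Proof.
have [P PE] : ispoly (fun t => p v 0 j + t * (q v 0 j - p v 0 j)).
  apply: ispolyD; first exact: ispoly_cst.
  by apply: ispolyM; [exact: ispoly_id|exact: ispoly_cst].
by exists P => t; rewrite -PE !mxE.
Qed.

(** Rigidity is implied by the nonvanishing of a polynomial and the independence of [B], so one
    configuration [p0], possibly very special, proves it generically. *)
Lemma generic_pinned_rigid (E : rel V) S B p0 : (n <= #|B|.+1)%N -> (#|B| <= n)%N ->
  B \subset S ->
  (forall a b, E a b -> (a \in S) && (b \in S)) ->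
  (forall a b, a \in B -> b \in B -> E a b) ->
  detg (pinned E S B p0) != 0 -> generic (fun p => rigid E p S).
Proof.
move=> nB Bn BS ES Ecl d0.
have gd : generic (fun p => detg (pinned E S B p) != 0).
  exists (fun p => detg (pinned E S B p)); split=> //; last by exists p0.
    move=> p q; apply: ispoly_detg => k i; apply: pinned_poly => v j.
    exact: line_poly.
  move=> p q e; apply: eq_detg => -[[a b]|u] i //=; by rewrite !e.
have := generic_and gd (generic_indep R Bn); apply: genericW => p [dp ip].
exact: pinned_rigid dp ip ES Ecl.
Qed.

End Rigid.

(** * Vertex splitting *)

Section Split.
Local Open Scope ring_scope.
Variables (R : realFieldType) (V : finType) (n : nat).
Implicit Types (p q w : V -> 'rV[R]_n) (S T B : {set V}) (A : 'M[R]_n).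

Lemma indep_comp p (f : V -> V) B :
  {in B &, injective f} -> indep p (f @: B) -> indep (p \o f) B.
Proof.
move=> inj ind w w0 b bB.
pose w' c := if [pick x in B | f x == c] is Some x then w x else 0.
have w'E x : x \in B -> w' (f x) = w x.
  move=> xB; rewrite /w'; case: pickP => [y /andP[yB /eqP/inj-> //]|/(_ x)].
  by rewrite xB eqxx.
rewrite -w'E //; apply: ind; last exact: imset_f.
rewrite big_imset //= -[RHS]w0; apply: eq_bigr => x xB.
by rewrite w'E.
Qed.

(** The complement of n - 1 independent points is a line, spanned by [z]. In vertex splitting it is
    the direction in which [v] leaves [u]. *)
Lemma orth_complement p T : indep p T -> n = #|T|.+1 ->
  exists z : 'rV[R]_n, forall x : 'rV[R]_n,
    dot x z = 0 -> (forall c, c \in T -> dot x (p c) = 0) -> x = 0.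
Proof.
move=> /indep_row_free; set X := \matrix_(_ < _) _ => Xf nE.
have rk : \rank (kermx X^T) = 1%N.
  by rewrite mxrank_ker mxrank_tr (eqP Xf) nE subSn ?subnn.
have [z zK z0] : exists2 z : 'rV_n, (z <= kermx X^T)%MS & z != 0.
  by apply/rowV0Pn; rewrite -mxrank_eq0 rk.
exists z => x xz xT.
have : (x <= kermx X^T)%MS.
  apply/sub_kermxP/rowP => i; rewrite [RHS]mxE -(xT _ (enum_valP i)) !mxE.
  by apply: eq_bigr => j _; rewrite !mxE.
have zK' : (kermx X^T <= z)%MS.
  by rewrite -(geq_leqif (mxrank_leqif_sup zK)) rk rank_rV z0.
move=> /submx_trans/(_ zK')/sub_rVP[a xE]; move: xz; rewrite xE dotZl => /eqP.
rewrite mulf_eq0 => /predU1P[->|]; first by rewrite scale0r.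
rewrite /dot psumr_eq0 => [/allP h|j _]; last by rewrite -expr2 sqr_ge0.
case/eqP: z0; apply/rowP => j; apply/eqP; rewrite mxE -sqrf_eq0 expr2.
by apply: h; rewrite mem_index_enum.
Qed.

Definition merge (u v x : V) := if x == v then u else x.

(* Whiteley's vertex splitting.  Move v towards u along the line u + t z and
   divide the row of the edge uv by t; at t = 0 this row says that w u - w v is
   orthogonal to z, and the common neighbours force w u = w v. *)
Lemma split_rigid (E' E : rel V) S B T u v p0 :
  u != v -> u \in S -> v \in S -> u \notin T -> v \notin T -> (n = #|T|.+2)%N ->
  E u u -> E v v -> E u v -> (forall c, c \in T -> E u c && E v c) ->
  (forall a b, E a b -> (a \in S) && (b \in S)) ->
  (forall a b, E' a b ->
     exists a' b', [/\ E a' b', merge u v a' = a & merge u v b' = b]) ->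
  n = #|B|.+1 -> B \subset S -> (forall a b, a \in B -> b \in B -> E a b) ->
  ~~ ((u \in B) && (v \in B)) ->
  gpos p0 -> rigid E' p0 (S :\ v) ->
  generic (fun p : V -> 'rV[R]_n => rigid E p S).
Proof.
move=> uv uS vS uT vT nT Euu Evv Euv ET ES EE' nB BS Ecl uvB gp rE'.
have [z zP] : exists z : 'rV[R]_n, forall x : 'rV[R]_n, dot x z = 0 ->
    (forall c, c \in u |: T -> dot x (p0 c) = 0) -> x = 0.
  have cT : #|u |: T| = #|T|.+1 by rewrite cardsU1 uT.
  by apply: orth_complement; [apply: gp|]; rewrite cT nT.
pose pt t x := if x == v then p0 u + t *: z else p0 x.
pose F t (k : V * V + V * 'I_n) (i : V * 'I_n) : R :=
  if k == inl (u, v) then ((i.1 == u)%:R - (i.1 == v)%:R) * z 0 i.2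
  else if k == inl (v, u) then 0 else pinned E S B (pt t) k i.
have mergeB : {in B &, injective (merge u v)}.
  move=> x y xB yB; rewrite /merge.
  case: eqP => [xv|_]; case: eqP => [yv|_] // e; move: uvB.
  - by rewrite xv yv.
  - by rewrite e yB -xv xB.
  - by rewrite -e xB -yv yB.
have mergeS x : x \in S -> merge u v x \in S :\ v.
  by rewrite !inE /merge; have [_ _|-> //] := eqVneq x v; rewrite uv.
have pt0 x : pt 0 x = p0 (merge u v x).
  by rewrite /pt /merge; case: eqP; rewrite // scale0r addr0.
have ind0 : indep (pt 0) B.
  have : indep (p0 \o merge u v) B.
    by apply: indep_comp => //; apply: gp; rewrite nB (leq_trans (leq_imset_card _ _)).
  move=> h w w0; apply: h; rewrite -[RHS]w0.
  by apply: eq_bigr => b _; rewrite pt0.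
have ptpoly x j : ispoly (fun t => pt t x 0 j).
  rewrite /pt; case: (x == v); last exact: ispoly_cst.
  have [P PE] : ispoly (fun t => p0 u 0 j + t * z 0 j).
    apply: ispolyD; first exact: ispoly_cst.
    by apply: ispolyM; [exact: ispoly_id|exact: ispoly_cst].
  by exists P => t; rewrite -PE !mxE.
have Fpoly : ispoly (fun t => detg (F t)).
  apply: ispoly_detg => k i; rewrite /F.
  case: (k == _); first exact: ispoly_cst.
  case: (k == _); first exact: ispoly_cst.
  exact: pinned_poly.
have Ipoly : ispoly (fun t => detg (indepc B (pt t))).
  apply: ispoly_detg => -[j|x] y /=; last exact: ispoly_cst.
  by case: (y \in B); [exact: ptpoly|exact: ispoly_cst].
have F0 : detg (F 0) != 0.
  apply/detg_neq0P => w kerF.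
  pose W x : 'rV[R]_n := \row_j w (x, j).
  have Wuvz : dot (W u - W v) z = 0.
    have := kerF (inl (u, v)); rewrite /F eqxx /=.
    under eq_bigr => i _ do rewrite mulrBl mulrBl.
    rewrite sumrB (sum_pair_delta u (fun i => z 0 i.2)).
    rewrite (sum_pair_delta v (fun i => z 0 i.2)) => e.
    rewrite dotDl dotNl -[RHS]e; congr (_ - _);
    by apply: eq_bigr => j _; rewrite mxE mulrC.
  have WE a b : E a b -> (a, b) != (u, v) -> (a, b) != (v, u) ->
      dot (W a) (pt 0 b) + dot (W b) (pt 0 a) = 0.
    move=> Eab /negPf nuv /negPf nvu; rewrite -(sum_pinned S B _ _ Eab).
    rewrite -[RHS](kerF (inl (a, b))); apply: eq_bigr => i _; congr (_ * _).
    by rewrite /F !(inj_eq inl_inj) nuv nvu.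
  have Wu : dot (W u) (p0 u) = 0.
    have := WE u u Euu; rewrite !xpair_eqE eqxx (negPf uv) => /(_ isT isT).
    by rewrite pt0 /merge (negPf uv) => /eqP; rewrite -mulr2n mulrn_eq0 => /eqP.
  have Wv : dot (W v) (p0 u) = 0.
    have := WE v v Evv; rewrite !xpair_eqE eqxx (eq_sym v u) (negPf uv) => /(_ isT isT).
    by rewrite pt0 /merge eqxx => /eqP; rewrite -mulr2n mulrn_eq0 => /eqP.
  have Wuv : W u = W v.
    apply/eqP; rewrite -subr_eq0; apply/eqP; apply: zP => // c.
    rewrite in_setU1 => /predU1P[->|cT]; first by rewrite dotDl dotNl Wu Wv subrr.
    have [/negPf cu /negPf cv] : c != u /\ c != v.
      by split; apply/eqP => e; move: cT; rewrite e ?(negPf uT) ?(negPf vT).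
    have /andP[Euc Evc] := ET _ cT.
    have := WE u c Euc; rewrite !xpair_eqE cu cv !andbF => /(_ isT isT).
    have := WE v c Evc; rewrite !xpair_eqE cu cv !andbF => /(_ isT isT).
    rewrite !pt0 /merge eqxx cv (negPf uv) => /eqP; rewrite addr_eq0 => /eqP e1.
    by move=> /eqP; rewrite addr_eq0 => /eqP e2; rewrite dotDl dotNl e1 e2 subrr.
  (* Since [W u = W v], the family [W] descends to a motion of the contracted framework, and it
     vanishes on the image of the clique [B]. *)
  have mW a : W (merge u v a) = W a by rewrite /merge; case: eqP => [->|].
  have mot : motion E' p0 W.
    move=> a b /EE'[a' [b' [Eab <- <-]]]; rewrite !mW.
    have [[-> ->]|nuv] := eqVneq (a', b') (u, v).
      by rewrite /merge eqxx (negPf uv) Wu Wv addr0.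
    have [[-> ->]|nvu] := eqVneq (a', b') (v, u).
      by rewrite /merge eqxx (negPf uv) Wu Wv addr0.
    by rewrite -!pt0 WE.
  have Wpin x : (x \in B) || (x \notin S) -> W x = 0.
    move=> xB; apply/rowP => l; have := kerF (inr (x, l)).
    rewrite (bigD1 (x, l)) //= {1}/F /= eqxx xB mul1r !mxE big1 ?addr0 // => i ne.
    by rewrite /F /= (negPf ne) mul0r.
  have [A skA WA] := rE' _ mot.
  have A0 : A = 0.
    apply: (@skew_eq0 _ _ _ p0 (merge u v @: B)) => //.
    - by apply: gp; rewrite nB (leq_trans (leq_imset_card _ _)).
    - by rewrite card_in_imset // nB.
    - move=> _ /imsetP[b bB ->]; rewrite -WA ?mW ?Wpin ?bB //.
      by rewrite mergeS ?(subsetP BS).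
  have W0 x : W x = 0.
    have [xS|xS] := boolP (x \in S); last by rewrite Wpin ?xS ?orbT.
    by rewrite -mW WA ?A0 ?mulmx0 ?mergeS.
  by move=> [x j]; have /rowP/(_ j) := W0 x; rewrite !mxE.
have [t [ft t0]] : exists t, detg (F t) * detg (indepc B (pt t)) != 0 /\ t != 0.
  apply: (@ispoly_nonroot2 _ (fun t => _) id 0 1); [exact: ispolyM|exact: ispoly_id| |exact: oner_neq0].
  by rewrite mulf_neq0 //; apply/indepcP.
move: ft; rewrite mulf_eq0 negb_or => /andP[/detg_neq0P Ft /indepcP It].
apply: (@generic_pinned_rigid _ _ _ E S B (pt t)); rewrite -?nB //; first by rewrite nB.
apply/detg_neq0P => w kerP; apply: Ft => k; rewrite /F.
have [_|_] := eqVneq k (inl (u, v)).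
- apply: (mulfI t0); rewrite mulr0 mulr_sumr.
  (* The loops make the division by t possible: the row of [uv] minus half the loop rows of [u] and
     [v] is t times the vector z at [u] and -z at [v]. *)
  transitivity (\sum_i pinned E S B (pt t) (inl (u, v)) i * w i
     - 2^-1 * (\sum_i pinned E S B (pt t) (inl (u, u)) i * w i)
     - 2^-1 * (\sum_i pinned E S B (pt t) (inl (v, v)) i * w i)); last first.
    by rewrite !kerP !mulr0 !subr0.
  rewrite !mulr_sumr -!sumrB; apply: eq_bigr => i _ /=.
  rewrite Euu Evv Euv /pt eqxx (negPf uv) !mxE; by field.
- have [_|_] := eqVneq k (inl (v, u)); last exact: kerP.
  by rewrite big1 // => i _; rewrite mul0r.
Qed.

End Split.

(** * Coning *)

Section Cone.
Local Open Scope ring_scope.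
Variables (R : realFieldType) (V : finType) (n : nat).

(* With the apex at the first basis vector, a motion fixing the apex has
   vanishing first coordinate and is a motion of the base. *)
Lemma cone_rigid (E' E : rel V) (S B : {set V}) v (p' : V -> 'rV[R]_n) :
  v \notin S -> (n <= #|B|.+1)%N -> (#|B| <= n)%N -> B \subset S -> indep p' B ->
  (forall a b, E' a b -> [&& a \in S, b \in S & E a b]) ->
  (forall a, a \in v |: S -> E v a && E a v) ->
  (forall a b, E a b -> (a \in v |: S) && (b \in v |: S)) ->
  (forall a b, a \in B -> b \in B -> E a b) ->
  rigid E' p' S -> generic (fun p : V -> 'rV[R]_n.+1 => rigid E p (v |: S)).
Proof.
move=> vS nB Bn BS ind E'E Ev ES Ecl rE'.
pose p x : 'rV[R]_(1 + n) := if x == v then row_mx 1 0 else row_mx 0 (p' x).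
have pv : p v = row_mx 1 0 by rewrite /p eqxx.
have pS x : x \in S -> p x = row_mx 0 (p' x).
  by rewrite /p; case: eqP => [->|//]; rewrite (negPf vS).
have vB : v \notin B by apply: contra vS; apply: (subsetP BS).
have indB : indep p (v |: B).
  move=> w; rewrite big_setU1 //= pv.
  rewrite (eq_bigr (fun b => row_mx 0 (w b *: p' b))); last first.
    by move=> b /(subsetP BS)/pS ->; rewrite scale_row_mx scaler0.
  have -> : \sum_(b in B) row_mx 0 (w b *: p' b) =
      row_mx 0 (\sum_(b in B) w b *: p' b) :> 'rV_(1 + n).
    apply: (big_ind2 (fun x y => x = row_mx 0 y)) => //; first by rewrite row_mx0.
    by move=> x1 y1 x2 y2 -> ->; rewrite add_row_mx addr0.
  rewrite scale_row_mx scaler0 add_row_mx addr0 add0r -[RHS]row_mx0.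
  case/eq_row_mx => /rowP/(_ 0); rewrite !mxE eqxx mulr1 => wv0 w0 b.
  by rewrite in_setU1 => /predU1P[->//|]; apply: ind.
apply: (@generic_pinned_rigid _ _ _ E (v |: S) (v |: B) p) => //.
- by rewrite cardsU1 vB.
- by rewrite cardsU1 vB.
- exact: setUS.
- move=> a b; rewrite !in_setU1 => /predU1P[->|aB] /predU1P[->|bB].
  + by have := Ev v; rewrite setU11 => /(_ isT)/andP[].
  + by have := Ev b; rewrite in_setU1 (subsetP BS) ?orbT // => /(_ isT)/andP[].
  + by have := Ev a; rewrite in_setU1 (subsetP BS) ?orbT // => /(_ isT)/andP[].
  + exact: Ecl.
apply: rigid_pinned indB _ _; rewrite ?cardsU1 ?vB ?setUS //.
move=> w mw.
(* The apex with its loop is a one-point clique. It yields a trivial motion with the right value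
   there, which is subtracted first. *)
have indv : indep p [set v].
  move=> c; rewrite big_set1 pv => /rowP/(_ (lshift n 0)).
  by rewrite !mxE (unsplitK (inl 0)) !mxE mulr1 => c0 b /set1P ->.
have [A0 skA0 wA0] : exists2 A, A^T = - A & forall x, x \in [set v] -> w x = p x *m A.
  apply: clique_rigid indv _ _ mw => a b /set1P -> /set1P ->.
  by have := Ev v; rewrite setU11 => /(_ isT)/andP[].
pose w1 x := w x - p x *m A0.
have mw1 : motion E p w1.
  move=> a b Eab; rewrite !dotDl !dotNl addrACA mw // add0r -opprD.
  by rewrite dot_skew ?oppr0.
have w1v : w1 v = 0 by rewrite /w1 wA0 ?set11 // subrr.
have w1S x : x \in S -> w1 x = row_mx 0 (rsubmx (w1 x)).
  move=> xS; rewrite -[LHS]hsubmxK; congr row_mx.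
  apply/rowP => i; rewrite ord1 [RHS]mxE.
  have /andP[Evx _] : E v x && E x v by apply: Ev; rewrite in_setU1 xS orbT.
  have := mw1 _ _ Evx; rewrite w1v dot0l add0r pv dotE tr_row_mx.
  rewrite -[w1 x]hsubmxK mul_row_col trmx0 mulmx0 addr0 row_mxKl trmx1 mulmx1.
  by [].
have mot : motion E' p' (fun x => rsubmx (w1 x)).
  move=> a b /E'E/and3P[aS bS Eab]; rewrite -[RHS](mw1 _ _ Eab).
  rewrite (w1S a aS) (w1S b bS) !pS // !dotE !tr_row_mx !mul_row_col !mul0mx !add0r.
  by rewrite !row_mxKr.
have [A skA wA] := rE' _ mot.
exists (A0 + (block_mx 0 0 0 A : 'M_(1 + n))).
  rewrite linearD /= skA0 tr_block_mx !trmx0 skA opprD opp_block_mx !oppr0.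
  by [].
move=> x; rewrite mulmxDr in_setU1 => /predU1P[->|xS].
  rewrite pv mul_row_block !mulmx0 !mul0mx !addr0 row_mx0 addr0.
  by rewrite -pv wA0 ?set11.
rewrite {2}pS // mul_row_block !mulmx0 ?mul0mx ?addr0 !add0r -wA // -w1S //.
by rewrite /w1 addrC subrK.
Qed.

End Cone.

(** * Minimal cycles modulo 2 *)

Section Cycles.
Variable (V : finType).
Implicit Types (C K L Z : {set {set V}}) (F T Q H : {set V}).

(** Addition of chains modulo 2, a chain being the set of its cells. *)
Definition symd (T : finType) (A B : {set T}) := (A :\: B) :|: (B :\: A).

Lemma in_symd (T : finType) (A B : {set T}) x :
  (x \in symd A B) = (x \in A) (+) (x \in B).
Proof. by rewrite !inE; case: (x \in A); case: (x \in B). Qed.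

Lemma odd_card_symd (T : finType) (A B : {set T}) :
  odd #|symd A B| = odd #|A| (+) odd #|B|.
Proof.
rewrite -(cardsID B A) -(cardsID A B) (setIC B A) /symd cardsU.
rewrite (_ : (A :\: B) :&: (B :\: A) = set0) ?cards0 ?subn0.
  by rewrite !oddD; case: (odd #|A :&: B|); case: (odd _); case: (odd _).
by apply/setP => x; rewrite !inE; case: (x \in A); case: (x \in B).
Qed.

Definition deg C T := #|[set F in C | T \subset F]|.

Lemma odd_deg_symd C Z T : odd (deg (symd C Z) T) = odd (deg C T) (+) odd (deg Z T).
Proof.
rewrite -odd_card_symd; congr (odd #|pred_of_set _|); apply/setP => F.
by rewrite !(in_symd, inE); case: (F \in C); case: (F \in Z); case: (T \subset F).
Qed.

Lemma deg_gt0 C T : (0 < deg C T)%N -> exists2 F, F \in C & T \subset F.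
Proof. by case/card_gt0P => F; rewrite inE => /andP[? ?]; exists F. Qed.

Lemma odd_deg_ex C T : odd (deg C T) -> exists2 F, F \in C & T \subset F.
Proof. by move/odd_gt0/deg_gt0. Qed.

Lemma card_between1 Q F : Q \subset F ->
  #|[set T : {set V} | [&& Q \subset T, T \subset F & #|T| == #|Q|.+1]]| = #|F :\: Q|.
Proof.
move=> QF; rewrite -(card_in_imset (f := fun x => x |: Q) (D := F :\: Q)).
  congr #|pred_of_set _|; apply/setP => T; apply/idP/imsetP.
    rewrite inE => /and3P[QT TF /eqP cT].
    have : #|T :\: Q| == 1%N by rewrite cardsDS // cT subSnn.
    case/cards1P => x Tx; have : x \in T :\: Q by rewrite Tx set11.
    rewrite !inE => /andP[xQ xT]; exists x.
      by rewrite inE xQ (subsetP TF).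
    by rewrite -Tx setUC setDE setUIr setUCr setIT; apply/esym/setUidPr.
  move=> [x]; rewrite !inE => /andP[xQ xF] ->.
  by rewrite subsetUr subUset sub1set xF QF cardsU1 xQ eqxx.
move=> x y; rewrite !inE => /andP[xQ _] /andP[yQ _] e.
by have := setU11 x Q; rewrite e in_setU1 (negPf xQ) orbF => /eqP.
Qed.

Section Dim.
Variable k : nat.

Definition cells C := [forall F in C, #|F| == k.+1].
Definition cycle C := cells C && [forall T : {set V}, (#|T| == k) ==> ~~ odd (deg C T)].

Lemma cellsP C : reflect (forall F, F \in C -> #|F| = k.+1) (cells C).
Proof. by apply: (iffP forall_inP) => h F /h/eqP. Qed.

Lemma cycleP C : reflect
  (cells C /\ forall T, #|T| = k -> ~~ odd (deg C T)) (cycle C).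
Proof.
apply: (iffP andP) => -[cC h]; split=> //.
  by move=> T cT; have /forallP/(_ T)/implyP := h; apply; apply/eqP.
by apply/forallP => T; apply/implyP => /eqP/h.
Qed.

Lemma cells_symd C Z : cells C -> cells Z -> cells (symd C Z).
Proof.
move=> /cellsP cC /cellsP cZ; apply/cellsP => F; rewrite in_symd.
by have [/cC//|_ /= /cZ] := boolP (F \in C).
Qed.

Lemma cycle_symd C Z : cycle C -> cycle Z -> cycle (symd C Z).
Proof.
move=> /cycleP[cC hC] /cycleP[cZ hZ]; apply/cycleP; split; first exact: cells_symd.
by move=> T cT; rewrite odd_deg_symd (negPf (hC _ cT)) (negPf (hZ _ cT)).
Qed.

Definition mincycle C := [/\ cycle C, C != set0 &
  forall Z, Z \subset C -> cycle Z -> Z != set0 -> Z = C].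

(** The boundary of a boundary vanishes: a cell containing [Q] has exactly two faces of codimension
    one through [Q]. *)
Lemma boundary_boundary C Q : cells C -> #|Q|.+1 = k ->
  ~~ odd #|[set T : {set V} | [&& Q \subset T, #|T| == k & odd (deg C T)]]|.
Proof.
move=> /cellsP cC cQ.
have -> : odd #|[set T : {set V} | [&& Q \subset T, #|T| == k & odd (deg C T)]]| =
    odd (\sum_(T : {set V} | (Q \subset T) && (#|T| == k)) deg C T).
  rewrite -sum1_card big_mkcond [in RHS]big_mkcond /=.
  elim/big_rec2: _ => // T m1 m2 _; rewrite !oddD => ->; congr (_ (+) _).
  rewrite inE; case: (Q \subset T) => //=; case: (_ == _) => //=; by case: (odd (deg C T)).
under eq_bigr => T _ do rewrite /deg -sum1_card.
under eq_bigr => T _ do rewrite big_mkcond /=.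
rewrite exchange_big /=.
suff: forall F, ~~ odd (\sum_(T : {set V} | (Q \subset T) && (#|T| == k))
    if F \in [set F in C | T \subset F] then 1 else 0)%N.
  by move=> h; elim/big_rec: _ => // F m _ hm; rewrite oddD (negPf (h F)).
move=> F; have [FC|FC] := boolP (F \in C); last first.
  by rewrite big1 // => T _; rewrite inE (negPf FC).
have [QF|QF] := boolP (Q \subset F); last first.
  rewrite big1 // => T /andP[QT _]; rewrite inE FC /=.
  by case: ifP => // TF; rewrite (subset_trans QT TF) in QF.
rewrite -big_mkcondr /= sum1dep_card.
have := card_between1 QF; rewrite cardsDS // (cC _ FC) -cQ subSn // subSnn.
move=> cA; rewrite (_ : #|_| = 2) // -[RHS]cA; apply: eq_card => T.
by rewrite !inE FC /= -andbA; congr andb; rewrite andbC.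
Qed.

(** * Chains avoiding an edge and their completion to cycles *)

Section Edge.
Variables (u v : V) (uv : u != v).

Definition U F := (u \in F) && (v \in F).
Definition noU C := [set F in C | ~~ U F].
(** The cells through [uv] that a chain avoiding this edge needs in order to be even at the faces
    with [u] but not [v]. The only cell through [uv] over such a face [F :\ v] is [F], so the
    completion [ext] is forced. *)
Definition lk K :=
  [set F : {set V} | [&& #|F| == k.+1, U F & odd (deg K (F :\ v))]].
Definition ext K := symd K (lk K).
(** These are the cycles with their cells through [uv] removed; [ext] recovers the cycle. By
    [cycle_contract] they are also the chains that become cycles when [v] is merged into [u],
    outside the degenerate case of [closed_pair]. *)
Definition closed K := [&& cells K, [forall F in K, ~~ U F] & cycle (ext K)].

Lemma lk_symd K L : lk (symd K L) = symd (lk K) (lk L).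
Proof.
apply/setP => F; rewrite in_symd !inE odd_deg_symd.
by case: (_ == _); case: (U F).
Qed.

Lemma ext_symd K L : ext (symd K L) = symd (ext K) (ext L).
Proof.
apply/setP => F; rewrite /ext lk_symd !in_symd.
by case: (F \in K); case: (F \in L); case: (F \in lk K); case: (F \in lk L).
Qed.

Lemma closed_symd K L : closed K -> closed L -> closed (symd K L).
Proof.
move=> /and3P[cK /forall_inP uK eK] /and3P[cL /forall_inP uL eL].
apply/and3P; split; first exact: cells_symd.
  apply/forall_inP => F; rewrite in_symd.
  by have [/uK|_ /= /uL] := boolP (F \in K).
by rewrite ext_symd cycle_symd.
Qed.

Lemma closedD K L : L \subset K -> closed K -> closed L -> closed (K :\: L).
Proof.
move=> /subsetP LK cK cL.
rewrite (_ : K :\: L = symd K L) ?closed_symd //; apply/setP => F.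
rewrite in_symd inE; have := LK F.
by case: (F \in L) => [->|_] //; case: (F \in K).
Qed.

Lemma symd_disjoint (T : finType) (A B : {set T}) :
  [disjoint A & B] -> symd A B = A :|: B.
Proof.
rewrite -setI_eq0 => /eqP AB; apply/setP => x; rewrite in_symd inE.
have /setP/(_ x) := AB; rewrite !inE.
by case: (x \in A); case: (x \in B).
Qed.

Lemma lkD K L : L \subset K -> lk K = symd (lk L) (lk (K :\: L)).
Proof.
move=> LK; rewrite -lk_symd; congr lk; apply/setP => F; rewrite in_symd inE.
have /implyP := subsetP LK F.
by case: (F \in L); case: (F \in K).
Qed.

Lemma cells_size C F : cells C -> F \in C -> #|F| = k.+1.
Proof. by move=> /cellsP cC /cC. Qed.

Lemma deg_U_face C F : cells C -> #|F| = k.+1 -> U F ->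
  deg C (F :\ v) = (deg (noU C) (F :\ v) + (F \in C))%N.
Proof.
move=> /cellsP cC cF /andP[uF vF]; rewrite /deg -(cardsID [set G : {set V} | U G]) addnC.
congr addn.
  congr #|pred_of_set _|; apply/setP => G; rewrite !inE.
  by case: (G \in C); case: (U G); rewrite ?andbF.
have [FC|FC] := boolP (F \in C).
  apply/eqP/cards1P; exists F; apply/setP => G; rewrite !inE.
  apply/idP/eqP => [/andP[/andP[GC FG] /andP[uG vG]]|->]; last first.
    by rewrite FC subD1set /U uF vF.
  apply/esym/eqP; rewrite eqEcard cF (cC _ GC) leqnn andbT.
  by rewrite -(setD1K vF) subUset sub1set vG.
apply/eqP; rewrite cards_eq0; apply/eqP/setP => G; rewrite !inE.
apply/negP => /andP[/andP[GC FG] /andP[uG vG]]; case/negP: FC.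
suff -> : F = G by [].
apply/eqP; rewrite eqEcard cF (cC _ GC) leqnn andbT.
by rewrite -(setD1K vF) subUset sub1set vG.
Qed.

(** Evenness at [F :\ v] decides whether a cell [F] through [uv] belongs to the cycle, once the
    other cells are known. *)
Lemma ext_noU C : cycle C -> ext (noU C) = C.
Proof.
move=> /cycleP[cC hC]; apply/setP => F; rewrite in_symd !inE.
have [FU|FU] /= := boolP (U F); last by rewrite andbF andbT addbF.
rewrite andbF addFb; have [cF|cF] /= := eqVneq #|F| k.+1; last first.
  by apply/esym/negP => /(cells_size cC)/eqP; rewrite (negPf cF).
have vF : v \in F by case/andP: FU.
have : ~~ odd (deg C (F :\ v)).
  by apply: hC; apply: succn_inj; rewrite -cF (cardsD1 v F) vF.
rewrite deg_U_face // oddD.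
by case: (odd _); case: (F \in C).
Qed.

Lemma closed_noU C : cycle C -> closed (noU C).
Proof.
move=> cC; apply/and3P; split; last by rewrite ext_noU.
- have /cycleP[/cellsP h _] := cC; apply/cellsP => F; rewrite inE => /andP[/h] //.
- by apply/forall_inP => F; rewrite inE => /andP[].
Qed.

Lemma noU_ext K : closed K -> noU (ext K) = K.
Proof.
move=> /and3P[_ /forall_inP uK _]; apply/setP => F; rewrite inE in_symd inE.
have [FK|FK] := boolP (F \in K).
  by rewrite (negPf (uK _ FK)) andbF.
by case: (U F); rewrite ?andbF.
Qed.

Lemma ext0 K : closed K -> ext K = set0 -> K = set0.
Proof.
move=> cK e; rewrite -(noU_ext cK) e; apply/setP => F; by rewrite !inE.
Qed.

(** The definition of [lk] treats [u] and [v] asymmetrically. The face [F :\ u] is handled through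
    the evenness of [ext K]: a second cell over it cannot contain [u], hence comes from [K]. *)
Lemma lk_faces K F : closed K -> F \in lk K ->
  [/\ #|F| = k.+1, u \in F, v \in F,
      exists2 G, G \in K & F :\ v \subset G &
      exists2 G, G \in K & F :\ u \subset G].
Proof.
move=> cK; rewrite inE => /and3P[/eqP cF FU odF].
have /andP[uF vF] := FU; split=> //; first exact: odd_deg_ex.
have /and3P[_ /forall_inP uK /cycleP[cE hE]] := cK.
have FE : F \in ext K.
  rewrite in_symd inE cF eqxx FU odF.
  by case: (F \in K) (uK F) => [/(_ isT)|//]; rewrite FU.
have cFu : #|F :\ u| = k by apply: succn_inj; rewrite -cF (cardsD1 u F) uF.
have := hE _ cFu.
have: (0 < deg (ext K) (F :\ u))%N.
  by apply/card_gt0P; exists F; rewrite inE FE subD1set.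
move=> d0 d1; have : (1 < deg (ext K) (F :\ u))%N.
  by case: (deg _ _) d0 d1 => [|[]].
rewrite /deg (cardsD1 F) inE FE subD1set /= ltnS => /card_gt0P[G].
rewrite in_setD1 in_set => /andP[GF /andP[GE FG]]; exists G => //.
move: GE; rewrite in_symd; case: (G \in K) => //=.
rewrite inE => /and3P[/eqP cG /andP[uG _] _]; case/eqP: GF.
apply/esym/eqP; rewrite eqEcard cF cG leqnn andbT.
by rewrite -(setD1K uF) subUset sub1set uG.
Qed.

(** A cell of [lk K] is not in [K], but its k + 1 vertices are covered; such cells are the gluing
    sets of [fogelsanger_step]. *)
Lemma lk_cover K F : closed K -> F \in lk K -> F \subset cover K.
Proof.
move=> cK /(lk_faces cK)[_ _ _ [G GK FG] [G' GK' FG']].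
apply/subsetP => x xF; apply/bigcupP; have [xv|xv] := eqVneq x v.
  by exists G' => //; apply: (subsetP FG'); rewrite !inE xF xv eq_sym uv.
by exists G => //; apply: (subsetP FG); rewrite !inE xF xv.
Qed.

Definition minclosed K := [/\ closed K, K != set0 &
  forall L, L \subset K -> closed L -> L != set0 -> L = K].

Definition minclosedb K := [&& closed K, K != set0 &
  [forall L : {set {set V}}, [&& L \subset K, closed L & L != set0] ==> (L == K)]].

Lemma minclosedP K : reflect (minclosed K) (minclosedb K).
Proof.
apply: (iffP and3P) => -[cK K0 minK]; split=> //.
  by move=> L LK cL L0; have /forallP/(_ L) := minK; rewrite LK cL L0 => /eqP.
by apply/forallP => L; apply/implyP => /and3P[LK cL L0]; rewrite (minK L).
Qed.

(** As [lk] is additive, when a closed chain splits into two closed parts the cell [F] lies in the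
    [lk] of one of them; descend on the number of cells. *)
Lemma minclosed_lk W F : closed W -> F \in lk W ->
  exists K, [/\ minclosed K, K \subset W & F \in lk K].
Proof.
have [m] := ubnP #|W|; elim: m W => // m IH W Wm cW FW.
have W0 : W != set0.
  have [_ _ _ [G GW _] _] := lk_faces cW FW.
  by apply/set0Pn; exists G.
have [/existsP[L /and4P[LW cL L0 nLW]]|/existsPn noL] :=
  boolP [exists L : {set {set V}}, [&& L \subset W, closed L, L != set0 & L != W]].
  have LpW : L \proper W by rewrite properEneq nLW.
  have cD := closedD LW cW cL.
  move: FW; rewrite (lkD LW) in_symd.
  have [FL _|FL /= FD] := boolP (F \in lk L).
    have [|K [mK KL FK]] := IH _ _ cL FL.
      exact: leq_trans (proper_card LpW) _.
    by exists K; split=> //; apply: subset_trans LW.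
  have [|K [mK KL FK]] := IH _ _ cD FD.
    apply: leq_trans (_ : #|W :\: L| < #|W|)%N _ => //.
    rewrite cardsDS // ltn_subrL !card_gt0 L0 //.
  by exists K; split=> //; apply: subset_trans KL (subsetDl _ _).
exists W; split=> //; split=> // L LW cL L0.
by have := noL L; rewrite LW cL L0 /= negbK => /eqP.
Qed.

Lemma simplex_cycle Q : #|Q| = k.+2 ->
  cycle [set F : {set V} | (F \subset Q) && (#|F| == k.+1)].
Proof.
move=> cQ; apply/cycleP; split.
  by apply/cellsP => F; rewrite inE => /andP[_ /eqP].
move=> T cT; rewrite /deg.
have [TQ|TQ] := boolP (T \subset Q).
  have := card_between1 TQ; rewrite cardsDS // cQ cT (subSn (leqnSn _)) subSnn.
  move=> cA; rewrite (_ : #|_| = 2) // -[RHS]cA; apply: eq_card => F.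
  by rewrite !inE; case: (T \subset F); rewrite ?andbF ?andbT.
rewrite (_ : #|_| = 0) //; apply: eq_card0 => F; rewrite !inE.
by apply/negP => /andP[/andP[FQ _] TF]; rewrite (subset_trans TF FQ) in TQ.
Qed.

(** This is the boundary of the simplex on [u], [v] and [F] without its cells through [uv]: the
    degenerate case, in which merging [v] into [u] identifies two cells. *)
Lemma closed_pair F : u \notin F -> v \notin F -> #|F| = k ->
  closed [set u |: F; v |: F].
Proof.
move=> uF vF cF; pose Q := u |: (v |: F).
have vuF : u \notin v |: F by rewrite in_setU1 negb_or uv.
have cQ : #|Q| = k.+2 by rewrite !cardsU1 vuF vF cF.
have := closed_noU (simplex_cycle cQ); congr closed.
have Qu : Q :\ u = v |: F by rewrite setU1K.
have Qv : Q :\ v = u |: F.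
  rewrite /Q setUCA setU1K // in_setU1 negb_or vF eq_sym uv //.
apply/setP => G; rewrite !inE; apply/idP/orP.
  case/andP=> /andP[GQ /eqP cG]; rewrite negb_and => /orP[uG|vG]; [right|left].
    by rewrite -Qu eqEcard subsetD1 GQ uG /= Qu cardsU1 vF cF cG.
  by rewrite -Qv eqEcard subsetD1 GQ vG /= Qv cardsU1 uF cF cG.
case=> /eqP ->; rewrite -?Qu -?Qv subD1set /U !inE eqxx /= ?andbF //.
  by rewrite Qv cardsU1 uF cF !eqxx andbF.
by rewrite Qu cardsU1 vF cF !eqxx.
Qed.

End Edge.

(** * Contraction of an edge *)

Section Contract.
Variables (u v : V) (uv : u != v) (K : {set {set V}}).
Hypothesis cK : cells K.
Hypothesis UK : forall F, F \in K -> ~~ U u v F.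
Hypothesis npair : forall F, u \notin F -> v \notin F ->
  ~~ ((u |: F \in K) && (v |: F \in K)).

Definition contract F := merge u v @: F.

Lemma contract_id F : v \notin F -> contract F = F.
Proof.
move=> vF; rewrite -[RHS]imset_id; apply: eq_in_imset => x xF.
by rewrite /merge; case: eqP => // e; rewrite e (negPf vF) in xF.
Qed.

Lemma contract_v F : v \in F -> contract F = u |: (F :\ v).
Proof.
move=> vF; rewrite /contract -{1}(setD1K vF) imsetU1 {1}/merge eqxx; congr (_ |: _).
by apply: contract_id; rewrite !inE eqxx.
Qed.

Lemma v_notin_contract F : v \notin contract F.
Proof.
apply/imsetP => -[x _]; rewrite /merge; case: eqP => [_ e|ne e].
  by case/eqP: uv.
by rewrite e in ne.
Qed.

(** Two cells with the same contraction differ at most by exchanging [u] and [v], which [npair]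
    forbids. *)
Lemma contract_inj : {in K &, injective contract}.
Proof.
move=> F G FK GK.
have noP A B : A \in K -> B \in K -> v \in A -> v \notin B ->
    u |: (A :\ v) = B -> False.
  move=> AK BK vA vB e; have := npair (F := A :\ v).
  rewrite e BK setD1K // AK !inE eqxx /=.
  have := UK AK; rewrite /U vA andbT => uA; rewrite (negPf uA) andbF.
  by move/(_ isT isT).
have [vF|vF] := boolP (v \in F); have [vG|vG] := boolP (v \in G).
- rewrite !contract_v // => e.
  have uF : u \notin F :\ v.
    by rewrite !inE; have := UK FK; rewrite /U vF andbT => /negPf ->; rewrite andbF.
  have uG : u \notin G :\ v.
    by rewrite !inE; have := UK GK; rewrite /U vG andbT => /negPf ->; rewrite andbF.
  by rewrite -(setD1K vF) -(setU1K uF) e setU1K // setD1K.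
- by rewrite contract_v // contract_id // => /noP; case.
- by rewrite contract_id // contract_v // => /esym/noP; case.
- by rewrite !contract_id.
Qed.

Lemma card_contract F : F \in K -> #|contract F| = k.+1.
Proof.
move=> FK; rewrite card_in_imset; first exact: (cells_size cK).
move=> x y xF yF; have := UK FK; rewrite /U /merge; move: xF yF.
have [->|_] := eqVneq x v; have [->|_] := eqVneq y v => // xF yF.
  by move=> + e; rewrite e xF yF.
by move=> + e; rewrite -e xF yF.
Qed.

Lemma deg_contract L T : L \subset K ->
  deg (contract @: L) T = #|[set F in L | T \subset contract F]|.
Proof.
move=> /subsetP LK; rewrite /deg -[RHS](card_in_imset (f := contract)); last first.
  by move=> F G; rewrite !inE => /andP[/LK FK _] /andP[/LK GK _]; apply: contract_inj.
congr #|pred_of_set _|; apply/setP => G; rewrite inE.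
apply/andP/imsetP => [[/imsetP[F FL ->] TF]|[F]].
  by exists F => //; rewrite inE FL.
by rewrite inE => /andP[FL TF] ->; rewrite imset_f.
Qed.

Lemma deg_contract_v L T : L \subset K -> v \in T -> deg (contract @: L) T = 0%N.
Proof.
move=> LK vT; rewrite deg_contract //; apply: eq_card0 => F; rewrite inE.
by apply/negP => /andP[_ /subsetP/(_ _ vT)]; rewrite (negPf (v_notin_contract F)).
Qed.

Lemma deg_contract_none L T : L \subset K -> u \notin T -> v \notin T ->
  deg (contract @: L) T = deg L T.
Proof.
move=> LK uT vT; rewrite deg_contract //; apply: eq_card => F; rewrite !inE.
congr andb; have [vF|vF] := boolP (v \in F); last by rewrite contract_id.
rewrite contract_v //; apply/subsetP/subsetP => h x xT.
  have := h _ xT; rewrite !inE => /orP[/eqP e|/andP[]//].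
  by rewrite -e xT in uT.
rewrite !inE h // andbT; apply/orP; right.
by apply: contraNneq vT => <-.
Qed.

Lemma deg_contract_u L H : L \subset K -> u \notin H -> v \notin H ->
  deg (contract @: L) (u |: H) = (deg L (u |: H) + deg L (v |: H))%N.
Proof.
move=> LK uH vH; rewrite deg_contract // /deg -(cardsID [set F : {set V} | v \in F]) addnC.
congr addn; apply: eq_card => F; rewrite !inE.
  have [vF|vF] /= := boolP (v \in F); last by rewrite contract_id.
  apply/esym/negP => /andP[FL uF]; have := UK (subsetP LK _ FL).
  by rewrite /U vF (subsetP uF) ?setU11.
have [vF|vF] /= := boolP (v \in F); last first.
  rewrite andbF; apply/esym/negP => /andP[_ /subsetP/(_ v)].
  by rewrite setU11 (negPf vF) => /(_ isT).
have [FL|FL] //= := boolP (F \in L); rewrite andbT contract_v //.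
have uF : u \notin F by have := UK (subsetP LK _ FL); rewrite /U vF andbT.
rewrite !subUset !sub1set setU11 vF /=.
apply/subsetP/subsetP => h x xH.
  have := h _ xH; rewrite !inE => /orP[/eqP e|/andP[]//].
  by rewrite -e xH in uH.
rewrite !inE h // andbT; apply/orP; right.
by apply: contraNneq vH => <-.
Qed.

(** A cell of [lk L] over [T] also contains [u] and [v], so by cardinality only [T] with its missing
    one of [u], [v] can qualify. *)
Lemma deg_lk_none L T : ~~ U u v T -> #|T| = k ->
  deg (lk u v L) T =
  if v \in T then (odd (deg L (u |: (T :\ v))) : nat)
  else if u \in T then (odd (deg L T) : nat) else 0%N.
Proof.
rewrite /U => uvT cT; rewrite /deg.
have [vT|vT] := boolP (v \in T).
  have uT : u \notin T by rewrite vT andbT in uvT.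
  have cuT : #|u |: T| = k.+1 by rewrite cardsU1 uT cT.
  have E : (u |: T) :\ v = u |: (T :\ v).
    apply/setP => x; rewrite !inE; have [->|//] := eqVneq x u.
    by rewrite uv.
  have [od|od] := boolP (odd _).
    apply/eqP/cards1P; exists (u |: T); apply/setP => F; rewrite !inE /U.
    apply/idP/eqP => [/andP[/and3P[/eqP cF /andP[uF vF] _] TF]|->].
      by apply/esym/eqP; rewrite eqEcard cF cuT leqnn andbT subUset sub1set uF.
    by rewrite cuT eqxx !inE eqxx vT orbT E od subsetUr.
  apply: eq_card0 => F; rewrite !inE /U.
  apply/negP => /andP[/and3P[/eqP cF /andP[uF vF] odF] TF]; case/negP: od.
  rewrite -E (_ : u |: T = F) //.
  by apply/eqP; rewrite eqEcard cF cuT leqnn andbT subUset sub1set uF.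
have [uT|uT] := boolP (u \in T); last first.
  apply: eq_card0 => F; rewrite !inE /U.
  apply/negP => /andP[/and3P[/eqP cF /andP[uF vF] odF] TF].
  have : u |: (v |: T) \subset F by rewrite !subUset !sub1set uF vF.
  move/subset_leq_card; rewrite cF !cardsU1 vT in_setU1 negb_or uv uT cT.
  by rewrite ltnn.
have cvT : #|v |: T| = k.+1 by rewrite cardsU1 vT cT.
have [od|od] := boolP (odd _).
  apply/eqP/cards1P; exists (v |: T); apply/setP => F; rewrite !inE /U.
  apply/idP/eqP => [/andP[/and3P[/eqP cF /andP[uF vF] _] TF]|->].
    by apply/esym/eqP; rewrite eqEcard cF cvT leqnn andbT subUset sub1set vF.
  by rewrite cvT eqxx !inE eqxx uT orbT setU1K // od subsetUr.
apply: eq_card0 => F; rewrite !inE /U.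
apply/negP => /andP[/and3P[/eqP cF /andP[uF vF] odF] TF]; case/negP: od.
rewrite -(setU1K vT) (_ : v |: T = F) //.
by apply/eqP; rewrite eqEcard cF cvT leqnn andbT subUset sub1set vF.
Qed.

(** At faces without [u], the parity of [ext L] is that of the contraction at the contracted face;
    at faces with [u] but not [v], [ext L] is even by the choice of [lk]. *)
Lemma cycle_contract L : L \subset K -> cycle (contract @: L) <-> closed u v L.
Proof.
move=> LK; have cL : cells L.
  by apply/cellsP => F /(subsetP LK)/(cells_size cK).
have ext_u T : u \in T -> v \notin T -> #|T| = k -> ~~ odd (deg (ext u v L) T).
    move=> uT vT cT; rewrite odd_deg_symd deg_lk_none ?(negPf vT) ?uT //.
      by rewrite oddb addbb.
    by rewrite /U (negPf vT) andbF.
  have ext_n T : u \notin T -> #|T| = k ->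
      odd (deg (ext u v L) T) = odd (deg (contract @: L) (contract T)).
    move=> uT cT; rewrite odd_deg_symd deg_lk_none ?(negPf uT) // /U ?(negPf uT) //.
    have [vT|vT] := boolP (v \in T).
      rewrite contract_v // deg_contract_u ?inE ?eqxx ?(negPf uT) ?andbF //.
      by rewrite oddb oddD setD1K // addbC.
    by rewrite contract_id // deg_contract_none // addbF.
split=> [/cycleP[cm em]|/and3P[_ _ /cycleP[ce ee]]].
  have cE : cells (ext u v L).
    by apply: cells_symd => //; apply/cellsP => F; rewrite inE => /and3P[/eqP].
  apply/and3P; split=> //; first by apply/forall_inP => F /(subsetP LK)/UK.
  have nonU T : ~~ U u v T -> #|T| = k -> ~~ odd (deg (ext u v L) T).
    have [uT uvT cT|uT _ cT] := boolP (u \in T).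
      by apply: ext_u => //; move: uvT; rewrite /U uT.
    rewrite ext_n //; apply: em; rewrite -cT card_in_imset // => x y xT yT.
    rewrite /merge; move: xT yT.
    have [->|_] := eqVneq x v; have [->|_] := eqVneq y v => // xT yT e.
      by move: yT; rewrite -e (negPf uT).
    by move: xT; rewrite e (negPf uT).
  apply/cycleP; split=> // T cT.
  have [/andP[uT vT]|/nonU/(_ cT)//] := boolP (U u v T).
  have cTv : #|T :\ v|.+1 = k by rewrite -cT (cardsD1 v T) vT.
  (* Odd faces must contain both [u] and [v], so [T] would be the only odd face through [T :\ v],
     against the parity of their number. *)
  have := boundary_boundary cE cTv; apply: contra => od.
  rewrite (_ : #|_| = 1%N) //; apply/eqP/cards1P; exists T.
  apply/setP => S; rewrite !inE; apply/idP/eqP => [/and3P[TS /eqP cS oS]|->].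
    have /andP[uS vS] : U u v S by apply: contraLR oS => /nonU; apply.
    apply/esym/eqP; rewrite eqEcard cS cT leqnn andbT.
    by rewrite -(setD1K vT) subUset sub1set vS.
  by rewrite subD1set cT eqxx.
apply/cycleP; split.
  by apply/cellsP => _ /imsetP[F FL ->]; apply: card_contract; apply: (subsetP LK).
move=> T cT; have [vT|vT] := boolP (v \in T); first by rewrite deg_contract_v.
have [uT|uT] := boolP (u \in T); last first.
  by rewrite -(contract_id vT) -ext_n // ee.
have vTu : v \notin T :\ u by rewrite inE (negPf vT) andbF.
rewrite -(setD1K uT) -{1}(setU1K vTu) -contract_v ?setU11 // -ext_n ?ee //.
- by rewrite cardsU1 vTu -cT (cardsD1 u T) uT.
- by rewrite !inE (negPf uv) eqxx.
- by rewrite cardsU1 vTu -cT (cardsD1 u T) uT.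
Qed.

Lemma mincycle_contract : minclosed u v K -> mincycle (contract @: K).
Proof.
move=> [cKc K0 minK]; split; first exact/cycle_contract.
  by have [F FK] := set0Pn _ K0; apply/set0Pn; exists (contract F); apply: imset_f.
move=> Z ZK cZ Z0; pose L := [set F in K | contract F \in Z].
have LK : L \subset K by apply/subsetP => F; rewrite inE => /andP[].
have ZL : Z = contract @: L.
  apply/setP => G; apply/idP/imsetP => [GZ|[F]]; last by rewrite inE => /andP[_ FZ] ->.
  have /imsetP[F FK GF] := subsetP ZK _ GZ.
  by exists F => //; rewrite inE FK -GF.
rewrite ZL (minK L) //; first by apply/(cycle_contract LK); rewrite -ZL.
have [G] := set0Pn _ Z0; rewrite ZL => /imsetP[F FL _].
by apply/set0Pn; exists F.
Qed.

Lemma cover_contract x : x \in cover K -> x != v -> x \in cover (contract @: K).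
Proof.
move=> /bigcupP[F FK xF] xv; apply/bigcupP; exists (contract F).
  exact: imset_f.
by apply/imsetP; exists x => //; rewrite /merge (negPf xv).
Qed.

Lemma cover_contract_sub : u \in cover K -> cover (contract @: K) \subset cover K :\ v.
Proof.
move=> uK; apply/subsetP => x /bigcupP[_ /imsetP[F FK ->]] /imsetP[y yF ->].
rewrite !inE /merge; have [_|yv] := eqVneq y v; first by rewrite uv.
by rewrite yv; apply/bigcupP; exists F.
Qed.

End Contract.

Section Rigidity.
Variable R : realFieldType.

Definition adj C : rel V := fun a b => [exists F in C, (a \in F) && (b \in F)].

Lemma adjP C a b : reflect (exists F, [/\ F \in C, a \in F & b \in F]) (adj C a b).
Proof.
by apply: (iffP exists_inP) => [[F FC /andP[]]|[F [FC aF bF]]];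
  exists F => //; rewrite aF.
Qed.

Lemma adj_cover C a b : adj C a b -> (a \in cover C) && (b \in cover C).
Proof. by case/adjP => F [FC aF bF]; apply/andP; split; apply/bigcupP; exists F. Qed.

End Rigidity.
End Dim.

(** * Fogelsanger's theorem *)

Section Fogelsanger.
Variable (R : realFieldType) (k : nat).
Hypothesis k2 : (2 <= k)%N.
Notation conf := (V -> 'rV[R]_k.+2).

Section Step.
Variables (C : {set {set V}}) (u v : V).
Hypotheses (uv : u != v) (mC : mincycle k C) (uvC : exists2 F, F \in C & U u v F).
Hypothesis IH : forall Z, (#|cover Z| < #|cover C|)%N -> mincycle k Z ->
  generic (fun p : conf => rigid (adj Z) p (cover Z)).

(** The k + 2 vertices form a clique of [C]: the two cells supply every pair except [uv], which is
    an edge of [C] by assumption. *)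
Lemma pair_rigid F : u \notin F -> v \notin F -> #|F| = k ->
  u |: F \in C -> v |: F \in C ->
  generic (fun p : conf => rigid (adj C) p (u |: (v |: F))).
Proof.
move=> uF vF cF uFC vFC.
have cQ : #|u |: (v |: F)| = k.+2 by rewrite !cardsU1 in_setU1 negb_or uv uF vF cF.
have := @generic_indep R V k.+2 (u |: (v |: F)).
rewrite cQ leqnn => /(_ isT); apply: genericW => p ip.
apply: clique_rigid ip _ => a b.
have [F' FC' /andP[uF' vF']] := uvC.
have inF x : x != u -> x != v -> x \in u |: (v |: F) -> x \in F.
  by rewrite !in_setU1 => /negPf -> /negPf ->.
move=> aQ bQ; apply/adjP.
have [au|au] := eqVneq a u; have [bu|bu] := eqVneq b u.
- by exists F'; rewrite au bu.
- have [bv|bv] := eqVneq b v; first by exists F'; rewrite au bv.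
  by exists (u |: F); rewrite au setU11 in_setU1 inF ?orbT.
- have [av|av] := eqVneq a v; first by exists F'; rewrite av bu.
  by exists (u |: F); rewrite bu setU11 in_setU1 inF ?orbT.
by exists (v |: F); move: aQ bQ; rewrite ![_ \in u |: _]in_setU1 (negPf au) (negPf bu).
Qed.

(** Outside the degenerate pair, the contraction of [K] is a minimal cycle with fewer vertices,
    rigid by induction, and vertex splitting restores [v]. The k common neighbours of [u] and [v]
    come from two cells of [lk K] with a common face. *)
Lemma contract_rigid K : K \subset noU u v C -> minclosed k u v K ->
  lk k u v K != set0 -> generic (fun p : conf => rigid (adj C) p (cover K)).
Proof.
move=> KC mK /set0Pn[s sK]; have [cK K0 minK] := mK.
have KC' F : F \in K -> F \in C by move/(subsetP KC); rewrite inE => /andP[].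
have [cells_K /forall_inP UK /cycleP[cE hE]] := and3P cK.
have [cs us vs [Gv GvK sGv] [Gu GuK sGu]] := lk_faces cK sK.
have coverS := subsetP (lk_cover uv cK sK).
have [uK vK] := (coverS _ us, coverS _ vs).
have [/existsP[F /and4P[uF vF uFK vFK]]|/existsPn npair] :=
    boolP [exists F : {set V}, [&& u \notin F, v \notin F, u |: F \in K & v |: F \in K]].
  have cF : #|F| = k.
    by apply: succn_inj; rewrite -(cells_size cells_K uFK) cardsU1 uF.
  have := pair_rigid uF vF cF (KC' _ uFK) (KC' _ vFK).
  rewrite (_ : cover K = u |: (v |: F)) // -(minK [set u |: F; v |: F]).
  - apply/setP => x; rewrite /cover bigcup_setU !big_set1 !inE.
    by case: (x == u); case: (x == v); case: (x \in F).
  - by apply/subsetP => G; rewrite !inE => /orP[] /eqP ->.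
  - exact: closed_pair.
  - by apply/set0Pn; exists (u |: F); rewrite !inE eqxx.
have {}npair F : u \notin F -> v \notin F -> ~~ ((u |: F \in K) && (v |: F \in K)).
  by move=> uF vF; have := npair F; rewrite uF vF.
pose Z := contract u v @: K.
have mZ : mincycle k Z by apply: mincycle_contract.
have ZK : cover Z \subset cover K :\ v by apply: cover_contract_sub.
have coverKC : cover K \subset cover C.
  by apply/subsetP => x /bigcupP[F /KC' FC xF]; apply/bigcupP; exists F.
have ltZ : (#|cover Z| < #|cover C|)%N.
  apply: leq_ltn_trans (subset_leq_card ZK) _.
  by apply: leq_trans (subset_leq_card coverKC); rewrite (cardsD1 v (cover K)) vK.
have [p0 [gp rZ]] := generic_ex (generic_and (generic_gpos R V k.+2) (IH ltZ mZ)).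
pose S := cover K.
pose E a b := [&& adj C a b, a \in S & b \in S].
have EK a b F : F \in K -> a \in F -> b \in F -> E a b.
  move=> FK aF bF; apply/and3P; split; last 2 first.
  - by apply/bigcupP; exists F.
  - by apply/bigcupP; exists F.
  by apply/adjP; exists F; rewrite KC'.
have Eself a : a \in S -> E a a by case/bigcupP => F FK aF; apply: (EK _ _ F).
have Euv : E u v.
  by apply/and3P; split=> //; apply/adjP; have [F FC /andP[uF vF]] := uvC; exists F.
(* a vertex w completing a second link cell through a face of s containing u and v *)
have [h hs] : exists h, h \in s :\ u :\ v.
  apply/set0Pn; rewrite -card_gt0 -(ltn_add2l 2) addn0.
  move: cs; rewrite (cardsD1 u) us (cardsD1 v) !inE vs eq_sym uv => /= e.
  by rewrite -[(2 + _)%N]/(1 + (1 + _))%N e ltnS.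
move: (hs); rewrite !inE => /and3P[hv hu h_s].
have c1 : #|s :\ h| = k by apply: succn_inj; rewrite -cs (cardsD1 h s) h_s.
have sE : s \in ext k u v K.
  rewrite in_symd sK; case: (boolP (s \in K)) => // /UK.
  by rewrite /U us vs.
have [s' [s'E s's hs']] : exists s', [/\ s' \in ext k u v K, s' != s & s :\ h \subset s'].
  have := hE _ c1; have: (0 < deg (ext k u v K) (s :\ h))%N.
    by apply/card_gt0P; exists s; rewrite inE sE subD1set.
  move=> d0 d1; have : (1 < deg (ext k u v K) (s :\ h))%N.
    by case: (deg _ _) d0 d1 => [|[]].
  rewrite /deg (cardsD1 s) inE sE subD1set /= ltnS => /card_gt0P[G].
  by rewrite in_setD1 in_set => /andP[Gs /andP[GE hG]]; exists G.
have us' : u \in s' by apply: (subsetP hs'); rewrite !inE us eq_sym hu.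
have vs' : v \in s' by apply: (subsetP hs'); rewrite !inE vs eq_sym hv.
have s'K : s' \in lk k u v K.
  move: s'E; rewrite in_symd; case: (boolP (s' \in K)) => // /UK.
  by rewrite /U us' vs'.
have [cs' _ _ [Gv' Gv'K sGv'] [Gu' Gu'K sGu']] := lk_faces cK s'K.
have [w ws' wsh] : exists2 w, w \in s' & w \notin s.
  apply/subsetPn; apply: contra s's => ss.
  by rewrite eqEcard ss cs cs' leqnn.
have [wu wv] : w != u /\ w != v by split; apply: contraNneq wsh => ->.
pose T := w |: (s :\ u :\ v).
have cT : k.+2 = #|T|.+2.
  rewrite cardsU1 !inE (negPf wsh) !andbF /= add1n.
  by rewrite -cs (cardsD1 u s) us (cardsD1 v (s :\ u)) !inE vs eq_sym uv.
have : exists B, B \in K by apply/set0Pn.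
case=> B BK; have cB : k.+2 = #|B|.+1 by rewrite (cells_size cells_K BK).
have rE : generic (fun p : conf => rigid E p S).
  apply: (@split_rigid R V k.+2 (adj Z) E S B T u v p0) => //.
  - by rewrite !inE (negPf uv) eq_sym (negPf wu) eqxx andbF.
  - by rewrite !inE eqxx eq_sym (negPf wv).
  - exact: Eself.
  - exact: Eself.
  - move=> c; rewrite in_setU1 => /predU1P[->|].
      rewrite (EK u w Gv') //= ?(EK v w Gu') //;
      by [apply: (subsetP sGv'); rewrite !inE ?us' ?ws' ?wv ?uv
         |apply: (subsetP sGu'); rewrite !inE ?vs' ?ws' ?wu // eq_sym uv].
    rewrite !inE => /and3P[cv cu c_s].
    rewrite (EK u c Gv) //= ?(EK v c Gu) //;
    by [apply: (subsetP sGv); rewrite !inE ?us ?c_s ?cv ?uv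
       |apply: (subsetP sGu); rewrite !inE ?vs ?c_s ?cu // eq_sym uv].
  - by move=> a b /and3P[_ -> ->].
  - move=> a b /adjP[_ [/imsetP[F FK ->] /imsetP[a' aF ->] /imsetP[b' bF ->]]].
    by exists a', b'; split=> //; apply: EK FK aF bF.
  - by apply/subsetP => x xB; apply/bigcupP; exists B.
  - by move=> a b; apply: EK.
  - exact: UK.
  apply: rigid_sub rZ; apply/subsetP => x; rewrite !inE => /andP[xv xS].
  exact: cover_contract.
by apply: genericW rE => p; apply: rigid_edges => a b /and3P[].
Qed.

Lemma fogelsanger_step : generic (fun p : conf => rigid (adj C) p (cover C)).
Proof.
have [cC C0 minC] := mC; set N := noU u v C.
have cN : closed k u v N by apply: closed_noU.
have eN : ext k u v N = C by apply: ext_noU.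
have NC : N \subset C by apply/subsetP => F; rewrite inE => /andP[].
(* One configuration has to serve all pieces at once; there are only finitely many chains. *)
have gK : generic (fun p : conf => forall K : {set {set V}},
    [&& K \subset N, minclosedb k u v K & lk k u v K != set0] ->
    rigid (adj C) p (cover K)).
  apply: generic_forall => K; case: (boolP [&& _, _ & _]) => [|_]; last exact: generic_true.
  by case/and3P => KN /minclosedP mK lK; apply: genericW (contract_rigid KN mK lK).
apply: genericW (generic_and (generic_gpos R V k.+2) gK) => p [gp rK].
have [s sC us] := uvC.
have sN : s \in lk k u v N.
  have : s \in ext k u v N by rewrite eN.
  by rewrite in_symd inE sC us.
have coverN : cover N = cover C.
  apply/eqP; rewrite eqEsubset; apply/andP; split; apply/subsetP => x /bigcupP[F].
    by move/(subsetP NC) => FC xF; apply/bigcupP; exists F.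
  rewrite -eN in_symd; have [FN _ xF|FN /= Flk] := boolP (F \in N).
    by apply/bigcupP; exists F.
  exact: (subsetP (lk_cover uv cN Flk)).
have coverU K L : cover (K :|: L) = cover K :|: cover L by apply: bigcup_setU.
(* A rigid closed part [K] grows by a minimal piece of the rest sharing a [lk] cell [t] with it. The
   k + 1 vertices of [t] suffice for gluing in dimension k + 2. *)
have grow m : forall K, (#|N :\: K| <= m)%N -> K \subset N -> closed k u v K ->
    K != set0 -> rigid (adj C) p (cover K) -> rigid (adj C) p (cover N).
  elim: m => [|m IHm] K Km KN cK K0 rigK.
    move: Km; rewrite leqn0 cards_eq0 setD_eq0 => NK.
    by rewrite (_ : N = K) //; apply/eqP; rewrite eqEsubset NK.
  have [<-//|nKN] := eqVneq K N.
  have cD := closedD KN cN cK.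
  (* Otherwise nothing in [lk K] cancels against the rest, and [ext K] is a cycle inside [C];
     minimality then forces [K = N]. *)
  have : ~~ [disjoint lk k u v K & lk k u v (N :\: K)].
    apply/negP => dis; case/eqP: nKN.
    have lkN : lk k u v K \subset lk k u v N.
      by rewrite (lkD k u v KN) symd_disjoint // subsetUl.
    have eKC : ext k u v K \subset C.
      apply/subsetP => F; rewrite in_symd; have [FK _|_ /= Fl] := boolP (F \in K).
        by rewrite (subsetP NC) ?(subsetP KN).
      have Fl' := subsetP lkN _ Fl; rewrite -eN in_symd Fl'.
      have /negPf -> // : F \notin N.
      by rewrite inE; move: Fl'; rewrite inE => /and3P[_ -> _]; rewrite andbF.
    have eK0 : ext k u v K != set0 by apply: contra_neq K0; apply: ext0.
    have eKE : ext k u v K = C by apply: minC => //; case/and3P: cK.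
    by rewrite -(noU_ext cK) eKE.
  rewrite -setI_eq0 => /set0Pn[t]; rewrite inE => /andP[tK tD].
  have [K' [mK' K'D tK']] := minclosed_lk cD tD.
  have [cK' K'0 _] := mK'.
  have K'N : K' \subset N by apply: subset_trans K'D (subsetDl _ _).
  have KK' : [disjoint K & K'].
    by rewrite disjoint_sym; apply: disjointWl K'D _; rewrite -setI_eq0 setDE -setIA (setIC _ K) setICr setI0.
  apply: (IHm (K :|: K')).
  - rewrite -ltnS; apply: leq_trans Km; apply: proper_card.
    rewrite properEneq setDS ?subsetUl // andbT.
    have [F FK'] := set0Pn _ K'0; apply/eqP => e.
    by have := subsetP K'D _ FK'; rewrite -e inE [_ \in K :|: _]inE FK' orbT.
  - by rewrite subUset KN.
  - by rewrite -symd_disjoint // closed_symd.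
  - by have [F FK] := set0Pn _ K0; apply/set0Pn; exists F; rewrite inE FK.
  - have ct : #|t| = k.+1 by have [] := lk_faces cK tK.
    rewrite coverU; apply: (@rigid_glue _ _ _ _ _ _ _ t) => //.
    + apply: rK; apply/and3P; split=> //; first exact/minclosedP.
      by apply/set0Pn; exists t.
    + by have := lk_cover uv cK tK.
    + by have := lk_cover uv cK' tK'.
    + by apply: gp; rewrite ct.
    + by rewrite ct.
have [K [mK KN sK]] := minclosed_lk cN sN.
rewrite -coverN; have [cK K0 _] := mK.
apply: (grow #|N :\: K| K) => //.
apply: rK; apply/and3P; split=> //; first exact/minclosedP.
by apply/set0Pn; exists s.
Qed.

End Step.

Theorem fogelsanger C : mincycle k C ->
  generic (fun p : conf => rigid (adj C) p (cover C)).
Proof.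
have [m] := ubnP #|cover C|; elim: m C => // m IH C Cm mC.
have [cC C0 _] := mC; have [F FC] := set0Pn _ C0.
have cF : #|F| = k.+1 by case/andP: cC => /cells_size/(_ FC).
have /card_gt1P[u [v [uF vF uv]]] : (1 < #|F|)%N by rewrite cF ltnS ltnW.
apply: (@fogelsanger_step C u v) => //; first by exists F; rewrite // /U uF.
by move=> Z ltZ mZ; apply: IH mZ; apply: leq_trans ltZ _.
Qed.

End Fogelsanger.
End Cycles.

From mathcomp Require Import boolp.

(** * The edge-path group *)

Section EdgePaths.
Variables (V : finType) (D : {set {set V}}).
Hypothesis Dsub : forall F G : {set V}, G \subset F -> F \in D -> G \in D.
Implicit Types (u v w : V) (s t : seq V).

Definition edge u v := [set u; v] \in D.
Definition tri u v w := [set u; v; w] \in D.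

Lemma edgeC u v : edge u v = edge v u.
Proof. by rewrite /edge setUC. Qed.

Lemma tri_edges u v w : tri u v w -> [/\ edge u v, edge v w & edge u w].
Proof.
move=> h; split; apply: Dsub h; apply/subsetP => x; rewrite !inE;
by case/orP=> ->; rewrite ?orbT.
Qed.

(** A degenerate triangle, through which [heq_tri] also removes backtracking. *)
Lemma tri_uvu u v : edge u v -> tri u v u.
Proof.
rewrite /edge /tri (_ : [set u; v; u] = [set u; v]) //.
by apply/setP => x; rewrite !inE; case: (x == u); rewrite ?orbF.
Qed.

(* Homotopy of edge paths starting at u, written without their first vertex. *)
Inductive heq (u : V) : seq V -> seq V -> Prop :=
| heq_refl s : heq u s s
| heq_sym s t : heq u s t -> heq u t s
| heq_trans s t r : heq u s t -> heq u t r -> heq u s r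
| heq_tri s v w t : tri (last u s) v w -> heq u (s ++ v :: w :: t) (s ++ w :: t)
| heq_stut s t : edge (last u s) (last u s) -> heq u (s ++ last u s :: t) (s ++ t).

Lemma heq_path u s t : heq u s t -> path edge u s = path edge u t /\ last u s = last u t.
Proof.
elim=> {s t} [//|s t _ [-> ->]//|s t r _ [-> ->] _ [-> ->]//|s v w t h|s t h].
  have [e1 e2 e3] := tri_edges h.
  by rewrite !cat_path /= e1 e2 e3 !last_cat.
by rewrite !cat_path /= h !last_cat.
Qed.

Lemma heq_catl u r s t : heq (last u r) s t -> heq u (r ++ s) (r ++ t).
Proof.
elim=> {s t} [s|s t _|s t q _ IH1 _ IH2|s v w t h|s t h].
- exact: heq_refl.
- exact: heq_sym.
- exact: heq_trans IH1 IH2.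
- by rewrite !catA; apply: heq_tri; rewrite last_cat.
- by have := @heq_stut u (r ++ s) t; rewrite last_cat -!catA; apply.
Qed.

Lemma heq_catr u r s t : heq u s t -> heq u (s ++ r) (t ++ r).
Proof.
elim=> {s t} [s|s t _|s t q _ IH1 _ IH2|s v w t h|s t h].
- exact: heq_refl.
- exact: heq_sym.
- exact: heq_trans IH1 IH2.
- by rewrite -!catA; apply: heq_tri.
- by rewrite -!catA; apply: heq_stut.
Qed.

Definition invp u s := rev (belast u s).

Lemma last_invp u s : last (last u s) (invp u s) = u.
Proof. by case: s => [|v s] //; rewrite /invp /= rev_cons last_rcons. Qed.

Lemma path_invp u s : path edge u s -> path edge (last u s) (invp u s).
Proof. by move=> p; rewrite /invp rev_path (eq_path (e' := edge)) // => x y; rewrite edgeC. Qed.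

Lemma invpK u s : invp (last u s) (invp u s) = s.
Proof.
case: s => [|v s] //; rewrite /invp /= rev_cons.
by rewrite belast_rcons rev_cons revK -lastI.
Qed.

Lemma heq_invr u s : path edge u s -> heq u (s ++ invp u s) [::].
Proof.
elim/last_ind: s => [_|s v IH]; first exact: heq_refl.
rewrite rcons_path => /andP[ps e]; rewrite /invp belast_rcons.
rewrite (lastI u s) rev_rcons cat_rcons.
have := IH ps; apply: heq_trans.
apply: heq_trans (heq_tri _ (tri_uvu e)) _.
apply: heq_stut; apply: Dsub e; apply/subsetP => x; rewrite !inE orbb.
by move=> ->.
Qed.

End EdgePaths.

Section EdgePathGroup.
Variables (V : finType) (D : {set {set V}}).
Hypothesis Dsub : forall F G : {set V}, G \subset F -> F \in D -> G \in D.
Variable a : V.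
Notation edge := (edge D).
Notation heq := (heq D).

Definition loop (s : seq V) := path edge a s && (last a s == a).

Definition rep (s : seq V) := choose (fun t => `[< heq a s t >]) s.

Lemma heq_rep s : heq a s (rep s).
Proof.
apply/asboolP; apply: (@chooseP _ (fun t => `[< heq a s t >])).
by apply/asboolP; apply: heq_refl.
Qed.

Lemma eq_rep s t : heq a s t -> rep s = rep t.
Proof.
move=> st; rewrite /rep (@choose_id _ (fun r => `[< heq a s r >]) s t).
- apply: eq_choose => r; apply/asboolP/asboolP; apply: heq_trans => //.
  exact: heq_sym.
- by apply/asboolP; apply: heq_refl.
- exact/asboolP.
Qed.

Lemma heq_loop s t : heq a s t -> loop s = loop t.
Proof. by move=> /(heq_path Dsub)[p l]; rewrite /loop p l. Qed.

Lemma loop_nil : loop [::]. Proof. by rewrite /loop /= eqxx. Qed.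

Lemma loop_cat s t : loop s -> loop t -> loop (s ++ t).
Proof.
move=> /andP[ps /eqP ls] /andP[pt lt].
by rewrite /loop cat_path last_cat ls ps pt lt.
Qed.

Lemma loop_invp s : loop s -> loop (invp a s).
Proof.
move=> /andP[ps /eqP ls]; have := path_invp ps; have := last_invp a s.
by rewrite ls /loop => -> ->; rewrite eqxx.
Qed.

(* A homotopy class is represented by its canonically chosen element. *)
Definition pi1 (_ : forall F G : {set V}, G \subset F -> F \in D -> G \in D) :=
  {s : seq V | loop s && (rep s == s)}.

HB.instance Definition _ := Choice.copy (pi1 Dsub) {s : seq V | loop s && (rep s == s)}.

Lemma can_rep s : loop s -> loop (rep s) && (rep (rep s) == rep s).
Proof.
by move=> ls; rewrite -(heq_loop (heq_rep s)) ls -(eq_rep (heq_rep s)) eqxx.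
Qed.

Definition cls (s : seq V) : pi1 Dsub :=
  insubd (Sub (rep [::]) (can_rep loop_nil) : {s : seq V | loop s && (rep s == s)}) (rep s).

Lemma cls_val s : loop s -> heq a (val (cls s)) s.
Proof.
by move=> ls; rewrite /cls val_insubd can_rep //; apply: heq_sym; apply: heq_rep.
Qed.

Lemma loop_val (x : pi1 Dsub) : loop (val x).
Proof. by have /andP[] := valP x. Qed.

Lemma cls_eq s t : heq a s t -> cls s = cls t.
Proof. by move=> st; rewrite /cls (eq_rep st). Qed.

Lemma val_cls (x : pi1 Dsub) : cls (val x) = x.
Proof.
have /andP[lx /eqP rx] := valP x.
by apply: val_inj; rewrite /cls val_insubd rx lx rx eqxx.
Qed.

Lemma cls_inj s t : loop s -> loop t -> cls s = cls t -> heq a s t.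
Proof.
move=> ls lt e; apply: heq_trans (heq_sym (cls_val ls)) _.
by rewrite e; apply: cls_val.
Qed.

Definition pi_one : pi1 Dsub := cls [::].
Definition pi_mul (x y : pi1 Dsub) : pi1 Dsub := cls (val x ++ val y).
Definition pi_inv (x : pi1 Dsub) : pi1 Dsub := cls (invp a (val x)).

Lemma cls_cat s t : loop s -> loop t -> pi_mul (cls s) (cls t) = cls (s ++ t).
Proof.
move=> ls lt; apply: cls_eq; apply: heq_trans (heq_catr _ (cls_val ls)) _.
by apply: heq_catl; have /andP[_ /eqP ->] := ls; apply: cls_val.
Qed.

Lemma pi_mulA : associative pi_mul.
Proof.
move=> x y z; rewrite -[x]val_cls -[y]val_cls -[z]val_cls.
by rewrite !cls_cat ?loop_cat ?loop_val // catA.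
Qed.

Lemma pi_mul1 : left_id pi_one pi_mul.
Proof. by move=> x; rewrite -[x]val_cls cls_cat ?loop_val ?loop_nil. Qed.

Lemma pi_1mul : right_id pi_one pi_mul.
Proof. by move=> x; rewrite -[x]val_cls cls_cat ?loop_val ?loop_nil // cats0. Qed.

Lemma pi_mulV : right_inverse pi_one pi_inv pi_mul.
Proof.
move=> x; rewrite /pi_inv -{1}[x]val_cls cls_cat ?loop_invp ?loop_val //.
by apply: cls_eq; apply: heq_invr => //; have /andP[] := loop_val x.
Qed.

Lemma pi_Vmul : left_inverse pi_one pi_inv pi_mul.
Proof.
move=> x; rewrite /pi_inv -{2}[x]val_cls cls_cat ?loop_invp ?loop_val //.
have /andP[px /eqP lx] := loop_val x.
have := path_invp px; rewrite lx => pi.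
have := invpK a (val x); rewrite lx => e.
by apply: cls_eq; have := heq_invr Dsub pi; rewrite e.
Qed.

HB.instance Definition _ := isGroup.Build (pi1 Dsub)
  pi_mulA pi_mul1 pi_1mul pi_Vmul pi_mulV.

Section Gains.
Variable gam : V -> seq V.
Hypothesis gam_path : forall v, [set v] \in D -> path edge a (gam v) /\ last a (gam v) = v.
Hypothesis gam_a : gam a = [::].

(** The loop through the edge [uv] closed up by the paths [gam]. When the universal cover is written
    as vertices times group, this is the change of sheet along [uv]. *)
Definition gain u v : pi1 Dsub := cls (gam u ++ v :: invp a (gam v)).

Lemma edge_vertex u v : edge u v -> [set u] \in D /\ [set v] \in D.
Proof. by move=> e; split; apply: Dsub e; rewrite sub1set !inE eqxx ?orbT. Qed.

Lemma loop_gain u v : edge u v -> loop (gam u ++ v :: invp a (gam v)).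
Proof.
move=> e; have [/gam_path[pu lu] /gam_path[pv lv]] := edge_vertex e.
rewrite /loop cat_path last_cat pu lu /= e.
have := path_invp pv; have := last_invp a (gam v); rewrite lv => -> ->.
by rewrite eqxx.
Qed.

(** The excursion from [v] to the base point and back is null-homotopic, and the triangle then
    absorbs [v]. *)
Lemma gain_flat u v w : tri D u v w -> (gain u v * gain v w)%g = gain u w.
Proof.
move=> h; have [e1 e2 e3] := tri_edges Dsub h.
rewrite [LHS]cls_cat ?loop_gain //; apply: cls_eq.
have [/gam_path[pu lu] /gam_path[pv lv]] := edge_vertex e1.
rewrite -catA /=; apply: (@heq_trans _ _ _ _ (gam u ++ v :: w :: invp a (gam w))).
  apply: heq_catl; rewrite lu -cat1s -[v :: w :: _]cat1s; apply: heq_catl => /=.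
  rewrite catA -[w :: _]cat0s; apply: heq_catr.
  have := heq_invr Dsub (path_invp pv); rewrite lv.
  by have := invpK a (gam v); rewrite lv => ->.
by apply: heq_tri; rewrite lu.
Qed.

Lemma gain_self v : [set v] \in D -> gain v v = 1%g.
Proof.
move=> vD; have h : tri D v v v by rewrite /tri !setUid.
by apply: (mulgI (gain v v)); rewrite gain_flat // mulg1.
Qed.

Fixpoint holonomy v (s : seq V) : pi1 Dsub :=
  if s is w :: s' then (gain v w * holonomy w s')%g else 1%g.

Lemma holonomyE v s : [set v] \in D -> path edge v s ->
  holonomy v s = cls (gam v ++ s ++ invp a (gam (last v s))).
Proof.
elim: s v => [|w s IH] v vD /=.
  have [pv lv] := gam_path vD.
  by move=> _; apply: cls_eq; apply: heq_sym; apply: heq_invr.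
move=> /andP[e ps]; have [_ wD] := edge_vertex e.
rewrite IH // [LHS]cls_cat ?loop_gain //; last first.
  have [pw lw] := gam_path wD; have [_ lD] : [set w] \in D /\ [set last w s] \in D.
    split=> //; elim: s w ps wD {IH e pw lw} => //= x s IHs w /andP[e' ps'] _.
    by apply: (IHs x ps'); have [] := edge_vertex e'.
  have [pl ll] := gam_path lD.
  rewrite /loop !cat_path !last_cat pw lw ps /=.
  by have := path_invp pl; have := last_invp a (gam (last w s)); rewrite ll => -> ->; rewrite eqxx.
have [pv lv] := gam_path vD; have [pw lw] := gam_path wD.
apply: cls_eq; rewrite -catA /=; apply: heq_catl; rewrite lv -cat1s -[w :: s ++ _]cat1s.
apply: heq_catl => /=; rewrite catA -[X in heq _ _ X]cat0s; apply: heq_catr.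
have := heq_invr Dsub (path_invp pw); rewrite lw.
by have := invpK a (gam w); rewrite lw => ->.
Qed.

(** The connecting paths telescope, and [gam a] is empty, so the holonomy of a loop at [a] is its
    own class. *)
Lemma holonomy_onto (x : pi1 Dsub) : [set a] \in D ->
  exists2 s, path edge a s /\ last a s = a & holonomy a s = x.
Proof.
move=> aD; have /andP[px /eqP lx] := loop_val x; exists (val x) => //.
by rewrite holonomyE // gam_a lx gam_a /= cats0 val_cls.
Qed.

End Gains.
End EdgePathGroup.

(** * Links and stars in a normal pseudomanifold *)

Section Pseudomanifold.
Variables (V : finType) (D : {set {set V}}) (k : nat).
Implicit Types (F G H T A : {set V}) (a u v w : V).
Hypothesis Dsub : forall F G, G \subset F -> F \in D -> G \in D.
Hypothesis pure : forall F, facet D F -> #|F| = k.+2.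
Hypothesis two : forall G, G \in D -> #|G| = k.+1 ->
  #|[set F | facet D F & G \subset F]| = 2.
Hypothesis linkconn : forall G A a v, G \in D -> G != set0 -> (#|G| < k.+1)%N ->
  (forall H u w, H \in link D G -> u \in H -> w \in H -> (u \in A) = (w \in A)) ->
  [set a] \in link D G -> a \in A -> [set v] \in link D G -> v \in A.

Lemma facetP G : G \in D -> exists2 F, facet D F & G \subset F.
Proof. by move=> /(@maxset_exists _ (fun G => G \in D))[F mF GF]; exists F. Qed.

Lemma facet_face F : facet D F -> F \in D.
Proof. by move=> /maxsetP[]. Qed.

(** With d = k + 1 these cells have k + 1 vertices: the link of a vertex is a chain of dimension k =
    d - 1. *)
Definition link_facets v := [set H : {set V} | (v \notin H) && facet D (v |: H)].

Lemma link_facets_card v H : H \in link_facets v -> #|H| = k.+1.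
Proof. by rewrite inE => /andP[vH /pure]; rewrite cardsU1 vH => -[]. Qed.

Lemma link_facetsD1 v F : facet D F -> v \in F -> F :\ v \in link_facets v.
Proof. by move=> fF vF; rewrite inE setD11 setD1K. Qed.

Lemma deg_link_facets v T : v \notin T -> #|T| = k -> v |: T \in D ->
  deg (link_facets v) T = 2.
Proof.
move=> vT cT TD; rewrite -(two TD) ?cardsU1 ?vT ?cT // /deg.
rewrite -[LHS](card_in_imset (f := fun H => v |: H)).
  apply: eq_card => F; rewrite !inE; apply/imsetP/andP => [[H]|[fF]].
    by rewrite !inE => /andP[/andP[vH fH] TH] ->; rewrite setUS.
  rewrite subUset sub1set => /andP[vF TF]; exists (F :\ v); last by rewrite setD1K.
  by rewrite inE link_facetsD1 // subsetD1 TF.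
move=> H K; rewrite !inE => /andP[/andP[vH _] _] /andP[/andP[vK _] _] e.
by rewrite -(setU1K vH) e setU1K.
Qed.

Lemma cycle_link_facets v : cycle k (link_facets v).
Proof.
apply/cycleP; split=> [|T cT]; first by apply/cellsP => H; apply: link_facets_card.
have [|h] := boolP ((v \notin T) && (v |: T \in D)).
  by case/andP=> vT TD; rewrite deg_link_facets.
rewrite /deg (_ : [set F in link_facets v | T \subset F] = set0) ?cards0 //.
apply/setP => F; rewrite !inE; apply: contraNF h.
case/andP=> /andP[vF fF] TF; apply/andP; split.
  by apply: contra vF; apply/subsetP.
by apply: Dsub (facet_face fF); rewrite setUS.
Qed.

(** Descending induction on the size of [G]. In codimension one, evenness puts both facets in [Z] or
    neither; for smaller [G], the connected link of [G] leads from one facet to the other through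
    facets sharing one more vertex. *)
Lemma constant_on_facets v Z G F F' : cycle k Z -> Z \subset link_facets v ->
  v \in G -> facet D F -> facet D F' -> G \subset F -> G \subset F' ->
  F :\ v \in Z -> F' :\ v \in Z.
Proof.
move=> /cycleP[_ cZ] ZC vG; have [m] := ubnP (k.+2 - #|G|).
elim: m G F F' vG => // m IH G F F' vG mG fF fF' GF GF' FZ.
have GD : G \in D by apply: Dsub GF (facet_face fF).
have [Gk|Gk] := ltnP k.+1 #|G|.
  have E K : facet D K -> G \subset K -> G = K.
    by move=> fK GK; apply/eqP; rewrite eqEcard GK (pure fK).
  by rewrite -(E F') // (E F).
have [Gk1|Gk1] := eqVneq #|G| k.+1.
  have vT : v \notin G :\ v by rewrite setD11.
  have cT : #|G :\ v| = k by move: Gk1; rewrite (cardsD1 v) vG => -[].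
  have d2 : deg (link_facets v) (G :\ v) = 2 by rewrite deg_link_facets ?setD1K.
  have dZ : (1 < deg Z (G :\ v))%N.
    have : (0 < deg Z (G :\ v))%N.
      by apply/card_gt0P; exists (F :\ v); rewrite inE FZ setSD.
    by have := cZ _ cT; case: (deg _ _) => [|[]].
  have /eqP eZ : [set K in Z | G :\ v \subset K] ==
      [set K in link_facets v | G :\ v \subset K].
    rewrite eqEcard; apply/andP; split.
      by apply/subsetP => K; rewrite !inE => /andP[/(subsetP ZC)]; rewrite inE => -> ->.
    by rewrite -[X in (X <= _)%N]/(deg (link_facets v) (G :\ v)) d2.
  have : F' :\ v \in [set K in link_facets v | G :\ v \subset K].
    by rewrite inE link_facetsD1 ?setSD // (subsetP GF').
  by rewrite -eZ inE => /andP[].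
have Gk2 : (#|G| < k.+1)%N by rewrite ltn_neqAle Gk1.
(* By induction, one facet through [u |: G] whose cell is in [Z] brings in all of them, so [A] is
   constant on each face of [link D G]. *)
pose A := [set u | [exists K, [&& facet D K, u |: G \subset K & K :\ v \in Z]]].
have IHu u K K' : u \notin G -> facet D K -> facet D K' -> u |: G \subset K ->
    u |: G \subset K' -> K :\ v \in Z -> K' :\ v \in Z.
  move=> uG; apply: IH; first by rewrite inE vG orbT.
  rewrite cardsU1 uG -ltnS; apply: leq_trans mG.
  by rewrite ltnS add1n subnSK // leqW.
have mono H u w : H \in link D G -> u \in H -> w \in H -> u \in A -> w \in A.
  rewrite !inE => /and3P[_ HG /eqP HG0] uH wH /existsP[K /and3P[fK uK KZ]].
  have [K' fK' /[!subUset]/andP[HK' GK']] := facetP HG.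
  apply/existsP; exists K'; rewrite fK' subUset sub1set (subsetP HK') //= GK' /=.
  apply: (IHu u K) => //; last by rewrite subUset sub1set (subsetP HK').
  by apply/negP => uG; move/setP/(_ u): HG0; rewrite !inE uH uG.
have outside K : facet D K -> G \subset K -> exists2 a, a \in K & a \notin G.
  move=> fK GK; apply/subsetPn/negP => KG.
  by have := subset_leq_card KG; rewrite (pure fK) leqNgt leqW.
have vlink K a : facet D K -> G \subset K -> a \in K -> a \notin G ->
    [set a] \in link D G.
  move=> fK GK aK aG; rewrite inE; apply/and3P; split.
  - by apply: Dsub (facet_face fK); rewrite sub1set.
  - by apply: Dsub (facet_face fK); rewrite subUset sub1set aK.
  - by rewrite setI_eq0 disjoints1.
have [[a aF aG] [b bF' bG]] := (outside F fF GF, outside F' fF' GF').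
have : b \in A.
  apply: (linkconn GD) (vlink F a fF GF aF aG) _ (vlink F' b fF' GF' bF' bG) => //.
  - by apply/set0Pn; exists v.
  - by move=> H u w HG uH wH; apply/idP/idP; apply: mono HG _ _.
  - by rewrite inE; apply/existsP; exists F; rewrite fF subUset sub1set aF GF.
rewrite inE => /existsP[K /and3P[fK bK KZ]].
apply: (IHu b K F') => //; by rewrite subUset sub1set bF'.
Qed.

Lemma mincycle_link_facets v : [set v] \in D -> mincycle k (link_facets v).
Proof.
move=> vD; have [F fF vF] := facetP vD.
split; first exact: cycle_link_facets.
  by apply/set0Pn; exists (F :\ v); rewrite link_facetsD1 // -sub1set.
move=> Z ZC cZ /set0Pn[H HZ]; apply/eqP; rewrite eqEsubset ZC; apply/subsetP => K.
have := subsetP ZC _ HZ; rewrite !inE => /andP[vH fH] /andP[vK fK].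
have := @constant_on_facets v Z [set v] (v |: H) (v |: K).
by rewrite !sub1set !setU11 !setU1K // inE eqxx; apply.
Qed.

(** Fogelsanger's theorem makes the link rigid in R^(k+2); the cone over it lives in R^(k+3) and
    uses only pairs spanning a face with [v]. *)
Lemma star_rigid (R : realFieldType) v : (2 <= k)%N -> [set v] \in D ->
  generic (fun p : V -> 'rV[R]_k.+3 => rigid (tri D v) p [set u | edge D v u]).
Proof.
move=> k2 vD; set C := link_facets v; have mC := mincycle_link_facets vD.
have [_ /set0Pn[B BC] _] := mC.
have [p' [rp' gp']] := generic_ex (generic_and (@fogelsanger _ R _ k2 C mC) (@generic_gpos R V k.+2)).
have BS : B \subset cover C by apply: bigcup_sup.
have starE : v |: cover C = [set u | edge D v u].
  apply/setP => u; rewrite !inE; apply/orP/idP => [[/eqP ->|/bigcupP[H]]|].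
  - by rewrite /edge setUid.
  - rewrite inE => /andP[_ fH uH]; apply: Dsub (facet_face fH).
    by rewrite subUset !sub1set !inE eqxx uH orbT.
  case/facetP=> F fF /[!subUset] /[!sub1set]/andP[vF uF].
  have [->|uv] := eqVneq u v; [by left|right].
  by apply/bigcupP; exists (F :\ v); rewrite ?link_facetsD1 // !inE uv.
have adjD a b : adj C a b -> tri D v a b.
  case/adjP=> H [/[!inE]/andP[_ fH] aH bH]; apply: Dsub (facet_face fH).
  by rewrite !subUset !sub1set !inE eqxx aH bH !orbT.
have inS u : u \in v |: cover C -> edge D v u by rewrite starE inE.
rewrite -starE; apply: (@cone_rigid _ _ _ (adj C) _ (cover C) B v p') => //.
- by apply/bigcupP => -[H /[!inE]/andP[/negP vH _]].
- by rewrite (link_facets_card BC).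
- by rewrite (link_facets_card BC).
- by apply: gp'; rewrite (link_facets_card BC).
- by move=> a b ab; have /andP[-> ->] := adj_cover ab; rewrite adjD.
- by move=> a /inS; rewrite /tri /edge setUid => e; rewrite setUAC setUid e.
- move=> a b ab; have [va _ vb] := tri_edges Dsub ab.
  by rewrite starE !inE va.
- by move=> a b aB bB; apply: adjD; apply/adjP; exists B.
Qed.

End Pseudomanifold.

(** * Motions of the universal cover *)

Section Cover.
Local Open Scope ring_scope.
Variables (R : realFieldType) (V : finType) (D : {set {set V}}) (k : nat) (a : V).
Hypothesis Dsub : forall F G : {set V}, G \subset F -> F \in D -> G \in D.
Hypothesis pure : forall F, facet D F -> #|F| = k.+2.
Hypothesis aD : [set a] \in D.
Variable gam : V -> seq V.
Hypothesis gam_path : forall v, [set v] \in D ->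
  path (edge D) a (gam v) /\ last a (gam v) = v.
Hypothesis gam_a : gam a = [::].
Variable p : V -> 'rV[R]_k.+3.
Hypothesis pgen : gpos p.
Hypothesis prig : forall v, [set v] \in D -> rigid (tri D v) p [set u | edge D v u].

Local Notation G := (pi1 a Dsub).
Local Notation gain := (gain Dsub a gam).
Local Notation holonomy := (holonomy Dsub a gam).

Variable y : V -> G -> 'rV[R]_k.+3.
Hypothesis cover_motion : forall u v h, edge D u v ->
  dot (y u h) (p v) + dot (y v (h * gain u v)%g) (p u) = 0.

(** The pair of [v] and [h] stands for the vertex over [v] in sheet [h] of the universal cover; its
    neighbour over [u] is in sheet [h * gain v u]. *)
Definition trivial_at A v h := forall u, edge D v u -> y u (h * gain v u)%g = p u *m A.

(** By [gain_flat] the star of [v] lifts isomorphically to the sheet [h], so rigidity of the star in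
    [D] applies. *)
Lemma trivial_at_ex v h : [set v] \in D -> exists2 A, A^T = - A & trivial_at A v h.
Proof.
move=> vD; have [|A skA Aw] := prig vD (w := fun u => y u (h * gain v u)%g).
  move=> b c bc; have [_ e _] := tri_edges Dsub bc.
  by have := cover_motion (h * gain v b)%g e; rewrite -mulgA (gain_flat Dsub gam_path).
by exists A => // u e; rewrite Aw ?inE.
Qed.

Lemma trivial_at_step A v u h : A^T = - A -> edge D v u ->
  trivial_at A v h -> trivial_at A u (h * gain v u)%g.
Proof.
move=> skA e tA; have [_ uD] := edge_vertex Dsub e.
have [A' skA' tA'] := trivial_at_ex (h * gain v u)%g uD.
have [F fF /[!subUset] /[!sub1set]/andP[vF uF]] := facetP e.
have inF b c d : b \in F -> c \in F -> d \in F -> tri D b c d.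
  move=> bF cF dF; apply: Dsub (facet_face fF).
  by rewrite !subUset !sub1set bF cF dF.
suff AA : A - A' = 0 by rewrite (subr0_eq AA).
apply: (@skew_eq0 _ _ _ p F); rewrite ?(pure fF) //.
- by apply: pgen; rewrite (pure fF).
- by rewrite linearB /= skA skA' opprB opprK addrC.
move=> b bF; have [_ _ vb] := tri_edges Dsub (inF v u b vF uF bF).
have [_ _ ub] := tri_edges Dsub (inF u v b uF vF bF).
by rewrite mulmxBr -tA // -tA' // -mulgA (gain_flat Dsub gam_path) ?subrr //; apply: inF.
Qed.

Lemma trivial_at_path A v s h : A^T = - A -> path (edge D) v s ->
  trivial_at A v h -> trivial_at A (last v s) (h * holonomy v s)%g.
Proof.
move=> skA; elim: s v h => [|u s IH] v h /=; first by rewrite mulg1.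
by move=> /andP[e ps] /(trivial_at_step skA e)/(IH _ _ ps); rewrite mulgA.
Qed.

Lemma cover_motion_constant v h : [set v] \in D -> y v h = y v 1%g.
Proof.
move=> vD; have [A skA tA] := trivial_at_ex 1%g aD.
suff yA g : y v g = p v *m A by rewrite !yA.
have tx x : trivial_at A a x.
  have [s [ps ls] <-] := holonomy_onto gam_path gam_a x aD.
  by have := trivial_at_path skA ps tA; rewrite ls mul1g.
have [pv lv] := gam_path vD.
(* The sheet over [a] is chosen so that the lift of [gam v] ends in sheet [g]. *)
have := trivial_at_path skA pv (tx (g * (holonomy a (gam v))^-1)%g).
rewrite lv mulgVK => /(_ v); rewrite (gain_self Dsub gam_path) // mulg1; apply.
by rewrite /edge setUid.
Qed.

End Cover.

From mathcomp Require Import all_classical all_reals all_analysis homotopy.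
From mathcomp Require Import zify.
Import numFieldNormedType.Exports.
Local Open Scope ring_scope.

(** * Equations over a group ring *)

Section FiniteSupport.
Local Open Scope classical_set_scope.
Local Open Scope ring_scope.
Variables (R : realType) (G : groupType).
Implicit Types (f g : G -> R).

Definition fsupp f := exists s : seq G, forall h, h \notin s -> f h = 0.

Definition fsum f : R := \sum_(h \in [set: G]) f h.

Lemma fsumE f s : uniq s -> (forall h, h \notin s -> f h = 0) ->
  fsum f = \sum_(h <- s) f h.
Proof.
move=> us fs; rewrite /fsum (fsbigE s) //; last by move=> h _; apply: fs.
by apply: eq_bigl => h; rewrite in_setT.
Qed.

Lemma fsupp2 f g : fsupp f -> fsupp g -> exists s : seq G,
  [/\ uniq s, forall h, h \notin s -> f h = 0 & forall h, h \notin s -> g h = 0].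
Proof.
move=> [s fs] [t gt]; exists (undup (s ++ t)); split; first exact: undup_uniq.
  by move=> h; rewrite mem_undup mem_cat negb_or => /andP[/fs].
by move=> h; rewrite mem_undup mem_cat negb_or => /andP[_ /gt].
Qed.

Lemma fsupp0 : fsupp (fun=> 0). Proof. by exists [::]. Qed.

Lemma fsuppM f g : fsupp f -> fsupp (fun h => f h * g h).
Proof. by move=> [s fs]; exists s => h /fs ->; rewrite mul0r. Qed.

Lemma fsuppZ a f : fsupp f -> fsupp (fun h => a * f h).
Proof. by move=> [s fs]; exists s => h /fs ->; rewrite mulr0. Qed.

Lemma fsuppD f g : fsupp f -> fsupp g -> fsupp (fun h => f h + g h).
Proof.
by move=> sf sg; have [s [_ f0 g0]] := fsupp2 sf sg; exists s => h hs; rewrite f0 ?g0 ?addr0.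
Qed.

Lemma fsupp_sum (I : Type) (r : seq I) (f : I -> G -> R) : (forall i, fsupp (f i)) ->
  fsupp (fun h => \sum_(i <- r) f i h).
Proof.
move=> fs; elim: r => [|i r IH].
  under [X in fsupp X]eq_fun do rewrite big_nil.
  exact: fsupp0.
under [X in fsupp X]eq_fun do rewrite big_cons.
exact: fsuppD.
Qed.

Lemma fsupp_shift f k : fsupp f -> fsupp (fun h => f (h * k)%g).
Proof.
move=> [s fs]; exists [seq (h * k^-1)%g | h <- s] => h hs; apply: fs.
apply: contra hs => hs; apply/mapP; exists (h * k)%g => //.
by rewrite mulgK.
Qed.

Lemma fsumD f g : fsupp f -> fsupp g ->
  fsum (fun h => f h + g h) = fsum f + fsum g.
Proof.
move=> sf sg; have [s [us f0 g0]] := fsupp2 sf sg.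
rewrite !(@fsumE _ s) // ?big_split // => h hs; by rewrite f0 ?g0 ?addr0.
Qed.

Lemma fsumZ a f : fsupp f -> fsum (fun h => a * f h) = a * fsum f.
Proof.
move=> sf; have [s [us f0 _]] := fsupp2 sf sf.
by rewrite !(@fsumE _ s) // ?mulr_sumr // => h hs; rewrite f0 ?mulr0.
Qed.

Lemma fsum0 : fsum (fun=> 0) = 0.
Proof. by rewrite (@fsumE _ [::]) // big_nil. Qed.

Lemma fsum_sum (I : finType) (f : I -> G -> R) : (forall i, fsupp (f i)) ->
  fsum (fun h => \sum_i f i h) = \sum_i fsum (f i).
Proof.
move=> fs.
elim: (index_enum I) => [|i r IH].
  under [X in fsum X]eq_fun do rewrite big_nil.
  by rewrite big_nil fsum0.
under [X in fsum X]eq_fun do rewrite big_cons.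
by rewrite big_cons fsumD ?IH //; exact: fsupp_sum.
Qed.

Lemma fsum_shift f k : fsum (fun h => f (h * k)%g) = fsum f.
Proof.
rewrite /fsum [RHS](reindex_fsbigT (fun h => h * k)%g) //.
by exists (fun h => h * k^-1)%g => h; rewrite ?mulgK ?mulgVK.
Qed.

Lemma fsum_ge_sub f s : fsupp f -> (forall h, 0 <= f h) -> uniq s ->
  \sum_(h <- s) f h <= fsum f.
Proof.
move=> [t f0] fge us.
have ut : uniq (s ++ [seq h <- undup t | h \notin s]).
  rewrite cat_uniq us filter_uniq ?undup_uniq // andbT.
  by apply/hasPn => h; rewrite mem_filter => /andP[].
rewrite (fsumE ut); first by rewrite big_cat lerDl sumr_ge0.
move=> h; rewrite mem_cat mem_filter negb_or => /andP[hs].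
by rewrite hs mem_undup => /f0.
Qed.

Lemma fsum_ge0 f : fsupp f -> (forall h, 0 <= f h) -> 0 <= fsum f.
Proof. by move=> sf fge; have := fsum_ge_sub sf fge (isT : uniq [::]); rewrite big_nil. Qed.

Lemma le_fsum f g : fsupp f -> fsupp g -> (forall h, f h <= g h) -> fsum f <= fsum g.
Proof.
move=> sf sg le; have [s [us f0 g0]] := fsupp2 sf sg.
by rewrite !(@fsumE _ s) // ler_sum.
Qed.

End FiniteSupport.

Section Vectors.
Local Open Scope classical_set_scope.
Local Open Scope ring_scope.
Variables (R : realType) (G : groupType).
Implicit Types (I J : finType).

Definition fvec I (y : I -> G -> R) := forall i, fsupp (y i).
Definition ip I (y z : I -> G -> R) : R := \sum_i fsum (fun h => y i h * z i h).

Lemma ipC I (y z : I -> G -> R) : ip y z = ip z y.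
Proof. by apply: eq_bigr => i _; congr fsum; apply/funext => h; rewrite mulrC. Qed.

(* Right convolution by a matrix over the group ring with entries a + b.[c]. *)
Definition op I J (a b : J -> I -> R) (c : J -> I -> G) (y : I -> G -> R) :
    J -> G -> R :=
  fun j h => \sum_i (a j i * y i h + b j i * y i (h * c j i)%g).

(** The adjoint for [ip]: transposed coefficients and inverted group elements. *)
Definition opT I J (a b : J -> I -> R) (c : J -> I -> G) : (J -> G -> R) -> (I -> G -> R) :=
  op (fun i j => a j i) (fun i j => b j i) (fun i j => (c j i)^-1)%g.

Definition comb I (t : R) (y z : I -> G -> R) : I -> G -> R := fun i h => y i h + t * z i h.

Ltac fs := by intros; repeat first [ assumption
  | match goal with H : fvec ?y |- fsupp (?y _) => exact: H end
  | apply: fsuppD | apply: fsuppZ | apply: fsuppM | apply: fsupp_shift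
  | apply: fsupp_sum; intro ].

Section Op.
Variables (I J : finType) (a b : J -> I -> R) (c : J -> I -> G).
Notation M := (op a b c).
Notation Mt := (opT a b c).
Implicit Types (y z : I -> G -> R) (w : J -> G -> R).

Lemma fvec_op y : fvec y -> fvec (M y).
Proof.
move=> fy j; apply: fsupp_sum => i; apply: fsuppD; apply: fsuppZ => //.
exact: fsupp_shift.
Qed.

Lemma fvec_comb t y z : fvec y -> fvec z -> fvec (comb t y z).
Proof. by move=> fy fz i; apply: fsuppD => //; apply: fsuppZ. Qed.

Lemma ip_combl t y z x : fvec y -> fvec z -> ip (comb t y z) x = ip y x + t * ip z x.
Proof.
move=> fy fz; rewrite /ip mulr_sumr -big_split; apply: eq_bigr => i _ /=.
rewrite -fsumZ; last exact: fsuppM.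
rewrite -fsumD; [|exact: fsuppM|by apply: fsuppZ; exact: fsuppM].
by congr fsum; apply/funext => h; rewrite /comb; ring.
Qed.

Lemma ip_combr t y z x : fvec y -> fvec z -> ip x (comb t y z) = ip x y + t * ip x z.
Proof. by move=> fy fz; rewrite ipC ip_combl // !(ipC x). Qed.

Lemma ip_ge0 y : fvec y -> 0 <= ip y y.
Proof.
move=> fy; apply: sumr_ge0 => i _; apply: fsum_ge0 => [|h]; first exact: fsuppM.
by rewrite -expr2 sqr_ge0.
Qed.

Lemma ip_ge_seq y i s : fvec y -> uniq s -> \sum_(h <- s) (y i h) ^+ 2 <= ip y y.
Proof.
move=> fy us; apply: (@le_trans _ _ (fsum (fun h => y i h * y i h))).
  under eq_bigr do rewrite expr2.
  by apply: fsum_ge_sub => // [|h]; [exact: fsuppM|rewrite -expr2 sqr_ge0].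
rewrite /ip (bigD1 i) //= lerDl sumr_ge0 // => i' _.
by apply: fsum_ge0 => [|h]; [exact: fsuppM|rewrite -expr2 sqr_ge0].
Qed.

Lemma ip_ge1 y i h : fvec y -> (y i h) ^+ 2 <= ip y y.
Proof. by move=> fy; have := ip_ge_seq i fy (isT : uniq [:: h]); rewrite big_seq1. Qed.

Lemma ip_adj y w : fvec y -> fvec w -> ip (M y) w = ip y (Mt w).
Proof.
move=> fy fw; rewrite /ip.
transitivity (\sum_j \sum_i (a j i * fsum (fun h => y i h * w j h) +
    b j i * fsum (fun h => y i (h * c j i)%g * w j h))).
  apply: eq_bigr => j _; rewrite /op.
  under [X in fsum X]eq_fun do rewrite mulr_suml.
  rewrite fsum_sum; last by fs.
  apply: eq_bigr => i _; rewrite -!fsumZ; try fs.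
  rewrite -fsumD; try fs.
  by congr fsum; apply/funext => h; ring.
rewrite exchange_big; apply: eq_bigr => i _; rewrite /opT /op.
under [X in fsum X]eq_fun do rewrite mulr_sumr.
rewrite fsum_sum; last by fs.
apply: eq_bigr => j _.
rewrite -(fsum_shift (fun h => y i (h * c j i)%g * w j h) (c j i)^-1%g).
under [X in _ + _ * fsum X]eq_fun do rewrite mulgVK.
rewrite -!fsumZ; try fs.
rewrite -fsumD; try fs.
by congr fsum; apply/funext => h; ring.
Qed.

Lemma sqr_sum_le (K : finType) (x : K -> R) : (\sum_k x k) ^+ 2 <= #|K|%:R * \sum_k (x k) ^+ 2.
Proof.
have -> : #|K|%:R * \sum_k (x k) ^+ 2 = \sum_k \sum_l (x k ^+ 2 + x l ^+ 2) / 2.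
  apply/esym; under eq_bigr => k _ do (under eq_bigr => l _ do rewrite mulrDl).
  under eq_bigr => k _ do rewrite big_split /= sumr_const -mulr_suml.
  rewrite big_split /= sumr_const sumrMnl -mulr_suml -(mulr_natl _ #|K|).
  set n := #|K|%:R; set X := \sum_k _. by field.
rewrite expr2 mulr_suml; apply: ler_sum => k _; rewrite mulr_sumr; apply: ler_sum => l _.
by rewrite ler_pdivlMr //; have := sqr_ge0 (x k - x l); nra.
Qed.

(** Cauchy-Schwarz over the finite index set [J]; translations by group elements preserve the
    norm. *)
Lemma op_bound : exists2 C, 0 < C & forall w, fvec w -> ip (Mt w) (Mt w) <= C * ip w w.
Proof.
pose k := #|J|%:R : R.
exists (1 + \sum_j \sum_i 2 * k * (a j i ^+ 2 + b j i ^+ 2)).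
  rewrite ltr_wpDr // sumr_ge0 // => j _; rewrite sumr_ge0 // => i _.
  by rewrite !mulr_ge0 // ?ler0n // addr_ge0 ?sqr_ge0.
move=> w fw; rewrite mulrDl mul1r ler_wpDl ?ip_ge0 //.
  by apply: sumr_ge0 => j _; apply: fsum_ge0 => [|h]; [exact: fsuppM|rewrite -expr2 sqr_ge0].
pose nw j := fsum (fun h => w j h * w j h).
have nw0 j : 0 <= nw j by apply: fsum_ge0 => [|h]; [exact: fsuppM|rewrite -expr2 sqr_ge0].
have nwl j : nw j <= ip w w.
  by rewrite /ip (bigD1 j) //= lerDl sumr_ge0 // => i _; exact: nw0.
rewrite exchange_big mulr_suml; apply: ler_sum => i _.
apply: (@le_trans _ _ (\sum_j 2 * k * (a j i ^+ 2 * nw j + b j i ^+ 2 * nw j))); last first.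
  rewrite mulr_suml; apply: ler_sum => j _; rewrite -mulrDl mulrA ler_wpM2l //.
  by rewrite !mulr_ge0 // ?ler0n // addr_ge0 ?sqr_ge0.
have sh j : fsupp (fun h => w j (h * (c j i)^-1)%g * w j (h * (c j i)^-1)%g).
  by apply: fsuppM; exact: fsupp_shift.
have E j : 2 * k * (a j i ^+ 2 * nw j + b j i ^+ 2 * nw j) =
   fsum (fun h => 2 * k * (a j i ^+ 2 * (w j h * w j h) +
      b j i ^+ 2 * (w j (h * (c j i)^-1)%g * w j (h * (c j i)^-1)%g))).
  rewrite fsumZ; last by apply: fsuppD; apply: fsuppZ => //; exact: fsuppM.
  rewrite fsumD; [|by apply: fsuppZ; exact: fsuppM|by apply: fsuppZ].
  rewrite !fsumZ //; last exact: fsuppM.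
  by rewrite (fsum_shift (fun h => w j h * w j h)).
rewrite (eq_bigr _ (fun j _ => E j)) -fsum_sum; last first.
  by move=> j; apply: fsuppZ; apply: fsuppD; apply: fsuppZ => //; exact: fsuppM.
apply: le_fsum => [||h].
- by apply: fsuppM; apply: (@fsupp_sum _ _ _ _ (fun j h => _)) => j; apply: fsuppD; apply: fsuppZ => //; exact: fsupp_shift.
- apply: fsupp_sum => j; apply: fsuppZ; apply: fsuppD; apply: fsuppZ => //; exact: fsuppM.
rewrite -expr2 /opT /op; apply: le_trans (sqr_sum_le _) _.
rewrite mulr_sumr; apply: ler_sum => j _; rewrite -/k.
have := mulr_ge0 (ler0n R #|J| : 0 <= k) (sqr_ge0 (a j i * w j h - b j i * w j (h * (c j i)^-1)%g)).
nra.
Qed.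

End Op.

Definition lin I J (X : (I -> G -> R) -> J -> G -> R) :=
  forall t y z, X (comb t y z) = comb t (X y) (X z).
Definition tr I (g : G) (y : I -> G -> R) : I -> G -> R := fun i h => y i (g * h)%g.
Definition eqv I J (X : (I -> G -> R) -> J -> G -> R) :=
  forall g y, X (tr g y) = tr g (X y).
Definition bas I (k : I) : I -> G -> R := fun i h => ((i == k) && (h == 1%g))%:R.

Lemma lin_sum I J (X : (I -> G -> R) -> J -> G -> R) (K : Type) (r : seq K)
    (t : K -> R) (F : K -> I -> G -> R) : lin X ->
  X (fun i h => \sum_(k <- r) t k * F k i h) =
  (fun j h => \sum_(k <- r) t k * X (F k) j h).
Proof.
move=> lX; elim: r => [|k r IH].
  pose z : I -> G -> R := fun _ _ => 0.
  have zE : (fun i h => \sum_(k <- [::]) t k * F k i h) = z.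
    by apply/funext => i; apply/funext => h; rewrite big_nil.
  have zz : z = comb (-1) z z.
    by apply/funext => i; apply/funext => h; rewrite /comb /z mulr0 addr0.
  rewrite zE zz lX; apply/funext => i; apply/funext => h.
  by rewrite /comb mulN1r subrr big_nil.
have -> : (fun i h => \sum_(k0 <- k :: r) t k0 * F k0 i h) =
    comb (t k) (fun i h => \sum_(k0 <- r) t k0 * F k0 i h) (F k).
  by apply/funext => i; apply/funext => h; rewrite /comb big_cons addrC.
rewrite lX IH; apply/funext => i; apply/funext => h.
by rewrite /comb big_cons addrC.
Qed.

Lemma lin_op I J a b c : lin (@op I J a b c).
Proof.
move=> t y z; apply/funext => j; apply/funext => h; rewrite /op /comb mulr_sumr -big_split.
by apply: eq_bigr => i _ /=; ring.
Qed.

Lemma eqv_op I J a b c : eqv (@op I J a b c).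
Proof.
move=> g y; apply/funext => j; apply/funext => h; rewrite /op /tr.
by apply: eq_bigr => i _; rewrite mulgA.
Qed.

Lemma opTT I J a b c : @opT J I (fun i j => a j i) (fun i j => b j i) (fun i j => (c j i)^-1)%g = @op I J a b c.
Proof.
rewrite /opT; congr op; apply/funext => j; apply/funext => i; exact: invgK.
Qed.

Lemma fvec_bas I k : fvec (@bas I k).
Proof. by move=> i; exists [:: 1%g] => h; rewrite inE /bas => /negPf ->; rewrite andbF. Qed.

Lemma ip_bas I k (y : I -> G -> R) : ip (bas k) y = y k 1%g.
Proof.
rewrite /ip (bigD1 k) //= big1 ?addr0 => [|i /negPf ik].
  rewrite (@fsumE _ _ _ [:: 1%g]) // ?big_seq1 /bas ?eqxx ?mul1r //.
  by move=> h; rewrite inE => /negPf ->; rewrite andbF mul0r.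
rewrite (@fsumE _ _ _ [::]) // ?big_nil // => h _.
by rewrite /bas ik mul0r.
Qed.

Section Damped.
Variables (I J : finType) (a b : J -> I -> R) (c : J -> I -> G) (t : R).
Notation M := (op a b c).
Notation Mt := (opT a b c).

Definition damp (y : I -> G -> R) := comb (- t) y (Mt (M y)).

Lemma fvec_damp y : fvec y -> fvec (damp y).
Proof. by move=> fy; apply: fvec_comb => //; do 2!apply: fvec_op. Qed.

Lemma fvec_iter n y : fvec y -> fvec (iter n damp y).
Proof. by move=> fy; elim: n => //= n IH; apply: fvec_damp. Qed.

Lemma damp_sym y z : fvec y -> fvec z -> ip (damp y) z = ip y (damp z).
Proof.
move=> fy fz; rewrite ip_combl ?ip_combr //; try by do 2!apply: fvec_op.
congr (_ + _ * _); rewrite -(ip_adj _ _ _ fy); last by apply: fvec_op.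
by rewrite ipC -(ip_adj _ _ _ fz) ?(ipC (M y)) //; apply: fvec_op.
Qed.

Lemma iter_sym m n y z : fvec y -> fvec z ->
  ip (iter m damp y) (iter n damp z) = ip y (iter (m + n) damp z).
Proof.
move=> fy fz; elim: m n => //= m IH n.
rewrite damp_sym; try exact: fvec_iter.
by rewrite -iterS IH addnS.
Qed.

Lemma lin_damp : lin damp.
Proof.
move=> u y z; rewrite /damp lin_op /opT lin_op; apply/funext => i; apply/funext => h.
by rewrite /comb; ring.
Qed.

Lemma eqv_damp : eqv damp.
Proof. by move=> g y; rewrite /damp eqv_op /opT eqv_op. Qed.

Lemma lin_iter n : lin (iter n damp).
Proof. by elim: n => //= n IH u y z; rewrite !iterS IH lin_damp. Qed.

Lemma eqv_iter n : eqv (iter n damp).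
Proof. by elim: n => //= n IH g y; rewrite !iterS IH eqv_damp. Qed.

End Damped.

(** * Traces over the group ring *)

Section Trace.
Variables (I J : finType) (a b : J -> I -> R) (c : J -> I -> G) (t : R).
Notation M := (op a b c).
Notation Mt := (opT a b c).
Notation S := (damp a b c t).
Notation S' := (damp (fun i j => a j i) (fun i j => b j i) (fun i j => (c j i)^-1)%g t).

(** [M] intertwines 1 - t [Mt M] with 1 - t [M Mt]. *)
Lemma iter_intertwine n y : M (iter n S y) = iter n S' (M y).
Proof.
elim: n y => //= n IH y; rewrite -IH /damp lin_op; congr comb.
by rewrite -/(opT a b c (M _)) opTT.
Qed.

(* The trace property tau(AB) = tau(BA) of the coefficient of the identity. *)
Lemma trace_cycle (X : (I -> G -> R) -> J -> G -> R) : lin X -> eqv X ->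
  \sum_i Mt (X (bas i)) i 1%g = \sum_j X (Mt (bas j)) j 1%g.
Proof.
move=> lX eX; rewrite /opT /op exchange_big; apply: eq_bigr => j _ /=.
pose F (k : I * bool) := if k.2 then bas k.1 else tr (c j k.1)^-1%g (bas k.1).
pose u (k : I * bool) := if k.2 then a j k.1 else b j k.1.
have -> : (fun i h => \sum_l (a l i * bas j l h + b l i * bas j l (h * (c l i)^-1)%g)) =
    (fun i h => \sum_(k <- index_enum _) u k * F k i h) :> (I -> G -> R).
  apply/funext => i; apply/funext => h; rewrite (bigD1 j) //= big1 ?addr0; last first.
    by move=> l /negPf lj; rewrite /bas lj !mulr0 addr0.
  transitivity (\sum_i' \sum_b' u (i', b') * F (i', b') i h); last first.
    by rewrite pair_bigA; apply: eq_bigr => -[].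
  rewrite [RHS](bigD1 i) //= [X in _ = _ + X]big1 ?addr0; last first.
    by move=> i' ii'; rewrite big_bool /F /u /= /tr /bas eq_sym (negPf ii') !mulr0 addr0.
  rewrite big_bool /F /u /= /tr /bas !eqxx /=; congr (_ * _ + _ * _).
  congr (nat_of_bool _)%:R; apply/eqP/eqP => [e|e].
    by rewrite -[h](mulgVK (c j i)) e mul1g mulVg.
  have hc : h = c j i by apply: (mulgI (c j i)^-1%g); rewrite e mulVg.
  by rewrite hc mulgV.
rewrite lin_sum //=.
transitivity (\sum_i' \sum_b' u (i', b') * X (F (i', b')) j 1%g); last first.
  by rewrite pair_bigA; apply: eq_bigr => -[].
apply: eq_bigr => i _; rewrite big_bool /F /u /= eX /tr mul1g mulg1 //.
Qed.

(** The n-th powers minus the identity are the same polynomial without constant term in [Mt M] and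
    in [M Mt], hence have equal traces by [trace_cycle]; [#|I|] and [#|J|] are the traces of the
    identities. *)
Lemma trace_identity n :
  \sum_i iter n S (bas i) i 1%g - #|I|%:R = \sum_j iter n S' (bas j) j 1%g - #|J|%:R.
Proof.
elim: n => [|n IH] /=.
  rewrite -!sum1_card !natr_sum -!sumrB /= !big1 // => i _; by rewrite /bas !eqxx subrr.
have EI : \sum_i S (iter n S (bas i)) i 1%g =
    \sum_i iter n S (bas i) i 1%g - t * \sum_i Mt (iter n S' (M (bas i))) i 1%g.
  rewrite mulr_sumr -sumrB; apply: eq_bigr => i _.
  by rewrite /damp /comb mulNr -iter_intertwine.
have EJ : \sum_j S' (iter n S' (bas j)) j 1%g =
    \sum_j iter n S' (bas j) j 1%g - t * \sum_j iter n S' (M (Mt (bas j))) j 1%g.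
  rewrite mulr_sumr -sumrB; apply: eq_bigr => j _.
  rewrite -iterS iterSr {2}/damp lin_iter /comb mulNr opTT.
  by [].
rewrite EI EJ (trace_cycle (X := fun y => iter n S' (M y))).
- by rewrite addrAC IH addrAC.
- by move=> u y z; rewrite lin_op lin_iter.
- by move=> g y; rewrite eqv_op eqv_iter.
Qed.

End Trace.
End Vectors.

Arguments bas {R G I} k.

(** * Decay of the damped iteration *)

Section Decay.
Local Open Scope classical_set_scope.
Local Open Scope ring_scope.
Variables (R : realType) (G : groupType).

Lemma cvgn_sum (I : Type) (r : seq I) (u : I -> nat -> R) (l : I -> R) :
  (forall i, u i n @[n --> \oo] --> l i) ->
  (\sum_(i <- r) u i n) @[n --> \oo] --> \sum_(i <- r) l i.
Proof.
move=> ul; elim: r => [|i r IH].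
  rewrite big_nil; under eq_fun do rewrite big_nil.
  exact: cvg_cst.
rewrite big_cons; under eq_fun do rewrite big_cons.
exact: cvgD.
Qed.

Lemma cvgn_sqr_le (u : nat -> R) (v : nat -> R) :
  (forall n, (u n) ^+ 2 <= v n) -> v @ \oo --> 0 -> u @ \oo --> 0.
Proof.
move=> uv v0; apply/cvgrPdist_lt => e e0.
move/cvgrPdist_lt: v0 => /(_ (e ^+ 2)); rewrite exprn_gt0 // => /(_ isT).
apply: filterS => n; rewrite !sub0r !normrN => vn.
rewrite -(ltr_pXn2r (n := 2)) ?nnegrE ?normr_ge0 ?ltW // -normrX.
by rewrite ger0_norm ?sqr_ge0 // (le_lt_trans (uv n)) // (le_lt_trans (ler_norm _)).
Qed.

Variables (I J : finType) (a b : J -> I -> R) (c : J -> I -> G).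
Notation M := (op a b c).
Notation Mt := (opT a b c).

Definition l2bounded (y : I -> G -> R) :=
  exists C, forall i (s : seq G), uniq s -> \sum_(h <- s) (y i h) ^+ 2 <= C.

Hypothesis noker : forall y, l2bounded y -> (forall j h, M y j h = 0) ->
  forall i h, y i h = 0.

(* S = 1 - t M^* M is a contraction whose powers converge to the projection on
   the kernel of M. *)
Lemma damp_decay : exists t : R, forall k : I,
  (iter n (damp a b c t) (bas k) k 1%g) @[n --> \oo] --> (0 : R).
Proof.
have [C C0 MtC] := op_bound a b c; pose t := C^-1; exists t => k.
have t0 : 0 < t by rewrite invr_gt0.
pose e : I -> G -> R := bas k.
have fe : fvec e by apply: fvec_bas.
pose y n := iter n (damp a b c t) e.
have fy n : fvec (y n) by apply: fvec_iter.
have fMy n : fvec (M (y n)) by apply: fvec_op.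
have fMMy n : fvec (Mt (M (y n))) by apply: fvec_op.
pose u n := ip (y n) (y n).
pose v n := ip (M (y n)) (M (y n)).
have v0 n : 0 <= v n by apply: ip_ge0.
have yS n : y n.+1 = comb (- t) (y n) (Mt (M (y n))) by [].
have ipyy p q : ip (y p) (y q) = ip e (y (p + q)%N) by apply: iter_sym.
have ipS n : ip (y n) (y n.+1) = u n - t * v n.
  by rewrite yS ip_combr // -ip_adj // mulNr.
(* Expanding gives u (n+1) = u n - 2 t v n + t^2 |Mt M y n|^2, and t C = 1 bounds the last term by t
   v n. *)
have uS n : u n.+1 <= u n - t * v n.
  rewrite /u {1}yS ip_combl // ipS.
  rewrite [ip (Mt _) _]ipC -ip_adj // yS lin_op ip_combl //; last by apply: fvec_op.
  have -> : ip (M (Mt (M (y n)))) (M (y n)) = ip (Mt (M (y n))) (Mt (M (y n))).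
    exact: ip_adj.
  rewrite -/(u n) -/(v n).
  have := MtC _ (fMy n); rewrite -/(v n) => h.
  have tC : t * C = 1 by rewrite mulVf ?gt_eqF.
  have : t * t * ip (Mt (M (y n))) (Mt (M (y n))) <= t * v n.
    by rewrite -mulrA ler_pM2l // -[leRHS]mul1r -tC -mulrA ler_pM2l.
  move: (v n) (u n) (ip _ _) h => vn un x h; nra.
have udec : nonincreasing_seq u.
  apply/nonincreasing_seqP => n; apply: le_trans (uS n) _.
  by rewrite gerBl mulr_ge0 // ltW.
have u0 n : 0 <= u n by apply: ip_ge0.
have ucvg : cvgn u.
  by apply: nonincreasing_is_cvgn => //; exists 0 => _ [n _ <-].
pose L := limn u.
have uL n : L <= u n by apply: nonincreasing_cvgn_ge.
(* At even index this product is a squared norm; at odd index it is at least the next squared norm,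
   by [ipS] and [uS]. *)
have mL n : L <= ip e (y n).
  rewrite -[n]odd_double_half -addnn; set r := n./2.
  case: (odd n); last by rewrite add0n -ipyy; exact: uL.
  rewrite add1n -addnS -ipyy ipS; apply: le_trans (uS r); exact: uL.
have uLcvg : (u n - L) @[n --> \oo] --> 0.
  by rewrite -(subrr L); apply: cvgB => //; exact: cvg_cst.
(* The squared distance of [y p] and [y q] is u p + u q minus twice a product bounded below by [mL]:
   the iterates form a Cauchy sequence. *)
have dist p q i h : (y p i h - y q i h) ^+ 2 <= (u p - L) + (u q - L).
  have -> : y p i h - y q i h = comb (-1) (y p) (y q) i h by rewrite /comb mulN1r.
  have fpq : fvec (comb (-1) (y p) (y q)) by apply: fvec_comb.
  apply: le_trans (ip_ge1 i h fpq) _.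
  rewrite ip_combl // !ip_combr // (ipC (y q) (y p)) -/(u p) -/(u q) ipyy.
  have := mL (p + q)%N; lra.
have cvgy i h : cvgn (fun n => y n i h).
  apply/cauchy_cvgP; apply: cauchy_exP => eps eps0.
  move/cvgrPdist_lt : uLcvg => /(_ (eps ^+ 2 / 2)).
  rewrite divr_gt0 ?exprn_gt0 // => /(_ isT)[N _ HN].
  exists (y N i h); exists N => // n /= Nn.
  have close r : (N <= r)%N -> u r - L < eps ^+ 2 / 2.
    move=> /HN /=; rewrite sub0r normrN; exact: le_lt_trans (ler_norm _).
  rewrite -ball_normE /= -(ltr_pXn2r (n := 2)) ?nnegrE ?normr_ge0 ?ltW // -normrX.
  rewrite ger0_norm ?sqr_ge0 //; apply: le_lt_trans (dist _ _ _ _) _.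
  have := close _ (leqnn N); have := close _ Nn; lra.
pose z i h := limn (fun n => y n i h).
have zE : forall i h, z i h = 0.
  apply: noker.
    exists 1 => i s us.
    have lim : (\sum_(h <- s) (y n i h) ^+ 2) @[n --> \oo] --> \sum_(h <- s) (z i h) ^+ 2.
      apply: (@cvgn_sum _ s (fun h n => (y n i h) ^+ 2)) => h.
      by rewrite expr2; under eq_fun do rewrite expr2; apply: cvgM; exact: cvgy.
    apply: (cvgr_to_le lim).
    near=> n; apply: le_trans (ip_ge_seq i (fy n) us) _.
    apply: (@le_trans _ _ (u 0%N)); first exact: udec.
    by rewrite /u /= /e ip_bas /bas !eqxx.
  move=> j h.
  have Mz : M (y n) j h @[n --> \oo] --> M z j h.
    apply: (@cvgn_sum _ _ (fun i n => a j i * y n i h + b j i * y n i (h * c j i)%g)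
      (fun i => a j i * z i h + b j i * z i (h * c j i)%g)) => i.
    by apply: cvgD; apply: cvgMr; exact: cvgy.
  apply/esym/(cvg_unique _ _ Mz) => //.
  (* By [uS], v n is at most C times the decrement of u, which tends to 0; so the limit is in the
     kernel of [M]. *)
  apply: (@cvgn_sqr_le _ v) => [n|]; first exact: ip_ge1.
  apply: (@squeeze_cvgr _ _ _ _ (fun=> 0) (fun n => C * ((u n - L) - (u n.+1 - L)))).
  - near=> n; rewrite v0 /=; rewrite opprB addrA subrK.
    have := uS n; rewrite -(ler_pM2l C0) mulrBr mulrA mulfV ?gt_eqF // mul1r; lra.
  - exact: cvg_cst.
  rewrite -(mulr0 C) -[X in C * X](subrr 0); apply: cvgMr; apply: cvgB => //.
  by move: uLcvg; rewrite -(cvg_shiftS (fun n => u n - L)).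
by have := cvgy k 1%g; rewrite /= -/(z k 1%g) zE.
Unshelve. all: by end_near.
Qed.

(** The trace of an even power of 1 - t [M Mt] is a sum of squared norms, hence nonnegative, while
    that of 1 - t [Mt M] is eventually below 1. So [#|I| - #|J|] is less than 1. *)
Theorem l2_card : (#|I| <= #|J|)%N.
Proof.
have [t tP] := damp_decay; rewrite leqNgt; apply/negP => JI.
have s0 : (\sum_i iter n (damp a b c t) (bas i) i 1%g) @[n --> \oo] --> (0 : R).
  have := @cvgn_sum _ (index_enum I) (fun i n => iter n (damp a b c t) (bas i) i 1%g) (fun=> 0) tP.
  by rewrite [X in _ --> X]big1.
move/cvgrPdist_lt: s0 => /(_ 1 ltr01)[N _ /(_ (N + N)%N)/=].
rewrite leq_addr => /(_ isT); rewrite sub0r normrN => lt1.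
have := trace_identity a b c t (N + N).
set A := \sum_i _; set B := \sum_j _ => AB.
have B0 : 0 <= B.
  apply: sumr_ge0 => j _; rewrite -ip_bas -iter_sym; try exact: fvec_bas.
  by apply: ip_ge0; apply: fvec_iter; exact: fvec_bas.
have : #|J|%:R + 1 <= #|I|%:R :> R by rewrite natr1 ler_nat.
have : A < 1 by apply: le_lt_trans (ler_norm _) lt1.
rewrite -[A]/A; move: AB B0; lra.
Qed.

End Decay.

(** * Finite groups: vectors of zero sum *)

Section FiniteGroup.
Local Open Scope classical_set_scope.
Local Open Scope ring_scope.
Variables (R : realType) (G : groupType) (I J : finType).
Variables (a b : J -> I -> R) (c : J -> I -> G).

Lemma kernel_ex (m n : nat) (A : 'M[R]_(m, n)) : (n < m)%N ->
  exists2 x : 'rV_m, x != 0 & x *m A = 0.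
Proof.
move=> nm; have : kermx A != 0.
  by rewrite -mxrank_eq0 mxrank_ker -lt0n subn_gt0 (leq_ltn_trans (rank_leq_col A)).
by case/rowV0Pn => x /sub_kermxP xA x0; exists x.
Qed.

Lemma zero_sum_card (s : seq G) (g0 : G) : (forall h, h \in s) -> g0 != 1%g ->
  (forall y : I -> G -> R, (forall i, fsum (y i) = 0) ->
    (forall j h, op a b c y j h = 0) -> forall i h, y i h = 0) ->
  (#|I| <= #|J|)%N.
Proof.
move=> sG g01 inj; rewrite leqNgt; apply/negP => JI.
have fin (f : G -> R) : fsupp f by exists s => h; rewrite sG.
pose T := seq_sub [seq h <- s | h != 1%g].
have T1 (k : T) : val k != 1%g by have := valP k; rewrite mem_filter => /andP[].
have Tin h : h != 1%g -> exists k : T, val k = h.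
  move=> h1; have hs : h \in [seq h <- s | h != 1%g] by rewrite mem_filter h1 sG.
  by exists (SeqSub hs).
(* The differences of a point mass at a non-identity element and the one at 1 form a basis of the
   zero-sum vectors. *)
pose B (q : I * T) : I -> G -> R :=
  fun i h => (i == q.1)%:R * ((h == val q.2)%:R - (h == 1%g)%:R).
pose A : 'M[R]_(#|{: I * T}|, #|{: J * T}|) :=
  \matrix_(q, r) op a b c (B (enum_val q)) (enum_val r).1 (val (enum_val r).2).
have lt : (#|{: J * T}| < #|{: I * T}|)%N.
  rewrite !card_prod ltn_pmul2r //; have [k _] := Tin _ g01.
  by apply/card_gt0P; exists k.
have [x x0 xA] := kernel_ex A lt.
pose y : I -> G -> R := fun i h => \sum_q x 0 q * B (enum_val q) i h.
have opy : op a b c y = fun j h => \sum_q x 0 q * op a b c (B (enum_val q)) j h.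
  by apply: (lin_sum _ (x 0) (fun q => B (enum_val q))); exact: lin_op.
have fsB q i : fsum (B q i) = 0.
  rewrite /B fsumZ // (fsumD (g := fun h => - (h == 1%g)%:R)) //.
  have -> : (fun h : G => - (h == 1%g)%:R) = (fun h : G => (-1) * (h == 1%g)%:R :> R).
    by apply/funext => h; rewrite mulN1r.
  have d1 k : fsum (fun h : G => (h == k)%:R : R) = 1.
    rewrite (@fsumE _ _ _ [:: k]) ?big_seq1 ?eqxx // => h.
    by rewrite inE => /negPf ->.
  by rewrite fsumZ // !d1 mulN1r subrr mulr0.
have fsy i : fsum (y i) = 0.
  rewrite /y fsum_sum // big1 // => q _.
  by rewrite fsumZ // fsB mulr0.
have opy0 j (k : T) : op a b c y j (val k) = 0.
  rewrite opy; have /rowP/(_ (enum_rank (j, k))) := xA.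
  rewrite !mxE => e; rewrite -[RHS]e; apply: eq_bigr => q _.
  by rewrite !mxE enum_rankK.
(* Convolution preserves zero sums, so the equation at the identity follows from those at the
   elements of [T]; both sides of the count thus have the common factor [#|T|], nonzero because of
   [g0]. *)
have opy1 j : op a b c y j 1%g = 0.
  have : fsum (op a b c y j) = 0.
    rewrite /op fsum_sum // big1 // => i _; rewrite fsumD // !fsumZ //.
    by rewrite (fsum_shift (y i)) fsy !mulr0 addr0.
  rewrite (@fsumE _ _ _ [:: 1%g]) ?big_seq1 // => h; rewrite inE => /Tin[k <-].
  exact: opy0.
have y0 : forall i h, y i h = 0.
  apply: inj fsy _ => j h; have [->|/Tin[k <-]] := eqVneq h 1%g; first exact: opy1.
  exact: opy0.
case/eqP: x0; apply/rowP => q; rewrite mxE -(y0 (enum_val q).1 (val (enum_val q).2)).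
rewrite /y (bigD1 q) //= /B !eqxx (negPf (T1 _)) subr0 !mul1r mulr1 big1 ?addr0 //.
move=> r rq; case: eqP => [e1|]; last by rewrite mul0r mulr0.
case: eqP => [e2|_]; last by rewrite subrr !mulr0.
case/eqP: rq; apply: enum_val_inj; move: e1 e2.
by case: (enum_val r) (enum_val q) => [r1 r2] [q1 q2] /= -> /val_inj ->.
Qed.

End FiniteGroup.

Lemma uniq_seq_size (T : eqType) (m : nat) :
  (forall s : seq T, exists x, x \notin s) -> exists2 s : seq T, uniq s & size s = m.
Proof.
move=> inf; elim: m => [|m [s us <-]]; first by exists [::].
by have [x xs] := inf s; exists (x :: s); rewrite //= xs.
Qed.

(** Over the trivial group the constancy of solutions would say nothing, whence [g0]. Over a finite
    group constancy and zero sum give 0; over an infinite one constancy and square-summability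
    do. *)
Theorem constant_kernel_card (R : realType) (G : groupType) (I J : finType)
    (a b : J -> I -> R) (c : J -> I -> G) (g0 : G) : g0 != 1%g ->
  (forall y : I -> G -> R, (forall j h, op a b c y j h = 0) ->
    forall i h, y i h = y i 1%g) ->
  (#|I| <= #|J|)%N.
Proof.
move=> g01 cst.
have [[s sG]|inf] := pselect (exists s : seq G, forall h, h \in s).
  apply: (zero_sum_card sG g01) => y y0 /cst yc i h.
  have := y0 i; rewrite (fsumE (undup_uniq s)); last by move=> g; rewrite mem_undup sG.
  rewrite (eq_bigr (fun=> y i 1%g)) // big_const_seq count_predT iter_addr_0.
  move/eqP; rewrite mulrn_eq0 yc size_eq0 => /orP[/eqP e|/eqP//].
  by have := sG 1%g; rewrite -mem_undup e.
apply: (l2_card (a := a) (b := b) (c := c)) => y [C yC] /cst yc i h.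
apply/eqP/negPn/negP => yn0; have e0 : 0 < y i h ^+ 2 by rewrite exprn_even_gt0.
have [|s us ss] := @uniq_seq_size G (Num.bound `|C / y i h ^+ 2|).
  move=> s; apply: contra_notP inf => /forallNP sG; exists s => g.
  by apply/negPn/negP/sG.
have := yC i s us; rewrite (eq_bigr (fun=> y i h ^+ 2)); last by move=> g _; rewrite yc (yc i h).
rewrite big_const_seq count_predT iter_addr_0 ss -mulr_natl -ler_pdivlMr //.
rewrite leNgt => /negP; apply; apply: le_lt_trans (ler_norm _) _.
by rewrite archi_boundP.
Qed.

(** * Edge paths and continuous paths *)

Section Continuity.
Local Open Scope classical_set_scope.
Local Open Scope ring_scope.
Variables (R : realType) (X : topologicalType).
Implicit Types f g : X -> R.

Lemma cont_cst (a : R) : continuous (fun _ : X => a).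
Proof. by move=> x; exact: cvg_cst. Qed.

Lemma contD f g : continuous f -> continuous g -> continuous (fun x => f x + g x).
Proof. by move=> cf cg x; exact: cvgD (cf x) (cg x). Qed.

Lemma contB f g : continuous f -> continuous g -> continuous (fun x => f x - g x).
Proof. by move=> cf cg x; exact: cvgB (cf x) (cg x). Qed.

Lemma contM f g : continuous f -> continuous g -> continuous (fun x => f x * g x).
Proof. by move=> cf cg x; exact: cvgM (cf x) (cg x). Qed.

Lemma cont_norm f : continuous f -> continuous (fun x => `|f x|).
Proof. by move=> cf x; apply: cvg_norm; exact: cf. Qed.

Lemma cont_max f g : continuous f -> continuous g -> continuous (fun x => Num.max (f x) (g x)).
Proof. by move=> cf cg x; exact: (@continuous_max R X f g x (cf x) (cg x)). Qed.

Lemma cont_min f g : continuous f -> continuous g -> continuous (fun x => Num.min (f x) (g x)).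
Proof. by move=> cf cg x; exact: (@continuous_min R X f g x (cf x) (cg x)). Qed.

Lemma cont_sum (I : Type) (r : seq I) (f : I -> X -> R) :
  (forall i, continuous (f i)) -> continuous (fun x => \sum_(i <- r) f i x).
Proof.
move=> cf; elim: r => [|i r IH].
  by under eq_fun do rewrite big_nil; exact: cont_cst.
by under eq_fun do rewrite big_cons; apply: contD.
Qed.

Lemma cont_comp (f : X -> R) (g : R -> R) : continuous g -> continuous f ->
  continuous (fun x => g (f x)).
Proof. by move=> cg cf x; apply: (@continuous_comp _ _ _ f g); [exact: cf|exact: cg]. Qed.

Lemma cont_comp2 f g (F : R * R -> R) : continuous F -> continuous f -> continuous g ->
  continuous (fun x => F (f x, g x)).
Proof.
move=> cF cf cg x; apply: (@continuous_comp _ _ _ (fun x => (f x, g x)) F).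
  exact: (cvg_pair (cf x) (cg x)).
exact: cF.
Qed.

End Continuity.

Lemma cont_idR (R : realType) : continuous (fun t : R => t).
Proof. by move=> t; exact: cvg_id. Qed.

Lemma cont_fst (R : realType) : continuous (fun z : R * R => z.1).
Proof. by move=> z; exact: cvg_fst. Qed.

Lemma cont_snd (R : realType) : continuous (fun z : R * R => z.2).
Proof. by move=> z; exact: cvg_snd. Qed.

Section Bridge.
Local Open Scope classical_set_scope.
Local Open Scope ring_scope.
Variables (R : realType) (V : finType) (D : {set {set V}}).
Implicit Types (x y z : V -> R).

Definition pt x : Prop := realization R D x.
Definition supp x : {set V} := [set v | x v != 0]%SET.

(** The retraction of the line onto [0, 1]. Through it paths become maps on all of [R], and no
    subspace topology is needed in the homotopies below. *)
Definition clamp (t : R) : R := Num.max 0 (Num.min t 1).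

Lemma clamp_in t : clamp t \in `[0, 1]%classic.
Proof.
by rewrite inE /= in_itv /= /clamp le_max lexx /= ge_max ler01 ge_min lexx orbT.
Qed.

Lemma clampE t : 0 <= t <= 1 -> clamp t = t.
Proof. by move=> /andP[t0 t1]; rewrite /clamp (min_idPl t1) (max_idPr t0). Qed.

Lemma clamp_cont : continuous clamp.
Proof.
apply: cont_max; first exact: cont_cst.
by apply: cont_min; [exact: cont_idR|exact: cont_cst].
Qed.

Definition cl (t : R) : unit_interval R := SigSub (clamp_in t).

Lemma cl_cont : continuous cl.
Proof. by apply: continuous_comp_initial; exact: clamp_cont. Qed.

Lemma val_zero : val (zero : unit_interval R) = 0. Proof. by []. Qed.
Lemma val_one : val (one : unit_interval R) = 1. Proof. by []. Qed.

Lemma cl_val (s : unit_interval R) : cl (val s) = s.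
Proof.
apply: val_inj => /=; apply: clampE.
by have := valP s; rewrite inE /= in_itv.
Qed.

Lemma cl0 : cl 0 = zero.
Proof. by rewrite -val_zero cl_val. Qed.

Lemma cl1 : cl 1 = one.
Proof. by rewrite -val_one cl_val. Qed.

Lemma ui_val_cont : continuous (fun s : unit_interval R => val s : R).
Proof. exact: initial_continuous. Qed.

Notation T := (set_type (realization R D)).

Lemma T_pt (x : T) : pt (val x).
Proof. by have := valP x; rewrite inE. Qed.

Lemma coord_cont (X : topologicalType) (f : X -> T) : continuous f ->
  forall v, continuous (fun s => (val (f s) : V -> R) v).
Proof.
move=> cf v s.
apply: (@continuous_comp _ _ _ f (fun y : T => (val y : V -> R) v)); first exact: cf.
apply: (@continuous_comp _ _ _ (val : T -> {ptws V -> R}) (fun y : {ptws V -> R} => y v)).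
  exact: initial_continuous.
exact: (@proj_continuous V (fun=> R) v).
Qed.

Lemma cont_coord (X : topologicalType) (f : X -> T) :
  (forall v, continuous (fun s => (val (f s) : V -> R) v)) -> continuous f.
Proof.
move=> cf; apply: continuous_comp_initial => s.
apply/cvg_sup => v; move: s.
apply/(@continuousP _ (initial_topology (fun y : {ptws V -> R} => y v))) => A [B oB <-].
by have /continuousP/(_ _ oB) := cf v.
Qed.

End Bridge.

(** * Homotopies in the realization *)

Section Homotopies.
Local Open Scope classical_set_scope.
Local Open Scope ring_scope.
Variables (R : realType) (V : finType) (D : {set {set V}}).
Hypothesis Dsub : forall F G : {set V}, G \subset F -> F \in D -> G \in D.
Implicit Types (x y : V -> R) (f g h : R -> V -> R) (t s r : R).
Notation pt := (@pt R V D).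
Notation supp := (@supp R V).

Definition mix r x y : V -> R := fun v => (1 - r) * x v + r * y v.

Lemma supp_mix r x y : supp (mix r x y) \subset supp x :|: supp y.
Proof.
apply/fintype.subsetP => v; rewrite !inE; apply: contraNT; rewrite negb_or !negbK.
by move=> /andP[/eqP x0 /eqP y0]; rewrite /mix x0 y0 !mulr0 addr0.
Qed.

Lemma mix_pt r x y : pt x -> pt y -> supp x :|: supp y \in D -> 0 <= r <= 1 ->
  pt (mix r x y).
Proof.
move=> [x0 x1 _] [y0 y1 _] xy /andP[r0 r1]; split.
- by move=> v; rewrite addr_ge0 // mulr_ge0 // subr_ge0.
- by rewrite big_split /= -!mulr_sumr x1 y1; ring.
- by apply: Dsub xy; apply: supp_mix.
Qed.

Lemma mix0 x y : mix 0 x y = x.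
Proof. by apply/funext => v; rewrite /mix; ring. Qed.

Lemma mix1 x y : mix 1 x y = y.
Proof. by apply/funext => v; rewrite /mix; ring. Qed.

Lemma mixx r x : mix r x x = x.
Proof. by apply/funext => v; rewrite /mix; ring. Qed.

(** Homotopy of loops at [x] in coordinates: continuity is required on the whole plane, all other
    conditions on the unit square only. *)
Definition hom x f g := exists H : R * R -> V -> R,
  [/\ forall v, continuous (fun z => H z v),
      forall t s, 0 <= t <= 1 -> 0 <= s <= 1 -> pt (H (t, s)),
      forall t, 0 <= t <= 1 -> H (t, 0) = f t,
      forall t, 0 <= t <= 1 -> H (t, 1) = g t &
      forall s, 0 <= s <= 1 -> H (0, s) = x /\ H (1, s) = x].

Lemma I0 : 0 <= (0 : R) <= 1. Proof. by rewrite lexx ler01. Qed.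
Lemma I1 : 0 <= (1 : R) <= 1. Proof. by rewrite lexx ler01. Qed.
Hint Resolve I0 I1 : core.

Lemma hom_straight x f g :
  (forall v, continuous (fun t => f t v)) -> (forall v, continuous (fun t => g t v)) ->
  (forall t, 0 <= t <= 1 -> [/\ pt (f t), pt (g t) & supp (f t) :|: supp (g t) \in D]) ->
  f 0 = x -> f 1 = x -> g 0 = x -> g 1 = x -> hom x f g.
Proof.
move=> cf cg fg f0 f1 g0 g1; exists (fun z => mix z.2 (f z.1) (g z.1)); split.
- move=> v; rewrite /mix; apply: contD; apply: contM.
  + by apply: contB; [exact: cont_cst|exact: cont_snd].
  + by apply: (cont_comp (cf v)); exact: cont_fst.
  + exact: cont_snd.
  + by apply: (cont_comp (cg v)); exact: cont_fst.
- by move=> t s /fg[ft gt u] sI; apply: mix_pt.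
- by move=> t _; rewrite mix0.
- by move=> t _; rewrite mix1.
- by move=> s _; rewrite f0 f1 g0 g1 mixx.
Qed.

Lemma hom_sym x f g : hom x f g -> hom x g f.
Proof.
move=> [H [cH pH H0 H1 Hx]]; exists (fun z => H (z.1, 1 - z.2)); split.
- move=> v; apply: (cont_comp2 (cH v)); first exact: cont_fst.
  by apply: contB; [exact: cont_cst|exact: cont_snd].
- by move=> t s tI /andP[s0 s1]; apply: pH => //=; rewrite subr_ge0 s1 gerBl.
- by move=> t tI; rewrite /= subr0 H1.
- by move=> t tI; rewrite /= subrr H0.
- by move=> s /andP[s0 s1]; apply: Hx; rewrite /= subr_ge0 s1 gerBl.
Qed.

Lemma hom_trans x f g h : hom x f g -> hom x g h -> hom x f h.
Proof.
move=> [H [cH pH H0 H1 Hx]] [K [cK pK K0 K1 Kx]].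
pose lo s := Num.min (2 * s) 1; pose hi s := Num.max 0 (2 * s - 1).
have cpair (F : R * R -> V -> R) (k : R -> R) v : continuous k ->
    (forall v, continuous (fun z => F z v)) ->
    continuous (fun z : R * R => F (z.1, k z.2) v).
  move=> ck cF; apply: (cont_comp2 (cF v)); first exact: cont_fst.
  by apply: (cont_comp ck); exact: cont_snd.
have c2 : continuous (fun s : R => 2 * s).
  by apply: contM; [exact: cont_cst|exact: cont_idR].
have loE s : 0 <= s <= 1 -> s <= 2^-1 ->
    [/\ lo s = 2 * s, hi s = 0 & 0 <= 2 * s <= 1].
  move=> /andP[s0 s1] sh.
  have h1 : 2 * s <= 1 by lra.
  rewrite /lo /hi (min_idPl h1) (max_idPl _); last lra.
  by rewrite h1 mulr_ge0.
have hiE s : 0 <= s <= 1 -> 2^-1 <= s ->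
    [/\ lo s = 1, hi s = 2 * s - 1 & 0 <= 2 * s - 1 <= 1].
  move=> /andP[s0 s1] sh.
  have h1 : 1 <= 2 * s by lra.
  rewrite /lo /hi (min_idPr h1) (max_idPr _); last lra.
  by rewrite subr_ge0 h1 /=; split=> //; lra.
(* Adding both homotopies and subtracting their common stage avoids pasting continuous maps: in each
   half of the square one of the two terms cancels with [H (z.1, 1)]. *)
pose L z : V -> R := fun v => H (z.1, lo z.2) v + K (z.1, hi z.2) v - H (z.1, 1) v.
have Llo t s : 0 <= t <= 1 -> 0 <= s <= 1 -> s <= 2^-1 -> L (t, s) = H (t, 2 * s).
  move=> tI sI /(loE _ sI)[l hh _]; apply/funext => v.
  by rewrite /L /= l hh K0 // H1 // addrK.
have Lhi t s : 0 <= t <= 1 -> 0 <= s <= 1 -> 2^-1 <= s -> L (t, s) = K (t, 2 * s - 1).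
  move=> tI sI /(hiE _ sI)[l hh _]; apply/funext => v.
  by rewrite /L /= l hh addrAC subrr add0r.
exists L; split.
- move=> v; rewrite /L; apply: contB; [apply: contD|].
  + by apply: cpair => //; apply: cont_min => //; exact: cont_cst.
  + apply: cpair => //; apply: cont_max; first exact: cont_cst.
    by apply: contB => //; exact: cont_cst.
  + by apply: (cpair H (fun=> 1)) => //; exact: cont_cst.
- move=> t s tI sI; case: (leP s 2^-1) => sh.
    by rewrite Llo //; apply: pH => //; have [] := loE _ sI sh.
  by rewrite Lhi // ?ltW //; apply: pK => //; have [] := hiE _ sI (ltW sh).
- by move=> t tI; rewrite Llo ?mulr0 ?H0 // invr_ge0 ler0n.
- move=> t tI; rewrite Lhi //; last by rewrite invf_le1 ?ler1n.
  by rewrite mulr1 (_ : 2 - 1 = 1) ?K1 //; ring.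
- move=> s sI; case: (leP s 2^-1) => sh.
    by rewrite !Llo //; apply: Hx; have [] := loE _ sI sh.
  by rewrite !Lhi // ?ltW //; apply: Kx; have [] := hiE _ sI (ltW sh).
Qed.

Definition hat t : R := Num.max 0 (1 - `|t|).

Lemma hat_cont : continuous hat.
Proof.
apply: cont_max; first exact: cont_cst.
by apply: contB; [exact: cont_cst|apply: cont_norm; exact: cont_idR].
Qed.

Lemma hat_out t : 1 <= `|t| -> hat t = 0.
Proof. by move=> t1; rewrite /hat (max_idPl _) // subr_le0. Qed.

Lemma hat_in t : `|t| <= 1 -> hat t = 1 - `|t|.
Proof. by move=> t1; rewrite /hat (max_idPr _) // subr_ge0. Qed.

Lemma hat_sum (M : nat) (T : R) : 0 <= T -> T <= M.+1%:R ->
  exists i r, [/\ (i <= M)%N, 0 <= r <= 1, T = i%:R + r &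
    forall F : nat -> R, \sum_(j < M.+2) hat (T - j%:R) * F j = (1 - r) * F i + r * F i.+1].
Proof.
move=> T0 TM.
have [i [iM iT Ti]] : exists i, [/\ (i <= M)%N, i%:R <= T & T <= i.+1%:R].
  elim: M TM => [|M IH] TM; first by exists 0%N.
  case: (leP T M.+1%:R) => [/IH[i [iM iT Ti]]|MT].
    by exists i; split=> //; apply: leqW.
  by exists M.+1; split=> //; apply: ltW.
exists i, (T - i%:R); split=> //.
- by rewrite subr_ge0 iT lerBlDl natr1.
- by rewrite addrC subrK.
move=> F; have iM2 : (i < M.+2)%N by apply: leqW.
rewrite (bigD1 (Ordinal iM2)) //= (bigD1 (Ordinal (iM : (i.+1 < M.+2)%N))) /=; last first.
  by rewrite -val_eqE /= eqn_leq ltnn.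
rewrite big1 ?addr0 => [|j].
  have e : i.+1%:R = i%:R + 1 :> R by rewrite natr1.
  rewrite e in Ti *; congr (_ * _ + _ * _).
    by rewrite hat_in ger0_norm ?subr_ge0 // lerBlDl.
  rewrite hat_in; first by rewrite ler0_norm; [ring|lra].
  by rewrite ler0_norm; lra.
rewrite -!val_eqE /= => /andP[ji ji1].
rewrite hat_out ?mul0r //.
have [jl|jl|e] := ltngtP j i; last by rewrite e eqxx in ji.
  have : (j.+1%:R : R) <= i%:R by rewrite ler_nat.
  by rewrite -natr1 => h; rewrite ger0_norm; lra.
have : (i.+2%:R : R) <= j%:R.
  by rewrite ler_nat ltn_neqAle jl andbT eq_sym.
rewrite -(natr1 i.+1) => h; rewrite ler0_norm; lra.
Qed.

(** The polygon that is at [Z j] at time j / M. The tent functions make it a single formula,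
    continuous without case distinction. *)
Definition Q (M : nat) (Z : nat -> V -> R) : R -> V -> R :=
  fun t v => \sum_(j < M.+1) hat (M%:R * t - j%:R) * Z j v.

Lemma Q_cont M Z v : continuous (fun t => Q M Z t v).
Proof.
apply: cont_sum => j; apply: contM; last exact: cont_cst.
apply: (cont_comp hat_cont); apply: contB; last exact: cont_cst.
by apply: contM; [exact: cont_cst|exact: cont_idR].
Qed.

Lemma Q_mix M t : 0 <= t <= 1 -> exists i r,
  [/\ (i <= M)%N, 0 <= r <= 1, M.+1%:R * t = i%:R + r &
    forall Z, Q M.+1 Z t = mix r (Z i) (Z i.+1)].
Proof.
move=> /andP[t0 t1]; have [||i [r [iM rI e E]]] := @hat_sum M (M.+1%:R * t).
- by rewrite mulr_ge0.
- by rewrite ger_pMr // ltr0n.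
exists i, r; split=> // Z; apply/funext => v; exact: (E (fun j => Z j v)).
Qed.

Lemma Q_start M Z : Q M.+1 Z 0 = Z 0%N.
Proof.
have [i [r [iM /andP[r0 r1] e ->]]] := Q_mix M I0.
have i0 : 0 <= (i%:R : R) by [].
have r00 : r = 0 by move: e; rewrite mulr0; lra.
have : (i%:R : R) = 0 by move: e; rewrite mulr0; lra.
move/eqP; rewrite pnatr_eq0 => /eqP ->.
by rewrite r00 mix0.
Qed.

Lemma Q_end M Z : Q M.+1 Z 1 = Z M.+1.
Proof.
have [i [r [iM /andP[r0 r1] e ->]]] := Q_mix M I1.
have iM' : (i%:R : R) <= M%:R by rewrite ler_nat.
have M1 : M.+1%:R = M%:R + 1 :> R by rewrite natr1.
have r11 : r = 1 by move: e; rewrite mulr1 M1; lra.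
have : (i%:R : R) = M%:R by move: e; rewrite mulr1 M1; lra.
move/eqP; rewrite eqr_nat => /eqP ->.
by rewrite r11 mix1.
Qed.

Definition seg x y := [/\ pt x, pt y & supp x :|: supp y \in D].

Lemma hom_contiguous x M (Z Z' : nat -> V -> R) :
  (forall i, (i <= M.+1)%N -> pt (Z i) /\ pt (Z' i)) ->
  (forall i, (i <= M)%N ->
    (supp (Z i) :|: supp (Z i.+1)) :|: (supp (Z' i) :|: supp (Z' i.+1)) \in D) ->
  Z 0%N = x -> Z' 0%N = x -> Z M.+1 = x -> Z' M.+1 = x ->
  hom x (Q M.+1 Z) (Q M.+1 Z').
Proof.
move=> pZ con Z0 Z0' Z1 Z1'; apply: hom_straight; rewrite ?Q_start ?Q_end //; try by move=> v; exact: Q_cont.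
move=> t tI; have [i [r [iM rI _ E]]] := Q_mix M tI; rewrite !E.
have [pi pi'] := pZ _ (leqW iM); have [pi1 pi1'] := pZ _ (iM : (i.+1 <= M.+1)%N).
have h := con _ iM; split.
- by apply: mix_pt => //; apply: Dsub h; apply: finset.subsetUl.
- by apply: mix_pt => //; apply: Dsub h; apply: finset.subsetUr.
- by apply: Dsub h; apply: finset.setUSS; apply: supp_mix.
Qed.

(** The polygon rests at [x] after step [m], so running it with more segments only changes the
    speed, which the homotopy interpolates linearly. *)
Lemma hom_reparam x m M (Z : nat -> V -> R) : (m <= M)%N ->
  (forall i, (m < i)%N -> Z i = x) -> Z 0%N = x ->
  (forall i, seg (Z i) (Z i.+1)) ->
  hom x (Q m.+1 Z) (Q M.+1 Z).
Proof.
move=> mM Zx Z0 sZ.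
pose q (T : R) v := \sum_(j < M.+2) hat (T - j%:R) * Z j v.
have qP T : 0 <= T <= M.+1%:R -> pt (q T) /\ (m.+1%:R <= T -> q T = x).
  move=> /andP[T0 TM]; have [i [r [iM rI e E]]] := hat_sum T0 TM.
  have -> : q T = mix r (Z i) (Z i.+1) by apply/funext => v; exact: (E (fun j => Z j v)).
  have [p1 p2 p12] := sZ i; split; first exact: mix_pt.
  move=> mT; have [mi|im] := ltnP m i; first by rewrite !Zx ?mixx // leqW.
  have : (i%:R : R) <= m%:R by rewrite ler_nat.
  move: mT rI; rewrite e -natr1 => h1 /andP[_ h2] h3.
  have r1 : r = 1 by lra.
  have : (m%:R : R) <= i%:R by lra.
  by rewrite ler_nat => mi; rewrite r1 mix1 Zx.
have mM' : (m.+1%:R : R) <= M.+1%:R by rewrite ler_nat.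
have m0 : 0 <= (m.+1%:R : R) by [].
have speed s : 0 <= s <= 1 -> m.+1%:R <= (1 - s) * m.+1%:R + s * M.+1%:R <= M.+1%:R.
  move: m.+1%:R M.+1%:R mM' m0 => a b ab a0 /andP[s0 s1].
  by apply/andP; split; nra.
exists (fun z => q (((1 - z.2) * m.+1%:R + z.2 * M.+1%:R) * z.1)); split.
- move=> v; apply: cont_sum => j; apply: contM; last exact: cont_cst.
  apply: (cont_comp hat_cont); apply: contB; last exact: cont_cst.
  apply: contM; last exact: cont_fst.
  apply: contD; apply: contM; try exact: cont_cst; last exact: cont_snd.
  by apply: contB; [exact: cont_cst|exact: cont_snd].
- move=> t s /andP[t0 t1] /speed/andP[sm sM] /=; apply: (qP _ _).1.
  have s0 := le_trans m0 sm.
  by rewrite mulr_ge0 // (le_trans _ sM) // ler_piMr.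
- move=> t /andP[t0 t1]; apply/funext => v /=.
  rewrite subr0 mul1r mul0r addr0 /q /Q.
  have mM2 : (m.+2 <= M.+2)%N by [].
  rewrite [RHS](big_ord_widen M.+2 (fun j => hat (m.+1%:R * t - j%:R) * Z j v)) //=.
  rewrite [LHS](bigID (fun j : 'I_M.+2 => (j < m.+2)%N)) /= [X in _ + X]big1 ?addr0 // => j.
  rewrite -leqNgt => mj; rewrite hat_out ?mul0r //.
  have : (m.+2%:R : R) <= j%:R by rewrite ler_nat.
  rewrite -natr1 => h; have : m.+1%:R * t <= m.+1%:R by rewrite ger_pMr // ltr0n.
  by move=> h'; rewrite ler0_norm; lra.
- move=> t tI; rewrite /= subrr mul0r add0r mul1r; exact/funext.
- move=> s /speed/andP[sm sM] /=; rewrite mulr0 mulr1; split.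
    have -> : q 0 = Q M.+1 Z 0 by apply/funext => v; rewrite /q /Q mulr0.
    by rewrite Q_start.
  by apply: (qP _ _).2 => //; rewrite sM (le_trans m0 sm).
Qed.

End Homotopies.

Ltac sub_faces := apply/fintype.subsetP => ?; rewrite !finset.inE;
  repeat case/orP; move=> ->; rewrite ?orbT //.

(** * Polygons and edge paths *)

Section Polygons.
Local Open Scope classical_set_scope.
Local Open Scope ring_scope.
Variables (R : realType) (V : finType) (D : {set {set V}}).
Hypothesis Dsub : forall F G : {set V}, G \subset F -> F \in D -> G \in D.
Variable x : V -> R.
Hypothesis px : pt D x.
Notation seg := (seg D).
Notation hom := (hom D x).
Notation pt := (@pt R V D).
Notation supp := (@supp R V).
Implicit Types (z : seq (V -> R)) (u b w : V -> R).

(* A finite sequence of points is continued by the base point x. *)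
Definition valid z := nth x z 0 = x /\ forall i, seg (nth x z i) (nth x z i.+1).

(** Asking for all large M makes sequences of different lengths comparable, since both are padded by
    the base point. *)
Definition peq z z' := exists M0 : nat, forall M, (M0 <= M)%N ->
  hom (Q M.+1 (nth x z)) (Q M.+1 (nth x z')).

Lemma peq_sym z z' : peq z z' -> peq z' z.
Proof. by move=> [M0 h]; exists M0 => M /h; apply: hom_sym. Qed.

Lemma peq_trans z z' z'' : peq z z' -> peq z' z'' -> peq z z''.
Proof.
move=> [M h] [M' h']; exists (maxn M M') => N; rewrite geq_max => /andP[/h hN /h'].
exact: hom_trans.
Qed.

Lemma seg_sym u w : seg u w -> seg w u.
Proof. by move=> [pu pw]; rewrite finset.setUC. Qed.

Lemma segxx u w : seg u w -> seg u u.
Proof. by move=> [pu _ uw]; split=> //; apply: Dsub uw; rewrite finset.setUid finset.subsetUl. Qed.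

Lemma pt_supp u : pt u -> supp u \in D.
Proof. by case. Qed.

Lemma peq_contiguous z z' : valid z -> valid z' ->
  (forall i, (supp (nth x z i) :|: supp (nth x z i.+1)) :|:
    (supp (nth x z' i) :|: supp (nth x z' i.+1)) \in D)%SET ->
  peq z z'.
Proof.
move=> [z0 sz] [z0' sz'] con; exists (size z + size z')%N => M le.
apply: (hom_contiguous Dsub) => //.
- by move=> i _; have [] := sz i; have [] := sz' i.
- by rewrite nth_default // (leq_trans _ (leqW le)) // leq_addr.
- by rewrite nth_default // (leq_trans _ (leqW le)) // leq_addl.
Qed.

Lemma peq_nth z z' : valid z -> nth x z =1 nth x z' -> peq z z'.
Proof.
move=> vz e; have vz' : valid z'.
  by have [z0 sz] := vz; split=> [|i]; rewrite -!e.
apply: peq_contiguous => // i; rewrite -!e finset.setUid.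
by have [_ /(_ i)[]] := vz.
Qed.

Lemma peq_refl z : valid z -> peq z z.
Proof. by move=> vz; apply: peq_nth. Qed.

Lemma nth_change l b b' l2 i : i != size l ->
  nth x (l ++ b :: l2) i = nth x (l ++ b' :: l2) i.
Proof.
move=> ne; rewrite !nth_cat; case: ltngtP ne => // il _.
by move: il; rewrite -subn_gt0; case: (i - size l)%N.
Qed.

Lemma nth_at0 l u c l2 : nth x (rcons l u ++ c :: l2) (size l) = u.
Proof. by rewrite nth_cat size_rcons ltnSn nth_rcons ltnn eqxx. Qed.

Lemma nth_at1 l u c l2 : nth x (rcons l u ++ c :: l2) (size l).+1 = c.
Proof. by rewrite nth_cat size_rcons ltnn subnn. Qed.

Lemma nth_at2 l u c l2 : nth x (rcons l u ++ c :: l2) (size l).+2 = head x l2.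
Proof. by rewrite nth_cat size_rcons ltnNge leqnSn /= subSn // subnn /= nth0. Qed.

Lemma peq_change l u b b' l2 :
  valid (rcons l u ++ b :: l2) -> valid (rcons l u ++ b' :: l2) ->
  ((supp u :|: supp b) :|: (supp u :|: supp b') \in D)%SET ->
  ((supp b :|: supp (head x l2)) :|: (supp b' :|: supp (head x l2)) \in D)%SET ->
  peq (rcons l u ++ b :: l2) (rcons l u ++ b' :: l2).
Proof.
move=> v1 v2 h1 h2; apply: peq_contiguous => // i.
have [->|n0] := eqVneq i (size l); first by rewrite !nth_at0 !nth_at1.
have [->|n1] := eqVneq i (size l).+1; first by rewrite !nth_at1 !nth_at2.
have e j : j != (size l).+1 ->
    nth x (rcons l u ++ b :: l2) j = nth x (rcons l u ++ b' :: l2) j.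
  by move=> ne; apply: nth_change; rewrite size_rcons.
by rewrite !e // finset.setUid; have [_ /(_ i)[]] := v2.
Qed.

Fixpoint chain u z : Prop := if z is b :: z' then seg u b /\ chain b z' else seg u x.

Lemma chainP u z : chain u z -> forall i, seg (nth x (u :: z) i) (nth x (u :: z) i.+1).
Proof.
elim: z u => [|b z IH] u /=.
  move=> ux [|i] //=; rewrite !nth_nil.
  by split=> //; rewrite finset.setUid; apply: pt_supp.
by move=> [ub /IH h] [|i] //=; apply: h.
Qed.

Lemma chain_of u z : (forall i, seg (nth x (u :: z) i) (nth x (u :: z) i.+1)) -> chain u z.
Proof.
elim: z u => [|b z IH] u h; first exact: (h 0%N).
by split; [exact: (h 0%N)|apply: IH => i; exact: (h i.+1)].
Qed.

Lemma valid_chain z : valid (x :: z) <-> chain x z.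
Proof. by split=> [[_ /chain_of]|h] //; split=> //; apply: chainP. Qed.

Lemma valid_dup l w l2 : valid (l ++ w :: l2) -> valid (l ++ w :: w :: l2).
Proof.
move=> [z0 sz].
have E i : nth x (l ++ w :: w :: l2) i =
    nth x (l ++ w :: l2) (if (i <= size l)%N then i else i.-1).
  rewrite !nth_cat; case: (ltngtP i (size l)) => il; rewrite ?il ?ltnn ?subnn //.
  case: i il => //= i; rewrite ltnS => li; rewrite ltnNge li /=.
  by rewrite subSn.
split=> [|i]; first by rewrite E.
rewrite !E; have [il|li] := ltnP i (size l); first by rewrite ltnW.
have [->|ne] := eqVneq i (size l); first by rewrite leqnn; apply: segxx (sz _).
have {li ne} li : (size l < i)%N by rewrite ltn_neqAle eq_sym ne.
by rewrite leqNgt li /=; case: i li.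
Qed.

Lemma nth_pad z i : nth x (rcons z x) i = nth x z i.
Proof.
by rewrite nth_rcons; case: ltngtP => // [il|->]; rewrite nth_default // ltnW.
Qed.

Lemma valid_pad z : valid z -> valid (rcons z x).
Proof. by move=> [z0 sz]; split=> [|i]; rewrite !nth_pad. Qed.

Lemma valid_seg l u b l2 : valid (rcons l u ++ b :: l2) ->
  seg u b /\ seg b (head x l2).
Proof.
move=> [_ sz]; have := sz (size l); have := sz (size l).+1.
by rewrite nth_at0 nth_at1 nth_at2.
Qed.

(* Slide the repetition to the end, one vertex at a time. *)
Lemma peq_dup l w l2 : valid (l ++ w :: l2) -> peq (l ++ w :: l2) (l ++ w :: w :: l2).
Proof.
elim: l2 l w => [|c l2 IH] l w vz.
  have vx : valid (rcons l w ++ [:: x]) by rewrite cats1; apply: valid_pad; rewrite -cats1.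
  have vw : valid (rcons l w ++ [:: w]) by rewrite cat_rcons; apply: valid_dup.
  have [[_ _ wx] _] := valid_seg vx; have [[_ _ ww] _] := valid_seg vw.
  apply: (@peq_trans _ (rcons l w ++ [:: x])).
    by apply: peq_nth => // i; rewrite !cats1 nth_pad.
  rewrite -(cat_rcons w l [:: w]); apply: peq_change => //=.
    by apply: Dsub wx; sub_faces.
  by apply: Dsub wx; sub_faces.
have vz' : valid (rcons l w ++ c :: l2) by rewrite cat_rcons.
have vcc : valid (rcons l w ++ c :: c :: l2) by apply: valid_dup.
have vww : valid (rcons l w ++ w :: c :: l2) by rewrite cat_rcons; apply: valid_dup.
have [[_ _ wc] _] := valid_seg vz'.
rewrite -(cat_rcons w l (c :: l2)) -(cat_rcons w l (w :: c :: l2)).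
apply: peq_trans (IH _ _ vz') _.
by apply: peq_change => //=; apply: Dsub wc; sub_faces.
Qed.

(** Read backwards: repeat [u], then move the second copy to [b] inside the face spanned by [u], [b]
    and the next point. *)
Lemma peq_remove l u b l2 : valid (rcons l u ++ b :: l2) ->
  (supp u :|: supp b :|: supp (head x l2) \in D)%SET ->
  valid (rcons l u ++ l2) -> peq (rcons l u ++ b :: l2) (rcons l u ++ l2).
Proof.
move=> v1 h v2; apply: peq_sym; rewrite (cat_rcons u l l2) in v2 *.
apply: peq_trans (peq_dup v2) _; have vd := valid_dup v2.
rewrite -(cat_rcons u l (u :: l2)) in vd *.
by apply: peq_change => //; apply: Dsub h; apply/fintype.subsetP => v; rewrite !finset.inE;
  repeat case/orP; move=> ->; rewrite ?orbT.
Qed.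

Definition delta (v : V) : V -> R := fun k => (k == v)%:R.

Lemma supp_delta v : supp (delta v) = [set v]%SET.
Proof.
by apply/setP => k; rewrite !finset.inE /delta pnatr_eq0 eqb0 negbK.
Qed.

Lemma pt_delta v : [set v]%SET \in D -> pt (delta v).
Proof.
move=> vD; split=> [k||]; [by rewrite ler0n| |by rewrite -/(supp _) supp_delta].
rewrite (bigD1 v) //= /delta eqxx big1 ?addr0 // => k /negPf ->.
by [].
Qed.

Lemma seg_delta k v : edge D k v -> seg (delta k) (delta v).
Proof.
move=> e; have [kD vD] := edge_vertex Dsub e.
by split; [exact: pt_delta|exact: pt_delta|rewrite !supp_delta].
Qed.

Definition walk (s : seq V) := x :: map delta s.

Definition near_x v := (supp x :|: [set v] \in D)%SET.

Lemma near_seg v : near_x v -> seg x (delta v).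
Proof.
move=> h; split=> //; last by rewrite supp_delta.
by apply: pt_delta; apply: Dsub h; apply: finset.subsetUr.
Qed.

Lemma chain_walk a s : path (edge D) a s -> near_x (last a s) -> chain (delta a) (map delta s).
Proof.
elim: s a => [|v s IH] a /=; first by move=> _ /near_seg/seg_sym.
by move=> /andP[/seg_delta e ps] /(IH _ ps).
Qed.

Lemma valid_walk a s : near_x a -> path (edge D) a s -> near_x (last a s) ->
  valid (walk (a :: s)).
Proof.
move=> na ps nl; apply/valid_chain; split; first exact: near_seg.
exact: chain_walk.
Qed.

Lemma walk_cat a s t : walk (a :: s ++ t) =
  rcons (x :: map delta (belast a s)) (delta (last a s)) ++ map delta t.
Proof. by rewrite /walk -cat_cons (lastI a s) map_cat map_rcons. Qed.

(** The two elementary moves of [heq] become [peq_remove] and [peq_dup]. *)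
Lemma heq_peq a s t : heq D a s t -> near_x a -> path (edge D) a s ->
  near_x (last a s) -> peq (walk (a :: s)) (walk (a :: t)).
Proof.
move=> h na; elim: h => {s t} [s|s t h IH|s t r h1 IH1 h2 IH2|s v w t tr|s t e] ps nl.
- by apply: peq_refl; apply: valid_walk.
- have [e1 e2] := heq_path Dsub h.
  by apply: peq_sym; apply: IH; rewrite ?e1 ?e2.
- have [e1 e2] := heq_path Dsub h1.
  apply: (peq_trans (IH1 ps nl)); apply: IH2; by rewrite -?e1 -?e2.
- have [e1 e2] := heq_path Dsub (heq_tri t tr).
  have v1 := valid_walk na ps nl.
  have v2 : valid (walk (a :: s ++ w :: t)) by apply: valid_walk => //; rewrite -?e1 -?e2.
  move: v1 v2; rewrite !walk_cat => v1 v2; apply: peq_remove => //=.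
  by rewrite !supp_delta.
- have [e1 e2] := heq_path Dsub (heq_stut t e).
  have v1 := valid_walk na ps nl.
  have v2 : valid (walk (a :: s ++ t)) by apply: valid_walk => //; rewrite -?e1 -?e2.
  move: v1 v2; rewrite !walk_cat.
  move=> v1 v2; apply: peq_sym; rewrite !cat_rcons in v2 *.
  exact: peq_dup.
Qed.

Hypothesis null : forall a s, path (edge D) a s -> last a s = a -> heq D a s [::].

Lemma supp_nonempty : exists a, a \in supp x.
Proof.
have [_ x1 _] := px; apply/finset.set0Pn; apply/eqP => s0; move/eqP: x1.
rewrite big1 ?(eq_sym 0) ?oner_eq0 // => v _; apply/eqP.
by have /setP/(_ v) := s0; rewrite !finset.inE => /negbFE.
Qed.

(** The point [x] need not be a vertex, while [null] speaks of loops at vertices. A vertex [a] of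
    the support of [x] is inserted at both ends of the walk, the resulting edge loop at [a] is
    contracted, and [a] is removed. *)
Lemma walk_null (b : V) s : near_x b -> path (edge D) b s -> near_x (last b s) ->
  peq (walk (b :: s)) [:: x].
Proof.
move=> nb ps nl; have [a ax] := supp_nonempty.
have xa0 : (supp x :|: [set a])%SET = supp x.
  by apply/finset.setUidPl; rewrite finset.sub1set.
have xa v : (supp x :|: [set a] :|: [set v])%SET = (supp x :|: [set v])%SET.
  by rewrite xa0.
have na : near_x a by rewrite /near_x xa0 pt_supp.
have near_edge v : near_x v -> edge D a v.
  move=> h; apply: Dsub h; apply/fintype.subsetP => k; rewrite !finset.inE.
  by case/orP => [/eqP ->|->]; rewrite ?orbT //; move: ax; rewrite finset.inE => ->.
have pa : path (edge D) a (b :: s) by rewrite /= near_edge.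
have pl : path (edge D) a (rcons (b :: s) a).
  by rewrite rcons_path pa edgeC near_edge.
have v0 : valid (walk (b :: s)) by apply: valid_walk.
have v1 : valid (walk (a :: b :: s)) by apply: valid_walk.
have v2 : valid (walk (a :: rcons (b :: s) a)).
  by apply: valid_walk; rewrite ?last_rcons.
have v3 : valid (walk [:: a]) by apply: valid_walk.
have v4 : valid [:: x].
  by apply/valid_chain => /=; split=> //; rewrite finset.setUid pt_supp.
apply: (@peq_trans _ (walk (a :: b :: s))).
  apply: peq_sym; apply: (@peq_remove [::] x (delta a) (map delta (b :: s))) => //=.
  by rewrite !supp_delta xa.
apply: (@peq_trans _ (walk (a :: rcons (b :: s) a))).
  have E1 := walk_cat a (b :: s) [::]; rewrite cats0 in E1.
  have E2 := walk_cat a (b :: s) [:: a]; rewrite cats1 in E2.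
  rewrite E1 E2 in v1 v2 *; apply: peq_sym; apply: peq_remove => //=.
  by apply: Dsub nl; rewrite !supp_delta; apply/fintype.subsetP => k; rewrite !finset.inE;
     case/orP => [/orP[]|] => [->|/eqP ->|->]; rewrite ?orbT //; move: ax; rewrite finset.inE => ->.
apply: (@peq_trans _ (walk [:: a])).
  by apply: heq_peq => //; rewrite ?last_rcons //; apply: null; rewrite ?last_rcons.
apply: (@peq_remove [::] x (delta a) [::]) => //=.
by rewrite supp_delta xa0 finset.setUid pt_supp.
Qed.

End Polygons.

Section Connected.
Local Open Scope classical_set_scope.
Local Open Scope ring_scope.
Variables (R : realType) (V : finType) (K : {set {set V}}).

(** The total weight on [A] is continuous and takes only the values 0 and 1 on the realization, so
    the threshold 1/2 cuts out a clopen part. *)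
Lemma connected_monochromatic (A : {set V}) a v :
  connected (realization R K) ->
  (forall F u w, F \in K -> u \in F -> w \in F -> (u \in A) = (w \in A)) ->
  [set a]%SET \in K -> a \in A -> [set v]%SET \in K -> v \in A.
Proof.
move=> conn mono aK aA vK.
pose sg (x : {ptws V -> R}) : R := \sum_u (if u \in A then x u else 0).
have csg : continuous sg.
  apply: (@cont_sum R {ptws V -> R} V (index_enum V)
    (fun u (x : {ptws V -> R}) => if u \in A then x u else 0)) => u.
  case: (u \in A); last exact: cont_cst.
  exact: (@proj_continuous V (fun=> R) u).
have ptd u : [set u]%SET \in K -> realization R K (delta R u) by exact: pt_delta.
have sgd u : sg (delta R u) = (u \in A)%:R.
  rewrite /sg (bigD1 u) //= /delta eqxx big1 ?addr0 ?(fun_if) //.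
    by case: (u \in A).
  by move=> w /negPf ->; rewrite if_same.
have sg01 x : realization R K x -> sg x = 0 \/ sg x = 1.
  move=> px; have [u ux] := supp_nonempty px; have [x0 x1 xK] := px.
  have sameA w : x w != 0 -> (w \in A) = (u \in A).
    by move=> xw; apply: mono xK _ _ => //; rewrite finset.inE.
  have [uA|uA] := boolP (u \in A); [right|left].
    rewrite -x1; apply: eq_bigr => w _; case: ifP => // wA.
    by apply/esym/eqP/negPn/negP => /sameA; rewrite wA uA.
  apply: big1 => w _; case: ifP => // wA.
  by apply/eqP/negPn/negP => /sameA; rewrite wA (negPf uA).
have half0 : (0 : R) < 2^-1 by rewrite invr_gt0.
have half1 : (2^-1 : R) < 1 by rewrite invf_lt1 // ltr1n.
have eB : realization R K `&` [set x | 2^-1 < sg x] =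
    realization R K `&` [set x | 2^-1 <= sg x].
  apply/seteqP; split=> x /= [px]; first by move/ltW.
  by have [->|->] := sg01 _ px; rewrite ?half1 // leNgt half0.
have : realization R K `&` [set x | 2^-1 < sg x] = realization R K.
  apply: conn.
  - by exists (delta R a); split; [exact: ptd|rewrite /= sgd aA].
  - exists [set x | 2^-1 < sg x] => //.
    exact: (open_comp (fun x _ => csg x) (@open_gt R 2^-1)).
  - exists [set x | 2^-1 <= sg x] => //.
    exact: (closed_comp (fun x _ => csg x) (@closed_ge R 2^-1)).
move/seteqP => [_ /(_ _ (ptd _ vK))] [_ /=].
by rewrite sgd; case: (v \in A) => //; rewrite ltNge ltW.
Qed.

End Connected.

(** * Simplicial approximation of loops *)

Section Approximation.
Local Open Scope classical_set_scope.
Local Open Scope ring_scope.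
Variable R : realType.

Lemma uniform_cont (f : R -> R) (e : R) : continuous f -> 0 < e ->
  exists N : nat, forall m, (N <= m)%N -> forall t t', 0 <= t <= 1 ->
    `|t - t'| < m.+1%:R^-1 -> `|f t - f t'| < e.
Proof.
move=> cf e0.
have /compact_near_coveringP/(_ nat \oo (fun m t => forall t', `|t - t'| < m.+1%:R^-1 -> `|f t - f t'| < e)) := @segment_compact R 0 1.
case=> [|N _ HN]; last first.
  exists N => m Nm t t' tI; apply: HN => //=; by rewrite in_itv.
move=> x _.
have /cvgrPdist_lt/(_ (e / 2)) := cf x; rewrite divr_gt0 // => /(_ isT).
case=> eta /= eta0 Heta.
have eta2 : 0 < eta / 2 by rewrite divr_gt0.
exists (ball x (eta / 2), [set m | m.+1%:R^-1 < eta / 2]).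
  split; first exact: nbhsx_ballx.
  exact: (near_infty_natSinv_lt (PosNum eta2)).
move=> [t m] /= [xt mt] t' tt'.
have h1 : `|f x - f t| < e / 2.
  by apply: Heta => /=; apply: lt_le_trans xt _; lra.
have h2 : `|f x - f t'| < e / 2.
  apply: Heta => /=; rewrite (_ : x - t' = (x - t) + (t - t')); last by ring.
  apply: le_lt_trans (ler_normD _ _) _; rewrite [ltRHS]splitr.
  by apply: ltrD => //; apply: lt_trans tt' mt.
rewrite (_ : f t - f t' = (f x - f t') - (f x - f t)); last by ring.
by apply: le_lt_trans (ler_normB _ _) _; rewrite [ltRHS]splitr; apply: ltrD.
Qed.

Variables (V : finType) (D : {set {set V}}).
Hypothesis Dsub : forall F G : {set V}, G \subset F -> F \in D -> G \in D.
Notation T := (set_type (realization R D)).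
Notation supp := (@supp R V).

Lemma large_coord (x : V -> R) : pt D x -> exists v, #|V|%:R^-1 <= x v.
Proof.
move=> px; have [u _] := supp_nonempty px; have [_ x1 _] := px.
apply/not_existsP => small.
have V0 : (0 < #|V|)%N by apply/card_gt0P; exists u.
have : \sum_v x v < \sum_(v : V) #|V|%:R^-1.
  apply: ltr_sum; first by apply/hasP; exists u; rewrite // mem_index_enum.
  by move=> v _; rewrite ltNge; apply/negP; exact: small.
by rewrite x1 sumr_const -[X in _ < X]mulr_natl divff ?ltxx // pnatr_eq0 -lt0n.
Qed.

Lemma small_const (x : V -> R) : pt D x ->
  exists2 e, 0 < e & e <= #|V|%:R^-1 /\ forall v, x v != 0 -> e <= x v.
Proof.
move=> px; have [u _] := supp_nonempty px; have [x0 x1 _] := px.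
have V0 : (0 < #|V|)%N by apply/card_gt0P; exists u.
have N0 : 0 < (#|V|%:R : R)^-1 by rewrite invr_gt0 ltr0n.
have N1 : (#|V|%:R : R)^-1 <= 1 by rewrite invf_le1 ?ler1n ?ltr0n.
have xle v : x v <= 1.
  by rewrite -x1 (bigD1 v) //= lerDl sumr_ge0.
have pr_le1 (P : pred V) : \prod_(v | P v && (x v != 0)) x v <= 1.
  by apply: prodr_ile1 => v _; rewrite x0 xle.
have pr_ge0 (P : pred V) : 0 <= \prod_(v | P v && (x v != 0)) x v.
  by apply: prodr_ge0 => v _; exact: x0.
(* The coordinates of [x] are at most 1, so the product of the nonzero ones is below each of
   them. *)
exists (#|V|%:R^-1 * \prod_(v | xpredT v && (x v != 0)) x v).
  by rewrite mulr_gt0 // prodr_gt0 // => v /= xv; rewrite lt_neqAle eq_sym xv x0.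
split; first by rewrite ler_piMr // ltW.
move=> v xv; rewrite (bigD1 v) //=.
have P0 : 0 <= \prod_(i | (x i != 0) && (i != v)) x i by apply: prodr_ge0.
have P1 : \prod_(i | (x i != 0) && (i != v)) x i <= 1.
  by apply: prodr_ile1 => w _; rewrite x0 xle.
rewrite mulrCA ler_piMr // mulr_ile1 // ltW //.
Qed.

(* A fine enough subdivision replaces the loop by a polygon whose i-th vertex
   spans a face with every point of the loop at times near i / M. *)
Lemma loop_polygon (x : V -> R) (f : R -> V -> R) :
  (forall v, continuous (fun t => f t v)) -> (forall t, pt D (f t)) ->
  f 0 = x -> f 1 = x ->
  exists m (vf : nat -> V), let Z := nth x (walk x [seq vf i | i <- iota 1 m.+1]) in
    forall i t, (i <= m.+2)%N -> 0 <= t <= 1 -> `|m.+2%:R * t - i%:R| < 1 ->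
      supp (Z i) \subset supp (f t).
Proof.
move=> cf pf f0 f1; have px : pt D x by rewrite -f0.
have [e e0 [eN ex]] := small_const px.
have /fin_all_exists[N NP] v := uniform_cont (cf v) e0.
pose m := (\max_v N v)%N.
have mP v (t t' : R) : 0 <= t <= 1 -> `|t - t'| < m.+2%:R^-1 -> `|f t v - f t' v| < e.
  by move=> tI tt'; apply: (NP v m.+1) => //; apply: leqW; apply: leq_bigmax.
(* At time i / (m+2) the vertex [vf i] has weight at least 1 / [#|V|] >= e. Nearby weights differ by
   less than e, so it stays in the support. *)
have /choice[vf vfP] : forall i : nat, exists v, #|V|%:R^-1 <= f (i%:R / m.+2%:R) v.
  by move=> i; apply: large_coord.
exists m, vf => Z i t im tI close.
have M0 : 0 < (m.+2%:R : R) by rewrite ltr0n.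
have closeE : `|t - i%:R / m.+2%:R| < m.+2%:R^-1.
  rewrite -(ltr_pM2l M0) mulfV ?gt_eqF // -[X in X * _]gtr0_norm // -normrM.
  by rewrite mulrBr mulrCA mulfV ?gt_eqF // mulr1.
have closev v := mP v _ _ tI closeE.
have pos v : e <= f (i%:R / m.+2%:R) v -> v \in supp (f t).
  move=> le; rewrite finset.inE; apply: contraTneq (closev v) => ->.
  by rewrite sub0r normrN -leNgt; apply: le_trans le (ler_norm _).
(* At both ends the polygon is at [x] itself, all of whose nonzero weights are at least e. *)
have ends : f (i%:R / m.+2%:R) = x -> Z i = x -> supp (Z i) \subset supp (f t).
  move=> fx ->; apply/fintype.subsetP => v vx; apply: pos; rewrite fx; apply: ex.
  by move: vx; rewrite finset.inE.
have [i0|i0] := posnP i.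
  by apply: ends; rewrite /Z i0 ?mul0r.
move: im; rewrite leq_eqVlt => /orP[/eqP iM|im].
  apply: ends; first by rewrite iM divff ?gt_eqF.
  by rewrite /Z nth_default // iM /walk /= size_map size_map size_iota.
have -> : Z i = delta R (vf i).
  rewrite /Z /walk; case: i i0 im {close closeE closev pos ends} => // i _ im.
  rewrite -[LHS]/(nth x [seq delta R j | j <- [seq vf j | j <- iota 1 m.+1]] i).
  by rewrite -map_comp (nth_map 0%N) ?size_iota // nth_iota.
rewrite supp_delta finset.sub1set; apply: pos; apply: le_trans eN _; exact: vfP.
Qed.

Hypothesis null : forall a s, path (edge D) a s -> last a s = a -> heq D a s [::].

Lemma loop_null (x : V -> R) (f : R -> V -> R) :
  (forall v, continuous (fun t => f t v)) -> (forall t, pt D (f t)) ->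
  f 0 = x -> f 1 = x -> hom D x f (fun=> x).
Proof.
move=> cf pf f0 f1; have px : pt D x by rewrite -f0.
have [m [vf /=]] := loop_polygon cf pf f0 f1.
set s := [seq vf i | i <- iota 1 m.+1]; set Z := nth x (walk x s) => near.
have sizew : size (walk x s) = m.+2 by rewrite /= size_map size_map size_iota.
have Zx i : (m.+1 < i)%N -> Z i = x by move=> mi; rewrite /Z nth_default ?sizew.
have M0 : 0 < (m.+2%:R : R) by rewrite ltr0n.
(* At the midpoint of the i-th time interval both ends of the segment are supported in the support
   of [f t], so they span a face. *)
have sup2 i : (i < m.+2)%N -> (supp (Z i) :|: supp (Z i.+1))%SET \in D.
  move=> im; pose t : R := (i%:R + 2^-1) / m.+2%:R.
  have h0 : (0 : R) < 2^-1 by rewrite invr_gt0.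
  have h1 : (2^-1 : R) < 1 by rewrite invf_lt1 // ltr1n.
  have Mt : m.+2%:R * t = i%:R + 2^-1 by rewrite mulrCA divff ?mulr1 ?gt_eqF.
  have tI : 0 <= t <= 1.
    apply/andP; split; first by rewrite divr_ge0 ?addr_ge0 ?ler0n ?ltW.
    rewrite ler_pdivrMr // mul1r.
    apply: (@le_trans _ _ (i.+1%:R)); last by rewrite ler_nat.
    by rewrite -[i.+1%:R]natr1 lerD2l ltW.
  have [_ _ ft] := pf t; apply: Dsub ft; rewrite finset.subUset; apply/andP; split.
    apply: near => //; first exact: ltnW.
    by rewrite Mt addrAC subrr add0r gtr0_norm.
  apply: near => //.
  rewrite Mt -[i.+1%:R]natr1 ltr_norml; apply/andP; split; lra.
have ZS i : (i < m.+1)%N -> Z i.+1 = delta R (nth (vf 0) s i).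
  by move=> im; rewrite /Z -[LHS]/(nth x [seq delta R j | j <- s] i) (nth_map (vf 0)) // size_map size_iota.
have ptZ i : pt D (Z i).
  have [mi|im] := ltnP m.+1 i; first by rewrite Zx.
  case: i im => [|i] im //.
  have sd := sup2 i.+1 im; rewrite ZS //; apply: pt_delta => //; apply: (Dsub _ sd).
  apply: fintype.subset_trans (finset.subsetUl _ _).
  by rewrite ZS // supp_delta.
have segZ i : seg D (Z i) (Z i.+1).
  split=> //; have [im|mi] := ltnP i m.+2; first exact: sup2.
  by rewrite !Zx ?finset.setUid; [case: px|exact: leqW|].
have [M PM] : peq D x (walk x s) [:: x].
  have sE : s = vf 1%N :: [seq vf i | i <- iota 2 m] by [].
  have edgeZ i : (i < m)%N -> edge D (nth (vf 0) s i) (nth (vf 0) s i.+1).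
    move=> im; have [_ _] := segZ i.+1; rewrite !ZS //; last exact: ltnW.
    by rewrite !supp_delta.
  rewrite sE; apply: walk_null => //.
  - have [_ _] := segZ 0%N; by rewrite ZS // supp_delta sE.
  - apply/(pathP (vf 0)) => i; rewrite size_map size_iota => im.
    by have := edgeZ _ im; rewrite sE.
  - have [_ _] := segZ m.+1; rewrite ZS // (Zx m.+2) // supp_delta finset.setUC.
    rewrite /near_x (_ : nth _ _ _ = last (vf 1%N) [seq vf i | i <- iota 2 m]) //.
    by rewrite -[RHS]/(last (vf 0%N) s) -nth_last size_map size_iota.
(* At each time the support of the polygon lies in that of the loop, so a straight homotopy joins
   them. Then the number of segments is raised to one for which [PM] holds. *)
apply: (@hom_trans _ _ _ _ _ (Q m.+2 Z)).
  apply: hom_straight; rewrite ?Q_start ?Q_end ?(Zx m.+2) //; try by move=> v; exact: Q_cont.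
  move=> t tI; have [i [r [im /andP[r0 r1] e ->]]] := Q_mix V m.+1 tI.
  have sub : supp (mix r (Z i) (Z i.+1)) \subset supp (f t).
    apply/fintype.subsetP => v; rewrite finset.inE /mix => mv.
    have [rv|rv] := eqVneq (r * Z i.+1 v) 0; last first.
      have : v \in supp (Z i.+1).
        by rewrite finset.inE; apply: contraNneq rv => ->; rewrite mulr0.
      have r00 : r != 0 by apply: contraNneq rv => ->; rewrite mul0r.
      have rp : 0 < r by rewrite lt_neqAle eq_sym r00.
      apply/fintype.subsetP; apply: near => //.
      by rewrite e -[i.+1%:R]natr1 ltr_norml; apply/andP; split; lra.
    rewrite rv addr0 in mv; have : v \in supp (Z i).
      by rewrite finset.inE; apply: contraNneq mv => ->; rewrite mulr0.
    have r11 : r != 1 by apply: contraNneq mv => ->; rewrite subrr mul0r.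
    have rp : r < 1 by rewrite lt_neqAle r11.
    apply/fintype.subsetP; apply: near => //; first exact: leqW.
    by rewrite e ltr_norml; apply/andP; split; lra.
  have [pi pi1 pii] := segZ i.
  split=> //; first by apply: mix_pt => //; apply/andP.
  by rewrite (finset.setUidPl sub); case: (pf t).
pose M' := maxn M m.+1.
apply: (@hom_trans _ _ _ _ _ (Q M'.+1 Z)).
  by apply: hom_reparam => //; apply: leq_maxr.
apply: (@hom_trans _ _ _ _ _ (Q M'.+1 (nth x [:: x]))).
  by apply: PM; apply: leq_maxl.
have QE t : 0 <= t <= 1 -> Q M'.+1 (nth x [:: x]) t = x.
  move=> tI; have [i [r [im rI e ->]]] := Q_mix V M' tI.
  by case: i {im e} => [|i] /=; rewrite ?nth_nil mixx.
apply: hom_straight => //; rewrite ?QE ?lexx ?ler01 //.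
- by move=> v; exact: Q_cont.
- by move=> v; exact: cont_cst.
- by move=> t tI; rewrite QE // finset.setUid; split=> //; case: px.
Qed.

Definition T_of (y : V -> R) (py : pt D y) : T := SigSub (mem_set py : y \in realization R D).

Lemma null_path_homotopic (x : T) (p : {path unit_interval R from x to x in T}) :
  path_homotopic p (cst x).
Proof.
pose f (t : R) : V -> R := val (p (cl t)).
have cf v : continuous (fun t => f t v).
  have cp : continuous (p \o @cl R).
    by move=> t; apply: continuous_comp; [exact: cl_cont|exact: cts_fun].
  exact: (@coord_cont _ _ _ _ _ cp v).
have [H [cH pH H0 H1 Hx]] : hom D (val x) f (fun=> val x).
  apply: loop_null => //.
  - by move=> t; apply: T_pt.
  - by rewrite /f cl0 path_zero.
  - by rewrite /f cl1 path_one.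
have I01 (s : unit_interval R) : 0 <= (val s : R) <= 1.
  by have := valP s; rewrite inE /= in_itv.
pose K (z : unit_interval R * unit_interval R) : T :=
  T_of (pH (val z.1) (val z.2) (I01 z.1) (I01 z.2)).
exists K; split.
- apply: cont_coord => v; apply: (cont_comp2 (cH v)).
  + by move=> z; apply: (@continuous_comp _ _ _ fst (fun s : unit_interval R => val s : R)); [exact: cvg_fst|exact: ui_val_cont].
  + by move=> z; apply: (@continuous_comp _ _ _ snd (fun s : unit_interval R => val s : R)); [exact: cvg_snd|exact: ui_val_cont].
- by move=> s; apply: val_inj; apply: (etrans (H0 _ (I01 s))); congr (val (p _)); exact: cl_val.
- by move=> s; apply: val_inj; exact: (H1 _ (I01 s)).
- by move=> t; apply: val_inj; have [h _] := Hx _ (I01 t); exact: h.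
- by move=> t; apply: val_inj; have [_ h] := Hx _ (I01 t); exact: h.
Qed.

Hypothesis joined : forall a b, [set a]%SET \in D -> [set b]%SET \in D ->
  exists2 s, path (edge D) a s & last a s = b.

Lemma supp_vertex (x : V -> R) a : pt D x -> a \in supp x -> near_x D x a.
Proof.
move=> [_ _ xD] ax; rewrite /near_x (finset.setUidPl _) //.
by rewrite finset.sub1set.
Qed.

Lemma realization_path_connected : path_connected R T.
Proof.
move=> x y; have [px py] := (T_pt x, T_pt y).
have [a ax] := supp_nonempty px; have [b bY] := supp_nonempty py.
have na := supp_vertex px ax; have nb := supp_vertex py bY.
have [aD bD] : [set a]%SET \in D /\ [set b]%SET \in D.
  by split; [apply: Dsub na|apply: Dsub nb]; apply: finset.subsetUr.
have [s ps ls] := joined aD bD.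
(* Here [val y] takes the place of the base point, so the polygon starts at [x] and is continued by
   [y]. *)
have ch : chain D (val y) (val x) (delta R a :: map (@delta R V) s).
  split; first exact: near_seg.
  by apply: chain_walk; rewrite ?ls.
have segZ := chainP py ch.
set Z := nth (val y : V -> R) _ in segZ.
pose M := (size s).+1.
have QI t : 0 <= t <= 1 -> pt D (Q M.+1 Z t).
  move=> tI; have [i [r [_ rI _ ->]]] := Q_mix V M tI.
  by have [p1 p2 p12] := segZ i; apply: mix_pt.
have I01 (u : unit_interval R) : 0 <= (val u : R) <= 1.
  by have := valP u; rewrite inE /= in_itv.
pose F (u : unit_interval R) : T := T_of (QI _ (I01 u)).
have cF : continuous F.
  apply: cont_coord => v u.
  apply: (@continuous_comp _ _ _ (fun u : unit_interval R => val u : R) (fun t => Q M.+1 Z t v)).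
    exact: ui_val_cont.
  exact: Q_cont.
have F0 : F zero = x by apply: val_inj; rewrite /= Q_start.
have F1 : F one = y.
  by apply: val_inj; rewrite /= Q_end /Z nth_default //= size_map.
by constructor; exact: (mk_path cF F0 F1).
Qed.

Theorem realization_simply_connected : simply_connected R T.
Proof.
by split; [exact: realization_path_connected|move=> x p; exact: null_path_homotopic].
Qed.

End Approximation.

(** * The lower bound *)

Lemma g2E (V : finType) (D : {set {set V}}) d : (0 < d)%N -> finset.set0 \in D ->
  g2 d D = 'C(d.+2, 2)%:Z + (face_num D 2)%:Z - d.+1%:Z * (face_num D 1)%:Z.
Proof.
case: d => // d _ D0.
have f0 : face_num D 0 = 1%N.
  rewrite /face_num (_ : [set F in D | _]%SET = [set finset.set0]%SET) ?cards1 //.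
  apply/setP => F; rewrite !finset.inE cards_eq0 andbC.
  by have [->|//] := eqVneq F finset.set0.
rewrite /g2 /h_num !big_ord_recr !big_ord0 /= f0 !subn0 !subSS !subn0.
rewrite !binn !expr0 !expr1 sqrrN expr1n.
rewrite (_ : 'C(d.+2, d) = 'C(d.+2, 2)); last by rewrite -[LHS]bin_sub ?subSn ?subSnn ?subnn // -addn2 leq_addr.
rewrite !binSn.
rewrite (_ : 'C(d.+3, 2) = ('C(d.+2, 2) + d.+2)%N); last by rewrite binS bin1.
by lia.
Qed.

Section Count.
Variables (V : finType) (D : {set {set V}}).

Definition vertex := {v : V | [set v]%SET \in D}.
(** Pairs [(v, v)] are included, one for each vertex: they are the f_0 loop equations. The order on
    [V] picks one orientation of each proper edge. *)
Definition ordered_edge :=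
  {e : V * V | edge D e.1 e.2 && (enum_rank e.1 <= enum_rank e.2)%N}.

Lemma leq_card_vertex : (face_num D 1 <= #|{: vertex}|)%N.
Proof.
apply: leq_trans (leq_imset_card (fun v : vertex => [set val v]%SET) predT).
apply/subset_leq_card/fintype.subsetP => F; rewrite finset.inE => /andP[FD /cards1P[v e]].
rewrite e in FD *; apply/imsetP; exists (Sub v FD : vertex) => //.
Qed.

Lemma leq_card_ordered_edge :
  (#|{: ordered_edge}| <= face_num D 1 + face_num D 2)%N.
Proof.
pose f (e : ordered_edge) := [set (val e).1; (val e).2]%SET.
have inj : injective f.
  move=> [[u v] /= uv] [[u' v'] /= uv'] E; apply: val_inj => /=.
  case/andP: (uv) => _ le; case/andP: (uv') => _ le'.
  have /finset.set2P m1 : u' \in [set u; v]%SET by rewrite [[set u; v]%SET]E finset.set21.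
  have /finset.set2P m2 : v' \in [set u; v]%SET by rewrite [[set u; v]%SET]E finset.set22.
  have /finset.set2P m3 : u \in [set u'; v']%SET by rewrite -[[set u'; v']%SET]E finset.set21.
  have /finset.set2P m4 : v \in [set u'; v']%SET by rewrite -[[set u'; v']%SET]E finset.set22.
  have ant : u' = v -> v' = u -> u = v.
    by move=> e1 e2; apply/enum_rank_inj/val_inj/eqP; rewrite eqn_leq le -e1 -e2 le'.
  by suff [-> ->] : u = u' /\ v = v' by []; intuition congruence.
rewrite -(card_imset predT inj).
apply: leq_trans (leq_card_setU _ _); apply/subset_leq_card/fintype.subsetP => F.
case/imsetP => -[[u v] /= e] _ ->; rewrite !finset.inE /f /= cards2.
have /andP[uvD _] := e; rewrite [_ \in D]uvD /=.
by have [|] := eqVneq u v.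
Qed.
End Count.

Section Bound.
Variables (R : realType) (V : finType) (D : {set {set V}}) (k : nat) (a : V).
Hypothesis Dsub : forall F G : {set V}, G \subset F -> F \in D -> G \in D.
Hypothesis pure : forall F, facet D F -> #|F| = k.+2.
Hypothesis aD : [set a]%SET \in D.
Variable gam : V -> seq V.
Hypothesis gam_path : forall v, [set v]%SET \in D ->
  path (edge D) a (gam v) /\ last a (gam v) = v.
Hypothesis gam_a : gam a = [::].
Variable p : V -> 'rV[R]_k.+3.
Hypothesis pgen : gpos p.
Hypothesis prig : forall v, [set v]%SET \in D ->
  rigid (tri D v) p [set u | edge D v u]%SET.
Variable g0 : pi1 a Dsub.
Hypothesis g01 : g0 != 1%g.

Local Notation vertex := (vertex D).
Local Notation ordered_edge := (ordered_edge D).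
Local Notation index := (vertex * 'I_k.+3)%type.

Definition lcoef (e : ordered_edge) (i : index) : R :=
  (val i.1 == (val e).1)%:R * p (val e).2 0 i.2.
Definition rcoef (e : ordered_edge) (i : index) : R :=
  (val i.1 == (val e).2)%:R * p (val e).1 0 i.2.
Definition shift (e : ordered_edge) (_ : index) : pi1 a Dsub :=
  gain Dsub a gam (val e).1 (val e).2.

(** Elements of [V] that are not vertices of [D] get the value 0; no edge contains them. *)
Definition motion_of (y : index -> pi1 a Dsub -> R) v h : 'rV[R]_k.+3 :=
  if insub v is Some v' then \row_j y (v', j) h else 0.

Lemma sum_vertex (v : V) (q : 'rV[R]_k.+3) y h : [set v]%SET \in D ->
  \sum_(i : index) (val i.1 == v)%:R * q 0 i.2 * y i h = dot (motion_of y v h) q.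
Proof.
move=> vD; rewrite /motion_of insubT.
pose F (u : vertex) j := (val u == v)%:R * q 0 j * y (u, j) h.
rewrite (eq_bigr (fun i => F i.1 i.2)) => [|[]//].
rewrite -(pair_bigA _ F) /F /=.
rewrite (bigD1 (Sub v vD)) //= [X in _ + X]big1 ?addr0; last first.
  move=> u uv; rewrite big1 // => j _; rewrite (_ : val u == v = false) ?mul0r //.
  by apply: contraNF uv => /eqP e; apply/eqP/val_inj.
by apply: eq_bigr => j _; rewrite mxE eqxx mul1r mulrC.
Qed.

(** There are at least (k + 3) f_0 unknowns and at most f_0 + f_1 equations; the f_0 loops cancel
    one copy of f_0. *)
Lemma edge_bound : (k.+2 * face_num D 1 <= face_num D 2)%N.
Proof.
suff le : (#|{: index}| <= #|{: ordered_edge}|)%N.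
  rewrite card_prod card_ord in le.
  have := leq_trans le (leq_card_ordered_edge D).
  move=> /(leq_trans (leq_mul (leq_card_vertex D) (leqnn k.+3))).
  by rewrite mulnC mulSn leq_add2l.
apply: (@constant_kernel_card R _ _ _ lcoef rcoef shift g0 g01) => y y0 i h.
case: i => -[v vD] j.
have := @cover_motion_constant _ _ _ _ _ _ pure aD _ gam_path gam_a _ pgen prig (motion_of y).
move=> /(_ _ v h vD); rewrite /motion_of insubT => E.
suff /rowP/(_ j) : \row_j y (exist _ v vD, j) h = \row_j y (exist _ v vD, j) 1%g.
  by rewrite !mxE.
apply: E => {v vD j h} u v h uv.
have [uD vD] := edge_vertex Dsub uv.
have oriented u' v' h' : edge D u' v' -> (enum_rank u' <= enum_rank v')%N ->
  dot (motion_of y u' h') (p v') + dot (motion_of y v' (h' * gain Dsub a gam u' v')%g) (p u') = 0.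
  move=> e le; have [u'D v'D] := edge_vertex Dsub e.
  have eP : edge D (u', v').1 (u', v').2 && (enum_rank (u', v').1 <= enum_rank (u', v').2)%N.
    by rewrite /= e.
  have := y0 (exist _ (u', v') eP) h'.
  by rewrite /op big_split /= -!sum_vertex.
have [le|/ltnW le] := leqP (enum_rank u) (enum_rank v); first exact: oriented.
(* The equation of the reversed edge is taken in the sheet reached along [uv]; [gain u v] and
   [gain v u] are inverse to each other. *)
rewrite addrC; have := oriented v u (h * gain Dsub a gam u v)%g.
rewrite -mulgA (gain_flat Dsub gam_path) ?gain_self ?mulg1 //; last first.
  by rewrite /tri finset.setUAC finset.setUid.
by rewrite edgeC; apply.
Qed.

End Bound.

Theorem theorem9p2 (R : realType) (V : finType) (D : {set {set V}}) (d : nat)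
    (hd : (3 <= d)%N)
    (hD : normal_pseudomanifold R d D)
    (hconn : connected (realization R D))
    (hnsc : ~ simply_connected R (realization R D)) :
  'C(d.+2, 2)%:Z <= g2 d D.
Proof.
(* From here on d = k + 1, so 2 <= k, as Fogelsanger's theorem requires for the k-dimensional
   links. *)
case: d hd hD => // k k2 [[D0 Dsub] pure two lconn].
have joined a b : [set a]%SET \in D -> [set b]%SET \in D ->
    exists2 s, path (edge D) a s & last a s = b.
  move=> aD bD; pose A := [set v | connect (edge D) a v]%SET.
  have mono F u w : F \in D -> u \in F -> w \in F -> u \in A -> w \in A.
    rewrite !finset.inE => FD uF wF au; apply: connect_trans au (connect1 _).
    by apply: Dsub FD; rewrite finset.subUset !finset.sub1set uF.
  have : b \in A.
    apply: (connected_monochromatic hconn) aD _ bD; last by rewrite finset.inE.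
    by move=> F u w FD uF wF; apply/idP/idP; apply: mono FD _ _.
  by rewrite finset.inE => /connectP[s ps ->]; exists s.
(* If all edge loops were null-homotopic the realization would be simply connected; the base vertex
   [a] comes with an essential loop. *)
have [a [s [ps ls nh]]] : exists a s, [/\ path (edge D) a s, last a s = a & ~ heq D a s [::]].
  apply: contra_notP hnsc => none; apply: realization_simply_connected => // a s ps ls.
  by apply: contra_notP none => nh; exists a, s.
have aD : [set a]%SET \in D.
  case: s ps nh {ls} => [_ /(_ (heq_refl D a _))//|b s /= /andP[e _] _].
  by have [] := edge_vertex Dsub e.
have /choice[gam' gam'P] v : exists s, [set v]%SET \in D -> path (edge D) a s /\ last a s = v.
  have [vD|vD] := boolP ([set v]%SET \in D); last by exists [::].
  by have [t pt lt] := joined a v aD vD; exists t.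
(* The path to [a] itself has to be empty for [holonomy_onto]. *)
pose gam v := if v == a then [::] else gam' v.
have gam_path v : [set v]%SET \in D -> path (edge D) a (gam v) /\ last a (gam v) = v.
  by rewrite /gam; have [->|_] := eqVneq v a; last exact: gam'P.
have linkconn (G A : {set V}) b v : G \in D -> G != finset.set0 -> (#|G| < k.+1)%N ->
    (forall H u w, H \in link D G -> u \in H -> w \in H -> (u \in A) = (w \in A)) ->
    [set b]%SET \in link D G -> b \in A -> [set v]%SET \in link D G -> v \in A.
  move=> GD G0 Gk; exact: connected_monochromatic (lconn G GD G0 Gk).
have [p [pgen prig]] : exists p : V -> 'rV[R]_k.+3, gpos p /\
    forall v, [set v]%SET \in D -> rigid (tri D v) p [set u | edge D v u]%SET.
  apply: generic_ex; apply: generic_and; first exact: generic_gpos.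
  apply: generic_forall => v; have [vD|vD] := boolP ([set v]%SET \in D).
    by apply: genericW (star_rigid Dsub pure two linkconn R k2 vD) => p.
  exact: generic_true.
have g01 : cls Dsub a s != 1%g.
  apply/negP => /eqP e; apply: nh; apply: (@cls_inj _ _ Dsub); first by rewrite /loop ps ls /=.
    exact: loop_nil.
  exact: e.
have gam_a : gam a = [::] by rewrite /gam eqxx.
have := edge_bound pure aD gam_path gam_a pgen prig g01.
by rewrite g2E //; lia.
Qed.
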